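(* Let $V$ be a vector superspace over a field $\mathbb F$ of characteristic $0$, with an even endomorphism $\partial$. The collection of vector superspaces $P^{\mathrm{ch}}(n)$ ($n\ge0$), with the right actions of $S_n$, the composition maps and the unit $1\in P^{\mathrm{ch}}(1)$ described in the context, is a (linear, unital, symmetric) superoperad: the compositions are well defined, associative and unital, and equivariant with respect to the symmetric group actions.
   Context: $\langle\Phi\rangle$ denotes the image of an endomorphism $\Phi$; $z_{ij}=z_i-z_j$; $\mathcal O^{\star T}_n=\mathbb F[z_{ij}^{\pm1}]_{1\le i<j\le n}$ (so it equals $\mathbb F$ for $n=0,1$). $P^{\mathrm{ch}}(n)$ is the superspace of linear maps $X:V^{\otimes n}\otimes\mathcal O^{\star T}_n\to V[\lambda_1,\dots,\lambda_n]/\langle\partial+\lambda_1+\dots+\lambda_n\rangle$, written $X^{z_1,\dots,z_n}_{\lambda_1,\dots,\lambda_n}(v_1,\dots,v_n;f)$, satisfying for all $i,j$ the sesquilinearity conditions $X(\dots,(\partial+\lambda_i)v_i,\dots;f)=X(v_1,\dots,v_n;\partial f/\partial z_i)$ and $X(v_1,\dots,v_n;z_{ij}f)=(\partial_{\lambda_j}-\partial_{\lambda_i})X(v_1,\dots,v_n;f)$. Thus $P^{\mathrm{ch}}(0)\cong V/\partial V$ and $P^{\mathrm{ch}}(1)\cong\mathrm{End}_{\mathbb F[\partial]}(V)$; the unit $1$ is the identity endomorphism. Action: $(X^\sigma)_{\lambda_1,\dots,\lambda_n}(v_1,\dots,v_n;f(z_1,\dots,z_n))=\epsilon_v(\sigma)X^{z_1,\dots,z_n}_{\lambda_{i_1},\dots,\lambda_{i_n}}(v_{i_1},\dots,v_{i_n};f(z_{i_1},\dots,z_{i_n}))$,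 $i_s=\sigma^{-1}(s)$, $\epsilon_v(\sigma)=\prod_{i<j,\,\sigma(i)>\sigma(j)}(-1)^{p(v_i)p(v_j)}$. Composition: let $Y\in P^{\mathrm{ch}}(n)$, $X_i\in P^{\mathrm{ch}}(m_i)$ ($m_i\geq 0$), $M_i=m_1+\dots+m_i$, $M_0=0$, $M=M_n$, $\Lambda_i=\sum_{k=M_{i-1}+1}^{M_i}\lambda_k$. For $h\in\mathcal O^{\star T}_M$ write $h=g(z_1,\dots,z_M)\prod_{i=1}^nf_i(z_{M_{i-1}+1},\dots,z_{M_i})$ with $f_i\in\mathcal O^{\star T}_{m_i}$ and $g\in\mathcal O^{\star T}_M$ having no poles at $z_k=z_l$ whenever $k\ne l$ lie in a common block $\{M_{i-1}+1,\dots,M_i\}$. Then $$\big(Y(X_1\otimes\dots\otimes X_n)\big)_{\lambda_1,\dots,\lambda_M}(v_1,\dots,v_M;h)=\pm Y^{w_1,\dots,w_n}_{\Lambda_1,\dots,\Lambda_n}\Big(\bigotimes_{i=1}^n(X_i)_{\lambda_{M_{i-1}+1}-\partial_{z_{M_{i-1}+1}},\dots,\lambda_{M_i}-\partial_{z_{M_i}}}(v_{M_{i-1}+1},\dots,v_{M_i};f_i)_\to\,;\,g|_{z_k=w_i\ (M_{i-1}<k\le M_i)}\Big),$$ where the arrows mean that the derivatives $\partial_{z_k}$ are applied to $g$ before the substitutions $z_k=w_i$, and $\pm=(-1)^{\sum_{i<j}p(X_j)(p(v_{M_{i-1}+1})+\dots+p(v_{M_i}))}$. A superoperad $\mathcal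 P$: superspaces $\mathcal P(n)$ with right $S_n$-actions and parity preserving compositions $f(g_1\otimes\dots\otimes g_n)\in\mathcal P(m_1+\dots+m_n)$ satisfying (Koszul sign rule) associativity $f((g_1\otimes\dots\otimes g_n)(h_1\otimes\dots\otimes h_{M_n}))=(f(g_1\otimes\dots\otimes g_n))(h_1\otimes\dots\otimes h_{M_n})$, unit axioms $f(1\otimes\dots\otimes1)=1(f)=f$, and equivariance $f^\sigma(g_1^{\tau_1}\otimes\dots\otimes g_n^{\tau_n})=\big(f(\sigma(g_1\otimes\dots\otimes g_n))\big)^{\sigma(\tau_1,\dots,\tau_n)}$, where $\sigma(g_1\otimes\dots\otimes g_n)=\epsilon_g(\sigma)g_{\sigma^{-1}(1)}\otimes\dots\otimes g_{\sigma^{-1}(n)}$ and $\sigma(\tau_1,\dots,\tau_n)\in S_{M_n}$ maps $M_{i-1}+j$ ($1\le j\le m_i$) to $m_{\sigma^{-1}(1)}+\dots+m_{\sigma^{-1}(\sigma(i)-1)}+\tau_i(j)$.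
   Formalization: In the action of S_n, f(z_{i_1},...,z_{i_n}) is replaced by the substitution z_k := z_{σ(k)} (argument s of X carries v_{i_s}, λ_{i_s} and z_{i_s}); read literally as z_s := z_{σ^{-1}(s)}, X^σ violates sesquilinearity already for 3-cycles. *)

(* Defs.v *)
From HB Require Import structures.
From mathcomp Require Import all_boot all_order all_fingroup all_algebra finmap.
From mathcomp Require Import boolp classical_sets functions fsbigop.
From mathcomp Require Import mpoly generic_quotient ring.

Set Implicit Arguments.
Unset Strict Implicit.
Unset Printing Implicit Defensive.

Import GRing.Theory.
Local Open Scope ring_scope.
Local Open Scope quotient_scope.

Record is_superspace (F : fieldType) (V : lmodType F)
    (of_parity : bool -> V -> Prop) : Prop := IsSuperspace {
  of_parity0 : forall b, of_parity b 0;
  of_parityP : forall b a x y,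
    of_parity b x -> of_parity b y -> of_parity b (a *: x + y);
  of_parity_decomp : forall v, exists! w : V * V,
    [/\ of_parity false w.1, of_parity true w.2 & v = w.1 + w.2] }.

Record superspace (F : fieldType) := Superspace {
  superspace_sort :> lmodType F;
  of_parity : bool -> superspace_sort -> Prop;
  superspaceP : is_superspace of_parity }.

Arguments of_parity {F s}.

(* The parity of a tensor product of homogeneous elements, and the exponents  *)
(* of the Koszul signs                                                        *)
(*   sigma (x_1 (x) ... (x) x_n) = +/- x_(sigma^-1 1) (x) ... ,               *)
(*   (f_1 (x) ... (x) f_n) (x_1 (x) ... (x) x_n)                              *)
(*     = +/- f_1 (x_1) (x) ... (x) f_n (x_n).                                 *)
Definition parity_sum n (p : 'I_n -> bool) : bool := odd (\sum_(i < n) p i).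

Definition perm_sign n (p : 'I_n -> bool) (sigma : 'S_n) : nat :=
  \sum_(i < n) \sum_(j < n | (i < j) && (sigma j < sigma i)) p i * p j.

Definition eval_sign n (pf px : 'I_n -> bool) : nat :=
  \sum_(i < n) \sum_(j < n | i < j) pf j * px i.

Section Operad.

Context {n : nat} {m : 'I_n -> nat}.

Lemma sum_unit_arity : (\sum_(i < n) 1)%N = n.
Proof. by rewrite sum1_card card_ord. Qed.

Lemma sum_arity1 k : (\sum_(i < 1) k)%N = k.
Proof. by rewrite big_ord1. Qed.

Lemma sum_arityA (l : 'I_(\sum_(i < n) m i) -> nat) :
  (\sum_(i < n) \sum_(j < m i) l (tagnat.Rank i j) = \sum_k l k)%N.
Proof.
rewrite sig_big_dep /= (reindex (@tagnat.rank n m)); last first.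
  exact/onW_bij/tagnat.rank_bij.
by apply: eq_bigr => p _; rewrite tagnat.rankE.
Qed.

Lemma sum_arity_perm (sigma : 'S_n) :
  (\sum_(i < n) m ((sigma^-1)%g i) = \sum_(i < n) m i)%N.
Proof. by rewrite [RHS](reindex_inj (@perm_inj _ (sigma^-1)%g)). Qed.

Section BlockPerm.

Variables (sigma : 'S_n) (tau : forall i, 'S_(m i)).

Definition block_perm_tag (p : {i : 'I_n & 'I_(m i)}) :
    {i : 'I_n & 'I_(m ((sigma^-1)%g i))} :=
  Tagged (fun i => 'I_(m ((sigma^-1)%g i)))
    (cast_ord (congr1 m (esym (permK sigma (tag p)))) (tau (tag p) (tagged p))).

Definition block_perm_fun (k : 'I_(\sum_(i < n) m i)) : 'I_(\sum_(i < n) m i) :=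
  cast_ord (sum_arity_perm sigma) (tagnat.rank (block_perm_tag (tagnat.sig k))).

Lemma block_perm_inj : injective block_perm_fun.
Proof.
move=> k k' /cast_ord_inj/tagnat.rank_inj.
case E: (tagnat.sig k) => [i j]; case E': (tagnat.sig k') => [i' j'].
move=> /[dup] /(congr1 (@tag _ _)) /= /perm_inj ii'.
case: _ / ii' in j' E' *; rewrite /block_perm_tag /= => /eqP.
rewrite eq_Tagged /= => /eqP /cast_ord_inj/perm_inj jj'.
by apply: tagnat.sig_inj; rewrite E E' jj'.
Qed.

Definition block_perm : 'S_(\sum_(i < n) m i) := perm block_perm_inj.

(* tagnat.Rank i j is the index m_0 + ... + m_(i-1) + j of the j-th element   *)
(* of the i-th block.                                                         *)
Lemma block_permE i (j : 'I_(m i)) :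
  block_perm (tagnat.Rank i j) =
    (\sum_(s < n | s < sigma i) m ((sigma^-1)%g s) + tau i j)%N :> nat.
Proof. rewrite permE /block_perm_fun /tagnat.Rank tagnat.rankK.
by apply: etrans (tagnat.rankEsum _) _. Qed.

End BlockPerm.

End Operad.

Section Superoperad.

Variables (F : fieldType) (P : nat -> lmodType F).

Record operad_data := OperadData {
  operad_act : forall n, P n -> 'S_n -> P n;
  operad_unit : P 1;
  operad_comp : forall n (m : 'I_n -> nat),
    P n -> (forall i, P (m i)) -> P (\sum_(i < n) m i)%N }.

Definition arity_cast n n' (e : n = n') (x : P n) : P n' := ecast k (P k) e x.

Definition multilinear_comp (S : operad_data) : Prop :=
  (forall n (m : 'I_n -> nat) (g : forall i, P (m i)) a (f f' : P n),
    operad_comp S (a *: f + f') g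
      = a *: operad_comp S f g + operad_comp S f' g) /\
  (forall n (m : 'I_n -> nat) (f : P n) (g : forall i, P (m i)) i a
      (x y : P (m i)),
    operad_comp S f (dfwith g (a *: x + y))
      = a *: operad_comp S f (dfwith g x) + operad_comp S f (dfwith g y)).

Variable par : forall n, bool -> P n -> Prop.

Record is_superoperad (S : operad_data) : Prop := IsSuperoperad {
  operad_superspace : forall n, is_superspace (@par n);

  operad_act_linear : forall n (sigma : 'S_n) a x y,
    operad_act S (a *: x + y) sigma
      = a *: operad_act S x sigma + operad_act S y sigma;
  operad_act_even : forall n (sigma : 'S_n) b x,
    par b x -> par b (operad_act S x sigma);
  operad_act1 : forall n (x : P n), operad_act S x 1%g = x;
  (* the group law of 'S_n composes from left to right: (tau * sigma) i is    *)
  (* sigma (tau i)                                                            *)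
  operad_actM : forall n (sigma tau : 'S_n) x,
    operad_act S (operad_act S x sigma) tau
      = operad_act S x (tau * sigma)%g;

  operad_comp_linear : multilinear_comp S;
  operad_comp_even : forall n (m : 'I_n -> nat) b (p : 'I_n -> bool)
      (f : P n) (g : forall i, P (m i)),
    par b f -> (forall i, par (p i) (g i)) ->
    par (b (+) parity_sum p) (operad_comp S f g);

  operad_compA : forall n (m : 'I_n -> nat) (l : 'I_(\sum_(i < n) m i) -> nat)
      (p : 'I_n -> bool) (q : 'I_(\sum_(i < n) m i) -> bool)
      (f : P n) (g : forall i, P (m i)) (h : forall k, P (l k)),
    (forall i, par (p i) (g i)) -> (forall k, par (q k) (h k)) ->
    (-1) ^+ eval_sign p (fun i => parity_sum (fun j => q (tagnat.Rank i j))) *: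
      arity_cast (sum_arityA l)
        (operad_comp S f (fun i =>
           operad_comp S (g i) (fun j => h (tagnat.Rank i j))))
    = operad_comp S (operad_comp S f g) h;

  operad_unit_even : par false (operad_unit S);
  operad_comp1 : forall n (f : P n),
    arity_cast (@sum_unit_arity n)
      (operad_comp S f (fun=> operad_unit S)) = f;
  operad_1comp : forall n (f : P n),
    arity_cast (@sum_arity1 n) (operad_comp S (operad_unit S) (fun=> f)) = f;

  operad_equivariance : forall n (m : 'I_n -> nat) (p : 'I_n -> bool)
      (sigma : 'S_n) (tau : forall i, 'S_(m i))
      (f : P n) (g : forall i, P (m i)),
    (forall i, par (p i) (g i)) ->
    operad_comp S (operad_act S f sigma) (fun i => operad_act S (g i) (tau i))
    = operad_act S
        (arity_cast (sum_arity_perm sigma)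
          ((-1) ^+ perm_sign p sigma *:
             operad_comp S f (fun i => g ((sigma^-1)%g i))))
        (block_perm sigma tau) }.

End Superoperad.

Section ImageQuotient.

Variables (F : fieldType) (W : lmodType F) (Phi : {linear W -> W}).

Definition image_pred : pred W := [pred u | `[< exists w, u = Phi w >]].

Lemma image_predP u : reflect (exists w, u = Phi w) (u \in image_pred).
Proof. exact: asboolP. Qed.

Lemma image_zmod_closed : zmod_closed image_pred.
Proof.
split=> [|u v /image_predP[u' ->] /image_predP[v' ->]]; apply/image_predP.
  by exists 0; rewrite raddf0.
by exists (u' - v'); rewrite raddfB.
Qed.

HB.instance Definition _ := GRing.isZmodClosed.Build W image_pred
  image_zmod_closed.

Definition imquot := Quotient.quot (GRing.ZmodClosed.clone W image_pred _).

HB.instance Definition _ := GRing.Zmodule.on imquot.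
HB.instance Definition _ : EqQuotient W (Quotient.equiv (GRing.ZmodClosed.clone W image_pred _)) imquot :=
  EqQuotient.on imquot.

Definition imquot_pi (u : W) : imquot := \pi u.

Lemma imquot_eq u v : imquot_pi u = imquot_pi v <-> exists w, u - v = Phi w.
Proof.
split=> [/eqmodP|uv]; first by rewrite /= Quotient.equivE => /image_predP.
by apply/eqmodP; rewrite /= Quotient.equivE; apply/image_predP.
Qed.

Lemma imquot_piK q : imquot_pi (repr q) = q. Proof. exact: reprK. Qed.

Lemma imquot_piD : {morph imquot_pi : u v / u + v}.
Proof. by move=> u v; rewrite /imquot_pi !piE. Qed.

Definition imquot_scale a (q : imquot) : imquot := imquot_pi (a *: repr q).

Lemma imquot_scaleE a u : imquot_scale a (imquot_pi u) = imquot_pi (a *: u).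
Proof.
apply/imquot_eq; have [w E] := (imquot_eq _ _).1 (imquot_piK (imquot_pi u)).
by exists (a *: w); rewrite -scalerBr E linearZ.
Qed.

Fact imquot_scaleA a b q :
  imquot_scale a (imquot_scale b q) = imquot_scale (a * b) q.
Proof. by rewrite -[q]imquot_piK !imquot_scaleE scalerA. Qed.

Fact imquot_scale1 : left_id 1 imquot_scale.
Proof. by move=> q; rewrite -[q]imquot_piK !imquot_scaleE scale1r. Qed.

Fact imquot_scaleDr : right_distributive imquot_scale +%R.
Proof.
move=> a q r; rewrite -[q]imquot_piK -[r]imquot_piK.
by rewrite -imquot_piD !imquot_scaleE scalerDr imquot_piD.
Qed.

Fact imquot_scaleDl q : {morph imquot_scale^~ q : a b / a + b}.
Proof.
by move=> a b; rewrite -[q]imquot_piK !imquot_scaleE scalerDl imquot_piD.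
Qed.

HB.instance Definition _ := GRing.Zmodule_isLmodule.Build F imquot
  imquot_scaleA imquot_scale1 imquot_scaleDr imquot_scaleDl.

Fact imquot_pi_linear : linear imquot_pi.
Proof. by move=> a u v; rewrite imquot_piD -imquot_scaleE. Qed.

HB.instance Definition _ := GRing.isLinear.Build F W imquot _ imquot_pi
  imquot_pi_linear.

End ImageQuotient.

(* The map induced on the quotients by phi, see imquot_mapE.                  *)
Definition imquot_map (F : fieldType) (W W' : lmodType F)
    (Phi : {linear W -> W}) (Phi' : {linear W' -> W'}) (phi : W -> W')
    (q : imquot Phi) : imquot Phi' :=
  imquot_pi Phi' (phi (repr q)).

Section ImageQuotientMap.

Variables (F : fieldType) (W W' : lmodType F).
Variables (Phi : {linear W -> W}) (Phi' : {linear W' -> W'}) (phi : W -> W').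
Hypothesis phi_linear : linear phi.
Hypothesis phi_image : forall u, phi (Phi u) = Phi' (phi u).

Lemma imquot_mapE u :
  imquot_map Phi' phi (imquot_pi Phi u) = imquot_pi Phi' (phi u).
Proof.
apply/imquot_eq; have [w E] := (imquot_eq _ _ _).1 (imquot_piK (imquot_pi Phi u)).
exists (phi w); rewrite -phi_image -E.
have := phi_linear (-1) u (repr (imquot_pi Phi u)).
by rewrite !scaleN1r ![- _ + _]addrC => ->.
Qed.

Lemma imquot_map_linear : linear (@imquot_map _ _ _ Phi Phi' phi).
Proof.
move=> a q r; rewrite -[q]imquot_piK -[r]imquot_piK -linearP !imquot_mapE.
by rewrite phi_linear linearP.
Qed.

End ImageQuotientMap.

Section VectorPolynomials.

Variables (F : fieldType) (V : lmodType F) (n : nat).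

Definition finsupp_pred : pred ('X_{1..n} -> V) :=
  [pred u | `[< exists s : {fset 'X_{1..n}}, forall a, a \notin s -> u a = 0 >]].

Lemma finsupp_predP u :
  reflect (exists s : {fset 'X_{1..n}}, forall a, a \notin s -> u a = 0)
          (u \in finsupp_pred).
Proof. exact: asboolP. Qed.

Fact finsupp_submod_closed : submod_closed finsupp_pred.
Proof.
split=> [|c u v /finsupp_predP[s us] /finsupp_predP[t vt]]; apply/finsupp_predP.
  by exists fset0.
exists (s `|` t)%fset => a; rewrite in_fsetU negb_or => /andP[/us ua /vt va].
by rewrite [LHS](congr2 (fun x y => c *: x + y) ua va) scaler0 addr0.
Qed.

HB.instance Definition _ := GRing.isSubmodClosed.Build F _ finsupp_pred
  finsupp_submod_closed.

(* V[lambda_1, ..., lambda_n], as the finitely supported families of          *)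
(* coefficients                                                               *)
Record vpoly := Vpoly { vcoef :> 'X_{1..n} -> V; _ : vcoef \in finsupp_pred }.

HB.instance Definition _ := [isSub for vcoef].
HB.instance Definition _ := [Choice of vpoly by <:].
HB.instance Definition _ := [SubChoice_isSubLmodule of vpoly by <:].

Lemma vpolyP (u v : vpoly) : (forall a, u a = v a) <-> u = v.
Proof. by split=> [uv|-> //]; apply/val_inj/funext. Qed.

Lemma vcoefP (c : F) (u v : vpoly) a :
  vcoef (c *: u + v) a = c *: u a + v a.
Proof. by []. Qed.

Lemma vpoly_support (u : vpoly) :
  exists s : {fset 'X_{1..n}}, forall a, a \notin s -> u a = 0.
Proof. by case: u => u ?; apply/finsupp_predP. Qed.

Fact vmono_finsupp a (v : V) :
  (fun b : 'X_{1..n} => v *+ (a == b)) \in finsupp_pred.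
Proof.
apply/finsupp_predP; exists [fset a]%fset => b.
by rewrite in_fset1 eq_sym => /negPf ->.
Qed.

(* v lambda^a                                                                 *)
Definition vmono (a : 'X_{1..n}) (v : V) : vpoly := Vpoly (vmono_finsupp a v).

Lemma vmono_linear a : linear (vmono a).
Proof. by move=> c v w; apply/vpolyP=> b /=; rewrite mulrnDl scalerMnr. Qed.

HB.instance Definition _ a := GRing.isLinear.Build F V vpoly _ (vmono a)
  (vmono_linear a).

(* \sum_a v_a lambda^a |-> \sum_a phi_a (v_a)                                 *)
Definition vlift (W : lmodType F) (phi : 'X_{1..n} -> V -> W) (u : vpoly) : W :=
  \sum_(a \in [set: 'X_{1..n}]) phi a (u a).

Lemma vlift_fset (W : lmodType F) (phi : 'X_{1..n} -> {linear V -> W})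
    (u : vpoly) (s : {fset 'X_{1..n}}) :
  (forall a, a \notin s -> u a = 0) ->
  vlift phi u = \sum_(a <- s) phi a (u a).
Proof. by move=> us; apply: fsbigTE => a /us ->; rewrite raddf0. Qed.

Lemma vlift_linear (W : lmodType F) (phi : 'X_{1..n} -> {linear V -> W}) :
  linear (vlift phi).
Proof.
move=> c u v; have [s us] := vpoly_support u; have [t vt] := vpoly_support v.
have ust a : a \notin (s `|` t)%fset -> u a = 0.
  by rewrite in_fsetU negb_or => /andP[/us].
have vst a : a \notin (s `|` t)%fset -> v a = 0.
  by rewrite in_fsetU negb_or => /andP[_ /vt].
rewrite !(@vlift_fset _ _ _ (s `|` t)%fset) //; last first.
  by move=> a ast; rewrite vcoefP ust // vst // scaler0 addr0.
rewrite scaler_sumr -big_split; apply: eq_bigr => a _.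
by rewrite vcoefP linearP.
Qed.

End VectorPolynomials.

Arguments vmono {F V n}.

Section VectorPolynomialOperations.

Variables (F : fieldType) (V : lmodType F) (n : nat).

Lemma vlift_mono (W : lmodType F) (phi : 'X_{1..n} -> {linear V -> W}) a v :
  vlift phi (vmono a v) = phi a v.
Proof.
rewrite (@vlift_fset _ _ _ _ _ _ [fset a]%fset) => [|b].
  by rewrite big_seq_fset1 /= eqxx.
by rewrite in_fset1 eq_sym /= => /negPf ->.
Qed.

Lemma vpoly_linear_ext (W : lmodType F) (f g : {linear vpoly V n -> W}) :
  (forall a v, f (vmono a v) = g (vmono a v)) -> f =1 g.
Proof.
move=> fg u; have [s us] := vpoly_support u.
have -> : u = \sum_(a <- s) vmono a (u a).
  apply/vpolyP=> b; pose ev := fun w : vpoly V n => w b.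
  have ev_sum r : ev (\sum_(a <- r) vmono a (u a))
      = \sum_(a <- r) u a *+ (a == b).
    by elim: r => [|a r IHr]; rewrite ?(big_nil, big_cons) // -IHr.
  rewrite -/(ev u) -/(ev (\sum_(a <- _) _)) ev_sum /ev.
  have [bs|/[dup] /us -> bs] := boolP (b \in s).
    rewrite (big_fsetD1 b) //= eqxx big1_fset ?addr0 // => a.
    by rewrite in_fsetD1 => /andP[/negPf ->].
  by rewrite big1_fset // => a; case: eqP => // ->; rewrite (negPf bs).
by rewrite !raddf_sum; apply: eq_bigr => a _; exact: fg.
Qed.

Definition vmulX (i : 'I_n) : vpoly V n -> vpoly V n :=
  vlift (fun a v => vmono (a + U_(i))%MM v).

Definition vderiv (i : 'I_n) : vpoly V n -> vpoly V n :=
  vlift (fun a v => (a i)%:R *: vmono (a - U_(i))%MM v).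

(* The substitution lambda_i |-> L_i                                          *)
Definition vsubst (k : nat) (L : 'I_n -> {mpoly F[k]}) :
    vpoly V n -> vpoly V k :=
  vlift (fun a v => let p := \prod_(i < n) L i ^+ a i in
    \sum_(b <- msupp p) p@_b *: vmono b v).

Lemma vmulX_linear i : linear (vmulX i).
Proof. exact: (@vlift_linear _ _ _ _ (fun a => vmono (a + U_(i))%MM)). Qed.

HB.instance Definition _ i := GRing.isLinear.Build F (vpoly V n) (vpoly V n) _
  (vmulX i) (vmulX_linear i).

Lemma vderiv_linear i : linear (vderiv i).
Proof.
exact: (@vlift_linear _ _ _ _ (fun a => (a i)%:R \*: vmono (a - U_(i))%MM)).
Qed.

HB.instance Definition _ i := GRing.isLinear.Build F (vpoly V n) (vpoly V n) _
  (vderiv i) (vderiv_linear i).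

Lemma vmulX_mono i a v : vmulX i (vmono a v) = vmono (a + U_(i))%MM v.
Proof. exact: (@vlift_mono _ (fun a => vmono (a + U_(i))%MM)). Qed.

Lemma vderiv_mono i a v :
  vderiv i (vmono a v) = (a i)%:R *: vmono (a - U_(i))%MM v.
Proof.
exact: (@vlift_mono _ (fun a => (a i)%:R \*: vmono (a - U_(i))%MM)).
Qed.

Variable d : {linear V -> V}.

(* d + lambda_1 + ... + lambda_n                                              *)
Definition total_deriv (u : vpoly V n) : vpoly V n :=
  vlift (fun a v => vmono a (d v)) u + \sum_(i < n) vmulX i u.

Lemma total_deriv_linear : linear total_deriv.
Proof.
move=> c u v; rewrite /total_deriv.
rewrite (@vlift_linear _ _ _ _ (fun a => vmono a \o d)).
under eq_bigr do rewrite vmulX_linear.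
by rewrite big_split /= -scaler_sumr scalerDr addrACA.
Qed.

HB.instance Definition _ := GRing.isLinear.Build F (vpoly V n) (vpoly V n) _
  total_deriv total_deriv_linear.

Lemma total_deriv_mono a v :
  total_deriv (vmono a v) = vmono a (d v) + \sum_(i < n) vmono (a + U_(i))%MM v.
Proof.
rewrite /total_deriv (@vlift_mono _ (fun a => vmono a \o d)) /=.
by under eq_bigr do rewrite vmulX_mono.
Qed.

Lemma vmulX_total_deriv i u :
  vmulX i (total_deriv u) = total_deriv (vmulX i u).
Proof.
apply: (@vpoly_linear_ext _ (vmulX i \o total_deriv) (total_deriv \o vmulX i)).
move=> a v /=; rewrite vmulX_mono !total_deriv_mono linearD /= vmulX_mono.
rewrite linear_sum; congr (_ + _); apply: eq_bigr => j _ /=.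
by rewrite vmulX_mono -!addmA [(U_(i) + _)%MM]addmC.
Qed.

Lemma vderiv_total_deriv i u :
  vderiv i (total_deriv u) = total_deriv (vderiv i u) + u.
Proof.
apply: (@vpoly_linear_ext _ (vderiv i \o total_deriv)
  ((total_deriv \o vderiv i) \+ idfun)).
move=> a v /=; rewrite vderiv_mono linearZ /= !total_deriv_mono linearD /=.
rewrite vderiv_mono linear_sum /= scalerDr -addrA; congr (_ + _).
rewrite scaler_sumr (bigD1 i) //= [in RHS](bigD1 i) //= vderiv_mono.
rewrite addmK mnmDE mnm1E eqxx natrD scalerDl scale1r addrAC.
congr (_ + _ + _).
  case: (posnP (a i)) => [->|ai]; first by rewrite !scale0r.
  by rewrite submK // lep1mP -lt0n.
apply: eq_bigr => j ji; rewrite vderiv_mono mnmDE mnm1E (negPf ji) addn0.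
case: (posnP (a i)) => [->|ai]; first by rewrite !scale0r.
by rewrite addmC -addmBA ?lep1mP -?lt0n // addmC.
Qed.

(* V[lambda_1, ..., lambda_n] / <d + lambda_1 + ... + lambda_n>               *)
Definition qpoly := imquot total_deriv.
HB.instance Definition _ := GRing.Lmodule.on qpoly.

Definition qpi : vpoly V n -> qpoly := imquot_pi total_deriv.

End VectorPolynomialOperations.

Fact quotient_ruleM (K : fieldType) (a b c e a' b' c' e' : K) :
  b != 0 -> e != 0 ->
  ((a' * c + a * c') * (b * e) - a * c * (b' * e + b * e')) / (b * e) ^+ 2
  = (a' * b - a * b') / b ^+ 2 * (c / e)
    + a / b * ((c' * e - c * e') / e ^+ 2).
Proof. by move=> b0 e0; field; rewrite b0 e0. Qed.

Fact quotient_ruleD (K : fieldType) (a b c e a' b' c' e' : K) :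
  b != 0 -> e != 0 ->
  ((a' * e + a * e' + (c' * b + c * b')) * (b * e)
    - (a * e + c * b) * (b' * e + b * e')) / (b * e) ^+ 2
  = (a' * b - a * b') / b ^+ 2 + (c' * e - c * e') / e ^+ 2.
Proof. by move=> b0 e0; field; rewrite b0 e0. Qed.

Section Fractions.

Variable R : idomainType.

Definition frac_of (p q : R) : {fraction R} := tofrac p / tofrac q.

Lemma frac_eq p q r s :
  q != 0 -> s != 0 -> frac_of p q = frac_of r s <-> p * s = r * q.
Proof.
move=> q0 s0; rewrite /frac_of.
have q0' : tofrac q != 0 by rewrite tofrac_eq0.
have s0' : tofrac s != 0 by rewrite tofrac_eq0.
split=> [/eqP|E]; first by rewrite eqr_div // -!tofracM tofrac_eq => /eqP.
by apply/eqP; rewrite eqr_div // -!tofracM E.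
Qed.

Lemma frac_repr (f : {fraction R}) : f = frac_of \n_(repr f) \d_(repr f).
Proof.
rewrite /frac_of -{1}[f]reprK; set r := repr f.
have d0 : tofrac \d_r != 0 by rewrite tofrac_eq0 denom_ratioP.
apply: (mulIf d0); rewrite divfK //.
rewrite /tofrac; unlock FracField.tofrac; rewrite -[LHS]FracField.pi_mul.
apply/eqmodP; rewrite /= FracField.equivfE /FracField.mulf.
by rewrite !numden_Ratio ?mulf_neq0 ?oner_neq0 ?denom_ratioP // !mulr1 mulrC.
Qed.

(* The extension to fractions of a derivation D of R                          *)
Definition frac_deriv (D : R -> R) (f : {fraction R}) : {fraction R} :=
  let p := \n_(repr f) in let q := \d_(repr f) in
  frac_of (D p * q - p * D q) (q ^+ 2).

Variable D : R -> R.
Hypothesis DD : {morph D : p q / p + q}.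
Hypothesis DM : forall p q, D (p * q) = D p * q + p * D q.

Lemma frac_derivE p q : q != 0 ->
  frac_deriv D (frac_of p q) = frac_of (D p * q - p * D q) (q ^+ 2).
Proof.
move=> q0; have := frac_repr (frac_of p q); rewrite /frac_deriv.
move: (denom_ratioP (repr (frac_of p q))).
move: \n_(repr _) \d_(repr _) => r s s0 /frac_eq -/(_ q0 s0) E.
apply/frac_eq; rewrite ?expf_neq0 //.
have dE : D p * s + p * D s = D r * q + r * D q by rewrite -!DM E.
have E1 : D r * q = D p * s + p * D s - r * D q by rewrite dE addrK.
transitivity (s * q * (D r * q) - q * D s * (r * q)); first by ring.
rewrite E1; transitivity ((D p * s + p * D s - r * D q) * s * q
  - p * s * (q * D s)); first by rewrite E; ring.
transitivity (D p * s * s * q - r * q * s * D q); first by ring.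
by rewrite -E; ring.
Qed.

Lemma frac_derivM f g :
  frac_deriv D (f * g) = frac_deriv D f * g + f * frac_deriv D g.
Proof.
rewrite (frac_repr f) (frac_repr g).
move: (denom_ratioP (repr f)) (denom_ratioP (repr g)).
move: \n_(repr f) \d_(repr f) \n_(repr g) \d_(repr g) => p q r s q0 s0.
rewrite [frac_of p q * _]mulf_div -!tofracM -/(frac_of _ _).
rewrite !frac_derivE ?mulf_neq0 // /frac_of.
rewrite !DM !(tofracXn, tofracM, tofracB, tofracD).
by apply: quotient_ruleM; rewrite tofrac_eq0.
Qed.

Lemma frac_derivD f g :
  frac_deriv D (f + g) = frac_deriv D f + frac_deriv D g.
Proof.
rewrite (frac_repr f) (frac_repr g).
move: (denom_ratioP (repr f)) (denom_ratioP (repr g)).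
move: \n_(repr f) \d_(repr f) \n_(repr g) \d_(repr g) => p q r s q0 s0.
rewrite [frac_of p q + _]addf_div ?tofrac_eq0 // -!tofracM -tofracD -/(frac_of _ _).
rewrite !frac_derivE ?mulf_neq0 // /frac_of !(DD, DM).
rewrite !(tofracXn, tofracM, tofracB, tofracD).
by apply: quotient_ruleD; rewrite tofrac_eq0.
Qed.

Lemma frac_deriv_tofrac p : frac_deriv D (tofrac p) = tofrac (D p).
Proof.
have E q : tofrac q = frac_of q 1 by rewrite /frac_of tofrac1 divr1.
have D1 : D 1 = 0.
  by apply: (addrI (D 1)); rewrite addr0 -{3}[1]mulr1 DM mulr1 mul1r.
by rewrite [in LHS]E frac_derivE ?oner_eq0 // D1 mulr0 subr0 mulr1 expr1n -E.
Qed.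

End Fractions.

Section RationalFunctions.

Variables (F : fieldType) (n : nat).

Definition ratfun := {fraction {mpoly F[n]}}.
HB.instance Definition _ := GRing.Field.on ratfun.

Definition ratfun_scale (c : F) (f : ratfun) : ratfun := tofrac c%:MP * f.

Fact ratfun_scaleA c c' f :
  ratfun_scale c (ratfun_scale c' f) = ratfun_scale (c * c') f.
Proof. by rewrite /ratfun_scale mulrA -tofracM -mpolyCM. Qed.

Fact ratfun_scale1 : left_id 1 ratfun_scale.
Proof. by move=> f; rewrite /ratfun_scale mpolyC1 tofrac1 mul1r. Qed.

Fact ratfun_scaleDr : right_distributive ratfun_scale +%R.
Proof. by move=> c f g; rewrite /ratfun_scale mulrDr. Qed.

Fact ratfun_scaleDl f : {morph ratfun_scale^~ f : c c' / c + c'}.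
Proof. by move=> c c'; rewrite /ratfun_scale mpolyCD tofracD mulrDl. Qed.

HB.instance Definition _ := GRing.Zmodule_isLmodule.Build F ratfun
  ratfun_scaleA ratfun_scale1 ratfun_scaleDr ratfun_scaleDl.

Fact ratfun_scaleAl (c : F) (f g : ratfun) : c *: (f * g) = (c *: f) * g.
Proof. exact: mulrA. Qed.

HB.instance Definition _ := GRing.Lmodule_isLalgebra.Build F ratfun
  ratfun_scaleAl.

End RationalFunctions.

Section TranslationInvariant.

Variables (F : fieldType) (n : nat).

Definition zdiff (i j : 'I_n) : ratfun F n := tofrac ('X_i - 'X_j).

(* The subalgebra generated by the z_ij and their inverses                    *)
Inductive in_Ost : ratfun F n -> Prop :=
| in_Ost_const c : in_Ost (c *: 1)
| in_Ost_z i j : in_Ost (zdiff i j)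
| in_Ost_zV i j : i != j -> in_Ost (zdiff i j)^-1
| in_OstD f g : in_Ost f -> in_Ost g -> in_Ost (f + g)
| in_OstM f g : in_Ost f -> in_Ost g -> in_Ost (f * g).

Definition Ost_pred : pred (ratfun F n) := [pred f | `[< in_Ost f >]].

Lemma Ost_predP f : reflect (in_Ost f) (f \in Ost_pred).
Proof. exact: asboolP. Qed.

Fact Ost_subalg_closed : subalg_closed Ost_pred.
Proof.
split=> [|c f g /Ost_predP Of /Ost_predP Og|f g /Ost_predP Of /Ost_predP Og];
  apply/Ost_predP.
- by rewrite -[1]scale1r; apply: in_Ost_const.
- rewrite -[f]mul1r scalerAl; apply: in_OstD => //.
  by apply: in_OstM => //; apply: in_Ost_const.
exact: in_OstM.
Qed.

HB.instance Definition _ := GRing.isSubalgClosed.Build F (ratfun F n) Ost_pred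
  Ost_subalg_closed.

Record Ost := MkOst { Ost_val :> ratfun F n; _ : Ost_val \in Ost_pred }.

HB.instance Definition _ := [isSub for Ost_val].
HB.instance Definition _ := [Choice of Ost by <:].
HB.instance Definition _ := [SubChoice_isSubComNzRing of Ost by <:].
HB.instance Definition _ := [SubZmodule_isSubLmodule of Ost by <:].

Lemma OstP (f : Ost) : in_Ost (Ost_val f).
Proof. by case: f => f ?; apply/Ost_predP. Qed.

Fact Ost_z_subproof i j : zdiff i j \in Ost_pred.
Proof. exact/Ost_predP/in_Ost_z. Qed.

Definition Ost_z i j : Ost := MkOst (Ost_z_subproof i j).

End TranslationInvariant.

Section RationalDerivation.

Variables (F : fieldType) (n : nat) (k : 'I_n).

Definition rat_deriv : ratfun F n -> ratfun F n := frac_deriv (mderiv k).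

Lemma rat_derivM f g :
  rat_deriv (f * g) = rat_deriv f * g + f * rat_deriv g.
Proof. exact (frac_derivM (mderivM k) f g). Qed.

Lemma rat_derivD f g : rat_deriv (f + g) = rat_deriv f + rat_deriv g.
Proof. exact (frac_derivD (mderivD k) (mderivM k) f g). Qed.

Lemma rat_deriv_poly (p : {mpoly F[n]}) :
  rat_deriv (tofrac p) = tofrac p^`M(k).
Proof. exact (frac_deriv_tofrac (mderivM k) p). Qed.

Lemma rat_deriv_const c : rat_deriv (c *: 1) = 0.
Proof.
have -> : c *: 1 = tofrac c%:MP :> ratfun F n by exact: mulr1.
by rewrite rat_deriv_poly mderivC; exact: tofrac0.
Qed.

Lemma rat_deriv_z i j :
  rat_deriv (zdiff F i j) = ((i == k)%:R - (j == k)%:R) *: 1.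
Proof.
have dX l : 'X_l^`M(k) = ((l == k)%:R : F)%:MP_[n].
  rewrite mderivX mnm1E; case: eqVneq => [->|_]; last by rewrite scale0r mpolyC0.
  by rewrite scale1r -[X in (X - _)%MM]add0m addmK mpolyX0 mpolyC1.
rewrite rat_deriv_poly mderivB !dX -mpolyCB; exact/esym/mulr1.
Qed.

Lemma zdiff_neq0 i j : i != j -> zdiff F i j != 0 :> ratfun F n.
Proof.
move=> ij; rewrite tofrac_eq0 subr_eq0.
apply: contra_neq ij => /(congr1 (mcoeff U_(i))).
rewrite !mcoeffX eqxx; case: eqP => [|_ /eqP]; last by rewrite oner_eq0.
by move/mnmP/(_ j); rewrite !mnm1E eqxx; case: eqVneq.
Qed.

Lemma rat_deriv_zV i j : i != j -> rat_deriv (zdiff F i j)^-1 =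
  (- ((i == k)%:R - (j == k)%:R)) *: 1 * ((zdiff F i j)^-1 * (zdiff F i j)^-1).
Proof.
move=> ij; move: (zdiff_neq0 ij) (rat_deriv_z i j).
move: (zdiff F i j) => z z0 dz; have := rat_derivM z z^-1.
have -> : z * z^-1 = 1 *: 1 by rewrite mulfV // scale1r.
rewrite rat_deriv_const dz => /eqP.
rewrite eq_sym addrC addr_eq0 => /eqP E; apply: (mulfI z0); rewrite E.
rewrite scaleNr mulNr mulrN [z * _]mulrC -!mulrA.
by rewrite mulVf // mulr1.
Qed.

Lemma rat_deriv_Ost f : in_Ost f -> in_Ost (rat_deriv f).
Proof.
elim=> [c|i j|i j ij|g h Og Odg Oh Odh|g h Og Odg Oh Odh].
- by rewrite rat_deriv_const -(scale0r 1); apply: in_Ost_const.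
- by rewrite rat_deriv_z; apply: in_Ost_const.
- rewrite rat_deriv_zV //; apply: in_OstM; first exact: in_Ost_const.
  by apply: in_OstM; apply: in_Ost_zV.
- by rewrite rat_derivD; apply: in_OstD.
by rewrite rat_derivM; apply: in_OstD; apply: in_OstM.
Qed.

Fact Ost_deriv_subproof (f : Ost F n) :
  rat_deriv (Ost_val f) \in @Ost_pred F n.
Proof. exact/Ost_predP/rat_deriv_Ost/OstP. Qed.

Definition Ost_deriv (f : Ost F n) : Ost F n := MkOst (Ost_deriv_subproof f).

End RationalDerivation.

Definition poly_subst (F : fieldType) a b (pi : 'I_a -> 'I_b)
    (p : {mpoly F[a]}) : {mpoly F[b]} :=
  p \mPo [tuple 'X_(pi k) | k < a].

(* f|_(z_k = w_(pi k)), for f without poles on this diagonal (junk value      *)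
(* otherwise). The result does not depend on the fraction p / q.              *)
Definition Ost_subst (F : fieldType) a b (pi : 'I_a -> 'I_b)
    (f : Ost F a) : Ost F b :=
  xget 0 [set g | exists p q, [/\ Ost_val f = frac_of p q,
    poly_subst pi q != 0 &
    Ost_val g = frac_of (poly_subst pi p) (poly_subst pi q)]]%classic.

(* f = p / q where q does not vanish identically on z_k = z_l                 *)
Definition no_pole (F : fieldType) n (k l : 'I_n) (f : Ost F n) : Prop :=
  exists p q, Ost_val f = frac_of p q /\
    poly_subst (fun i => if i == l then k else i) q != 0.

Section Chiral.

Variables (F : fieldType) (V : superspace F) (d : {linear V -> V}).

Local Notation Q n := (@qpoly F V n d).
Local Notation Qpi := (@qpi F V _ d).
Local Notation Qmap :=
  (@imquot_map _ _ _ (@total_deriv F V _ d) (@total_deriv F V _ d)).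

Definition qmulX n (i : 'I_n) : Q n -> Q n := Qmap (vmulX i).

(* (d/d lambda_j - d/d lambda_i)                                              *)
Definition qderiv n (j i : 'I_n) : Q n -> Q n :=
  Qmap (fun u => vderiv j u - vderiv i u).

(* The substitution lambda_i |-> L_i                                          *)
Definition qsubst n k (L : 'I_n -> {mpoly F[k]}) : Q n -> Q k :=
  Qmap (vsubst L).

Definition q_parity n (b : bool) (x : Q n) : Prop :=
  exists u, Qpi u = x /\ forall a, of_parity b (vcoef u a).

(* Linear maps on V^(x)n (x) O are encoded as maps which are linear in each   *)
(* of the n + 1 arguments.                                                    *)
Record is_chiral n (X : ('I_n -> V) -> Ost F n -> Q n) : Prop := IsChiral {
  chiral_linear : forall v, linear (X v);
  chiral_multilinear : forall v (i : 'I_n) a x y f,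
    X [eta v with i |-> a *: x + y] f
      = a *: X [eta v with i |-> x] f + X [eta v with i |-> y] f;
  chiral_deriv : forall v i f,
    X [eta v with i |-> d (v i)] f + qmulX i (X v f) = X v (Ost_deriv i f);
  chiral_zmul : forall v i j f,
    X v (Ost_z F i j * f) = qderiv j i (X v f) }.

Definition chiral_map n := ('I_n -> V) -> Ost F n -> Q n.
HB.instance Definition _ n := GRing.Lmodule.on (chiral_map n).

Definition chiral_pred n : pred (chiral_map n) :=
  [pred X | `[< is_chiral X >]].

Lemma chiral_predP n (X : chiral_map n) :
  reflect (is_chiral X) (X \in @chiral_pred n).
Proof. exact: asboolP. Qed.

Lemma qmulX_linear n i : linear (@qmulX n i).
Proof.
apply: imquot_map_linear => [|u]; first exact: vmulX_linear.
exact: vmulX_total_deriv.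
Qed.

Lemma qderiv_linear n j i : linear (@qderiv n j i).
Proof.
apply: imquot_map_linear => [a u v|u].
  by rewrite !vderiv_linear opprD addrACA -scalerBr.
by rewrite !vderiv_total_deriv opprD addrACA subrr addr0 linearB.
Qed.

Fact chiral_submod_closed n : submod_closed (@chiral_pred n).
Proof.
have eval0 v f : (0 : chiral_map n) v f = 0 by [].
have evalP a X Y v f :
  (a *: X + Y : chiral_map n) v f = a *: X v f + Y v f by [].
split=> [|a X Y /chiral_predP[Xl Xm Xd Xz] /chiral_predP[Yl Ym Yd Yz]];
  apply/chiral_predP; split.
- by move=> v a f g; rewrite !eval0 scaler0 addr0.
- by move=> v i a x y f; rewrite !eval0 scaler0 addr0.
- move=> v i f; rewrite !eval0 add0r.
  by have := qmulX_linear i (-1) 0 0; rewrite scaler0 addr0 scaleN1r addNr.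
- move=> v i j f; rewrite !eval0.
  by have := qderiv_linear j i (-1) 0 0; rewrite scaler0 addr0 scaleN1r addNr.
- move=> v b f g; rewrite !evalP Xl Yl !scalerDr addrACA.
  by rewrite !scalerA [a * b]mulrC.
- move=> v i b x y f; rewrite !evalP Xm Ym !scalerDr addrACA.
  by rewrite !scalerA [a * b]mulrC.
- by move=> v i f; rewrite !evalP qmulX_linear -Xd -Yd scalerDr addrACA.
by move=> v i j f; rewrite !evalP qderiv_linear Xz Yz.
Qed.

HB.instance Definition _ n := GRing.isSubmodClosed.Build F (chiral_map n)
  (@chiral_pred n) (@chiral_submod_closed n).

Record Pch n := MkPch {
  Pch_val : chiral_map n;
  _ : Pch_val \in @chiral_pred n }.

HB.instance Definition _ n := [isSub for @Pch_val n].
HB.instance Definition _ n := [Choice of Pch n by <:].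
HB.instance Definition _ n := [SubChoice_isSubLmodule of Pch n by <:].

Definition Pch_eval n (X : Pch n) : ('I_n -> V) -> Ost F n -> Q n := Pch_val X.
Coercion Pch_eval : Pch >-> Funclass.

Definition Pch_parity n (b : bool) (X : Pch n) : Prop :=
  forall (p : 'I_n -> bool) v f, (forall i, of_parity (p i) (v i)) ->
    q_parity (b (+) parity_sum p) (X v f).

(* X^sigma (v; f) = +/- X_(lambda_i1, ...) (v_i1, ...; f), where             *)
(* i_s = sigma^-1 (s), and the variable z_(i_s) of f is the s-th variable of  *)
(* X, so that z_k is sent to z_(sigma k).                                     *)
Definition chiral_act_spec (act : forall n, Pch n -> 'S_n -> Pch n) : Prop :=
  forall n (X : Pch n) (sigma : 'S_n) (p : 'I_n -> bool) v f,
    (forall i, of_parity (p i) (v i)) ->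
    act n X sigma v f = (-1) ^+ perm_sign p sigma *:
      qsubst (fun s => 'X_((sigma^-1)%g s))
        (X (fun s => v ((sigma^-1)%g s)) (Ost_subst sigma f)).

Definition chiral_unit_spec (one : Pch 1) : Prop :=
  forall v : 'I_1 -> V, one v 1 = Qpi (vmono 0%MM (v ord0)).

(* Phi (g) |-> Phi ((lambda_k - d/dz_k) g), for an F-linear Phi; the operator *)
(* acts on g, and the lambda_k's are taken out of Phi                         *)
Definition shift_op n k (Phi : Ost F n -> Q n) (g : Ost F n) : Q n :=
  qmulX k (Phi g) - Phi (Ost_deriv k g).

(* Phi (g) |-> Phi (\prod_k (lambda_k - d/dz_k)^(a_k) g)                      *)
Definition shift_monomial n (a : 'X_{1..n}) (Phi : Ost F n -> Q n) :
    Ost F n -> Q n :=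
  foldr (fun k => iter (a k) (shift_op k)) Phi (enum 'I_n).

Section Composition.

Variables (n : nat) (m : 'I_n -> nat).
Local Notation M := (\sum_(i < n) m i)%N.

(* Y_(Lambda_1, ..., Lambda_n) (u_1, ..., u_n; g|_(z_k = w_i)) where          *)
(* lambda_k - d/dz_k is substituted for lambda_k in the u_i's                 *)
Definition chiral_comp_rhs (Y : Pch n) (u : forall i, vpoly V (m i))
    (g : Ost F M) : Q M :=
  \sum_(a \in [set: 'X_{1..M}])
    shift_monomial a (fun g' =>
      qsubst (fun i => \sum_(j < m i) 'X_(tagnat.Rank i j))
        (Y (fun i => u i [multinom a (tagnat.Rank i j) | j < m i])
           (Ost_subst (@tagnat.sig1 n m) g'))) g.

Definition regular_on_blocks (g : Ost F M) : Prop :=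
  forall k l, k != l -> tagnat.sig1 k = tagnat.sig1 l -> no_pole k l g.

End Composition.

Definition chiral_comp_spec
    (comp : forall n (m : 'I_n -> nat),
       Pch n -> (forall i, Pch (m i)) -> Pch (\sum_(i < n) m i)) : Prop :=
  forall n (m : 'I_n -> nat) (Y : Pch n) (X : forall i, Pch (m i))
    (q : 'I_n -> bool) (p : 'I_(\sum_(i < n) m i) -> bool) v
    (g : Ost F (\sum_(i < n) m i)) (f : forall i, Ost F (m i))
    (u : forall i, vpoly V (m i)),
  (forall i, Pch_parity (q i) (X i)) ->
  (forall k, of_parity (p k) (v k)) ->
  regular_on_blocks g ->
  (forall i, Qpi (u i) = X i (fun j => v (tagnat.Rank i j)) (f i)) ->
  comp n m Y X v (g * \prod_(i < n) Ost_subst (tagnat.Rank i) (f i))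
    = (-1) ^+ eval_sign q (fun i => parity_sum (fun j => p (tagnat.Rank i j))) *:
        chiral_comp_rhs Y u g.

Definition is_chiral_structure (S : operad_data Pch) : Prop :=
  [/\ chiral_act_spec (operad_act S),
      chiral_unit_spec (operad_unit S),
      multilinear_comp S &
      chiral_comp_spec (operad_comp S)].

End Chiral.

Arguments Pch_parity {F V d} n b X.

(* Main.v *)
(** Let T_k be the operator Phi |-> lambda_k Phi(_) - Phi(d_(z_k) _) on maps
    from functions g to V[lambda] / <d + sum lambda>. The T_k commute, and the
    right-hand side of the composition formula is T^a applied to
    g |-> Y(w; g|) when the i-th polynomial is w_i lambda^(a_i). Hence it is
    multilinear in the polynomials, and multiplying one of them by lambda_k
    amounts to applying T_k. Identities between such right-hand sides are
    therefore proved by induction: they are compatible with linear combinations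
    and with the T_k, and for constant polynomials they are properties of the
    single map g |-> Y(w; g|). This applies to invariance modulo the image of
    d + sum lambda, to sesquilinearity, to associativity, and to the fact that a
    factor z_kl with k, l in the same block may be moved from f_i to g. By the
    latter, the value at h = g prod f_i = g' prod f'_i is well defined: write
    f_i = c_i e_i and f'_i = c'_i e_i with polynomials c_i, c'_i and a common
    denominator e_i^-1.

    The blocks are given by an arbitrary map pi : 'I_M -> 'I_n with enumerated
    fibres, so that permutations and the identification of sums of arities are
    relabellings. The Koszul signs are introduced at the end, by decomposing all
    arguments into homogeneous components. *)

From HB Require Import structures.
Require Import Defs.
From mathcomp Require Import all_boot all_order all_fingroup all_algebra finmap.
From mathcomp Require Import boolp classical_sets functions fsbigop.
From mathcomp Require Import mpoly generic_quotient ring.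

Set Implicit Arguments.
Unset Strict Implicit.
Unset Printing Implicit Defensive.

Import GRing.Theory.
Local Open Scope ring_scope.

(** * Polynomials with coefficients in V and their quotients *)

(** Two descriptions of poles have to be reconciled. The specification asks, pair by pair, for a
    denominator that survives on z_k = z_l, whereas the inductions need one class of functions
    closed under sums, products and derivatives and compatible with substitutions. [reg] is that
    class, and [reg_of_no_pole] reaches it from the pairwise conditions by dividing numerators by
    z_kl within the translation invariant polynomials. [Ost_subst] is total, with a default value
    outside its domain, so regularity hypotheses accompany every computation.

    The specifications fix values only at homogeneous arguments. Homogeneity is treated as an
    eigenvector condition for parity involutions on polynomials, on their quotients and on chiral
    maps; this is where 2 != 0 enters. Closure properties become computations, and a chiral map is
    split into its parts by averaging. Multilinearity then determines all values, hence also
    uniqueness. Modulo 2 every Koszul exponent is a sum over pairs i < j, so sign identities are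
    checked on one pair at a time. *)

Definition lin_of (R : pzRingType) (U W : lmodType R) (f : U -> W)
    (fL : linear f) : {linear U -> W} :=
  HB.pack f (GRing.isLinear.Build R U W *:%R f fL).

Section LinearFacts.

Variables (R : pzRingType) (U W : lmodType R) (f : U -> W).
Hypothesis fL : linear f.

Lemma lin0 : f 0 = 0. Proof. exact: (raddf0 (lin_of fL)). Qed.
Lemma linB x y : f (x - y) = f x - f y. Proof. exact: (raddfB (lin_of fL)). Qed.
Lemma linD x y : f (x + y) = f x + f y. Proof. exact: (raddfD (lin_of fL)). Qed.
Lemma linZ a x : f (a *: x) = a *: f x.
Proof.
  by have := fL a x 0; rewrite lin0 !addr0.
Qed.
Lemma lin_sum (I : Type) (r : seq I) (P : pred I) (G : I -> U) :
  f (\sum_(i <- r | P i) G i) = \sum_(i <- r | P i) f (G i).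
Proof. exact: (raddf_sum (lin_of fL)). Qed.

End LinearFacts.

Section VPolyInduction.

Variables (F : fieldType) (V : lmodType F).

Lemma vlift_vmono_id n (x : vpoly V n) : vlift vmono x = x.
Proof.
apply: (@vpoly_linear_ext _ _ _ _ (lin_of (vlift_linear vmono)) idfun) => a v
  /=.
exact: vlift_mono.
Qed.

Lemma vpoly_sum n (x : vpoly V n) : exists s : seq 'X_{1..n},
  x = \sum_(a <- s) vmono a (x a).
Proof.
have [s xs] := vpoly_support x; exists s.
rewrite -{1}[x]vlift_vmono_id; exact: (@vlift_fset _ _ _ _ vmono).
Qed.

(** Constants generate V[lambda] under linear combinations and multiplication by the variables;
    monomials are reached by induction on their degree. *)
Lemma vpoly_ind n (P : vpoly V n -> Prop) :
  (forall a x y, P x -> P y -> P (a *: x + y)) ->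
  (forall i x, P x -> P (vmulX i x)) ->
  (forall v, P (vmono 0%MM v)) -> forall x, P x.
Proof.
move=> Plin PX P0 x.
have PM k a v : mdeg a = k -> P (vmono a v).
  elim: k a => [|k IHk] a; first by move/eqP; rewrite mdeg_eq0 => /eqP ->.
  case: (pickP (fun i => 0 < a i)%N) => [i ai|a0] ak; last first.
    suff a00 : a = 0%MM by rewrite a00 mdeg0 in ak.
    by apply/mnmP => i; rewrite mnm0E; apply/eqP; rewrite -leqn0 leqNgt a0.
  have E : a = (a - U_(i) + U_(i))%MM by rewrite submK // lep1mP -lt0n.
  rewrite E -vmulX_mono; apply/PX/IHk; apply: succn_inj; rewrite -ak.
  by rewrite {2}E mdegD mdeg1 addn1.
have PM0 : P 0 by rewrite -(raddf0 (vmono 0%MM)); apply: P0.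
have [s ->] := vpoly_sum x.
elim: s => [|a s IHs]; rewrite ?big_nil // big_cons -[vmono _ _]scale1r.
exact/Plin/IHs/PM.
Qed.

(** The product p v, in the form that occurs inside [vsubst], so that [vsubst_mono] holds by
    conversion. *)
Definition vpmul n (p : {mpoly F[n]}) (v : V) : vpoly V n :=
  \sum_(b <- msupp p) p@_b *: vmono b v.

Lemma vpmul_linear n (p : {mpoly F[n]}) : linear (vpmul p).
Proof.
move=> a v w; rewrite /vpmul scaler_sumr -big_split /=; apply: eq_bigr => b _.
by rewrite linearP scalerDr !scalerA mulrC.
Qed.

HB.instance Definition _ n (p : {mpoly F[n]}) :=
  GRing.isLinear.Build F V (vpoly V n) _ (vpmul p) (vpmul_linear p).

Fact vcoef_linear n (b : 'X_{1..n}) : linear (fun u : vpoly V n => u b).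
Proof. by []. Qed.

Lemma vcoef_sum n (I : Type) (r : seq I) (G : I -> vpoly V n) b :
  vcoef (\sum_(i <- r) G i) b = \sum_(i <- r) G i b.
Proof. exact: (raddf_sum (lin_of (@vcoef_linear n b))). Qed.

Lemma vpmul_coef n (p : {mpoly F[n]}) v b : vpmul p v b = p@_b *: v.
Proof.
have vmE (c : F) a : (c *: vmono a v) b = c *: (v *+ (a == b)) by [].
rewrite /vpmul vcoef_sum (eq_bigr (fun a => p@_a *: (v *+ (a == b)))) //.
have [bp|bp] := boolP (b \in msupp p); last first.
  rewrite memN_msupp_eq0 // scale0r big_seq big1 // => a ap.
  case: eqVneq => [ab|_]; last by rewrite scaler0.
  by rewrite -ab ap in bp.
rewrite (bigD1_seq b) ?msupp_uniq //= eqxx big1 ?addr0 // => a /negPf ->.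
by rewrite scaler0.
Qed.

Lemma vpmul_linearl n v : linear (fun p : {mpoly F[n]} => vpmul p v).
Proof.
move=> a p q; apply/vpolyP=> b; rewrite vcoefP !vpmul_coef mcoeffD mcoeffZ.
by rewrite scalerDl scalerA.
Qed.

Lemma vpmulX n (b : 'X_{1..n}) v : vpmul 'X_[b] v = vmono b v.
Proof.
apply/vpolyP=> c; rewrite vpmul_coef mcoeffX /=.
by case: eqP; rewrite ?scale1r ?scale0r.
Qed.

Lemma vmulX_vpmul n k (p : {mpoly F[n]}) v :
  vmulX k (vpmul p v) = vpmul ('X_k * p) v.
Proof.
suff gen (L : {linear {mpoly F[n]} -> vpoly V n}) :
    (forall b, L 'X_[b] = vmono b v) -> vmulX k (L p) = L ('X_k * p).
  by apply: (gen (lin_of (@vpmul_linearl n v))) => b; exact: vpmulX.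
move=> LX; rewrite (mpolyE p) mulr_sumr !raddf_sum; apply: eq_bigr => b _.
rewrite -scalerAr [RHS]linearZ /= -mpolyXD LX linearZ /= LX.
by rewrite [LHS]linearZ /= vmulX_mono addmC.
Qed.

End VPolyInduction.

(** * Pullback of polynomials along maps of indices *)

Section VPull.

Variables (F : fieldType) (V : lmodType F).

(** Substituting this for lambda_i is dual to setting z_k = w_(pi k). It covers the Lambda_i of a
    composition and, for bijective pi, relabellings of the variables. *)
Definition fibsum a b (pi : 'I_b -> 'I_a) (i : 'I_a) : {mpoly F[b]} :=
  \sum_(k | pi k == i) 'X_k.

Definition vpull a b (pi : 'I_b -> 'I_a) : vpoly V a -> vpoly V b :=
  vsubst (fibsum pi).

Lemma vsubst_linear n k (L : 'I_n -> {mpoly F[k]}) :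
  linear (vsubst (V := V) L).
Proof.
  exact: (@vlift_linear _ _ _ _ (fun a => @vpmul F V k (\prod_(i < n) L i ^+ a
    i))).
Qed.

HB.instance Definition _ n k (L : 'I_n -> {mpoly F[k]}) :=
  GRing.isLinear.Build F (vpoly V n) (vpoly V k) _ (vsubst L) (vsubst_linear L).

Lemma vsubst_mono n k (L : 'I_n -> {mpoly F[k]}) a (v : V) :
  vsubst L (vmono a v) = vpmul (\prod_(i < n) L i ^+ a i) v.
Proof.
  exact: (@vlift_mono _ _ _ _ (fun a => @vpmul F V k (\prod_(i < n) L i ^+ a
    i))).
Qed.

HB.instance Definition _ a b (pi : 'I_b -> 'I_a) := 
  GRing.Linear.on (vpull pi).

Lemma vpull0 a b (pi : 'I_b -> 'I_a) (v : V) : vpull pi (vmono 0%MM v) = vmono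
  0%MM v.
Proof.
rewrite /vpull vsubst_mono big1 => [|i _]; last by rewrite mnm0E expr0.
by rewrite -mpolyX0 vpmulX.
Qed.

Lemma vpull_mulX a b (pi : 'I_b -> 'I_a) i (u : vpoly V a) :
  vpull pi (vmulX i u) = \sum_(k | pi k == i) vmulX k (vpull pi u).
Proof.
pose f1 := (vpull pi \o vmulX i : {linear vpoly V a -> vpoly V b}).
have f2L : linear (fun u => \sum_(k | pi k == i) vmulX k (vpull pi u)).
  move=> c x y; rewrite scaler_sumr -big_split /=; apply: eq_bigr => k _.
  by rewrite !linearP.
apply: (@vpoly_linear_ext _ _ _ _ f1 (lin_of f2L)) => e v /=.
rewrite vmulX_mono /vpull !vsubst_mono.
under eq_bigr do rewrite vmulX_vpmul.
rewrite -(raddf_sum (lin_of (@vpmul_linearl F V b v))) /= -mulr_suml.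
congr (vpmul _ v); rewrite -/(fibsum pi i) (bigD1 i) //= [in RHS](bigD1 i) //=.
rewrite mnmDE mnm1E eqxx addn1 exprS -mulrA; congr (_ * (_ * _)).
by apply: eq_bigr => j ji; rewrite mnmDE mnm1E eq_sym (negPf ji) addn0.
Qed.

(** The fibres of pi partition the indices, so the fibre sums add up to the sum of all lambda_k. *)
Lemma vpull_total_deriv (d : {linear V -> V}) a b (pi : 'I_b -> 'I_a) u :
  vpull pi (total_deriv d u) = total_deriv d (vpull pi u).
Proof.
elim/vpoly_ind: u => [c x y Hx Hy|i x Hx|v].
- by rewrite !linearP /= Hx Hy.
- rewrite -vmulX_total_deriv !vpull_mulX linear_sum; apply: eq_bigr => k _.
  by rewrite Hx vmulX_total_deriv.
rewrite vpull0 !total_deriv_mono linearD /= vpull0; congr (_ + _).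
rewrite linear_sum (partition_big pi xpredT) //=; apply: eq_bigr => i _.
rewrite -vmulX_mono vpull_mulX; apply: eq_bigr => k _.
by rewrite vpull0 vmulX_mono.
Qed.

Lemma vmulXC n i j (u : vpoly V n) : vmulX i (vmulX j u) = vmulX j (vmulX i u).
Proof.
apply: (@vpoly_linear_ext _ _ _ _ (vmulX i \o vmulX j) (vmulX j \o vmulX i)).
by move=> a v /=; rewrite !vmulX_mono -!addmA [(U_(i) + _)%MM]addmC.
Qed.

Lemma vderiv0 n k (v : V) : vderiv k (vmono 0%MM v : vpoly V n) = 0.
Proof. by rewrite vderiv_mono mnm0E scale0r. Qed.

Lemma vderiv_mulX n k i (u : vpoly V n) :
  vderiv k (vmulX i u) = vmulX i (vderiv k u) + (i == k)%:R *: u.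
Proof.
have fL : linear (fun u : vpoly V n => vmulX i (vderiv k u) + (i == k)%:R *: u).
  by move=> c x y /=; rewrite !linearP /= scalerDr addrACA.
apply: (@vpoly_linear_ext _ _ _ _ (vderiv k \o vmulX i) (lin_of fL)) => a v /=.
rewrite vmulX_mono !vderiv_mono linearZ /= vmulX_mono mnmDE mnm1E.
rewrite natrD scalerDl; have [<-|ik] := eqVneq i k; last first.
  rewrite !scale0r !addr0; have [->|ak] := posnP (a k); first by rewrite
    !scale0r.
  by rewrite addmC -addmBA ?lep1mP -?lt0n // addmC.
rewrite addmK; congr (_ + _); have [->|ai] := posnP (a i).
  by rewrite !scale0r.
by rewrite submK // lep1mP -lt0n.
Qed.

(** Chain rule: lambda_k occurs only in the fibre sum of pi k, with coefficient 1. *)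
Lemma vderiv_pull a b (pi : 'I_b -> 'I_a) k (u : vpoly V a) :
  vderiv k (vpull pi u) = vpull pi (vderiv (pi k) u).
Proof.
elim/vpoly_ind: u => [c x y Hx Hy|i x Hx|v].
- by rewrite !linearP /= Hx Hy.
- rewrite vpull_mulX linear_sum /=; under eq_bigr do rewrite vderiv_mulX Hx.
  rewrite vderiv_mulX linearD linearZ /= vpull_mulX big_split /=; congr (_ + _).
  rewrite -scaler_suml -natr_sum; congr (_%:R *: _).
  rewrite big_mkcond (bigD1 k) //= eqxx eq_sym big1 => [|j /negPf ->].
    by case: eqP.
  by case: eqP.
by rewrite vpull0 !vderiv0 linear0.
Qed.

Lemma vpull_comp a b c (pi : 'I_b -> 'I_a) (rho : 'I_c -> 'I_b) (u : vpoly V a)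
  :
  vpull rho (vpull pi u) = vpull (pi \o rho) u.
Proof.
elim/vpoly_ind: u => [e x y Hx Hy|i x Hx|v].
- by rewrite !linearP /= Hx Hy.
- rewrite !vpull_mulX linear_sum /= [RHS](partition_big rho (fun k => pi k ==
  i)) //.
  apply: eq_bigr => k /eqP ki; rewrite vpull_mulX Hx.
  apply: eq_bigl => j /=; case: eqP => [->|]; last by rewrite andbF.
  by rewrite ki eqxx.
by rewrite !vpull0.
Qed.

Lemma vpull_id a (pi : 'I_a -> 'I_a) (u : vpoly V a) : pi =1 id -> vpull pi u =
  u.
Proof.
move=> /funext ->; elim/vpoly_ind: u => [c x y Hx Hy|i x Hx|v].
- by rewrite linearP /= Hx Hy.
- by rewrite vpull_mulX big_pred1_eq Hx.
by rewrite vpull0.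
Qed.

End VPull.

(** * Operations on the quotients by the image of d + lambda_1 + ... + lambda_n *)

Section QModule.

Variables (F : fieldType) (V : superspace F) (d : {linear V -> V}).

Local Notation Q n := (@Defs.qpoly F V n d).
Local Notation Qpi := (@qpi F V _ d).

Lemma qpiK n (x : Q n) : exists u, x = Qpi u.
Proof. by exists (repr x); rewrite -[LHS]imquot_piK. Qed.

Lemma qpi_eq n (u v : vpoly V n) :
  Qpi u = Qpi v -> exists w, u = v + total_deriv d w.
Proof. by move/imquot_eq => [w E]; exists w; rewrite -E addrC subrK. Qed.

Lemma qpiP n a (u v : vpoly V n) : Qpi (a *: u + v) = a *: Qpi u + Qpi v.
Proof. exact: imquot_pi_linear. Qed.

Lemma qpi0 n : Qpi (0 : vpoly V n) = 0.
Proof. exact: (raddf0 (imquot_pi (total_deriv d))). Qed.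

Lemma qpiD n (u v : vpoly V n) : Qpi (u + v) = Qpi u + Qpi v.
Proof. by have := qpiP 1 u v; rewrite !scale1r. Qed.

Lemma qpiZ n a (u : vpoly V n) : Qpi (a *: u) = a *: Qpi u.
Proof. by have := qpiP a u 0; rewrite qpi0 !addr0. Qed.

Lemma qpi_sum n (I : Type) (r : seq I) (P : pred I) (G : I -> vpoly V n) :
  Qpi (\sum_(i <- r | P i) G i) = \sum_(i <- r | P i) Qpi (G i).
Proof. by apply: (big_morph _ (@qpiD n) (qpi0 n)). Qed.

Lemma qpi_deriv n (w : vpoly V n) : Qpi (total_deriv d w) = 0.
Proof. by rewrite -qpi0; apply/imquot_eq; exists w; rewrite subr0. Qed.

Lemma qmulXE n i (u : vpoly V n) : qmulX i (Qpi u) = Qpi (vmulX i u).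
Proof.
by apply: imquot_mapE => [|w]; [exact: vmulX_linear | exact: vmulX_total_deriv].
Qed.

Lemma qderivE n j i (u : vpoly V n) :
  qderiv j i (Qpi u) = Qpi (vderiv j u - vderiv i u).
Proof.
apply: imquot_mapE => [a x y|w].
  by rewrite !vderiv_linear opprD addrACA -scalerBr.
by rewrite !vderiv_total_deriv opprD addrACA subrr addr0 linearB.
Qed.

Definition qpull a b (pi : 'I_b -> 'I_a) : Q a -> Q b := qsubst (fibsum F pi).

Lemma qpullE a b (pi : 'I_b -> 'I_a) u : qpull pi (Qpi u) = Qpi (vpull pi u).
Proof.
apply: imquot_mapE => [|w]; first exact: vsubst_linear.
exact: vpull_total_deriv.
Qed.

Lemma qpull_linear a b (pi : 'I_b -> 'I_a) : linear (qpull pi).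
Proof.
apply: imquot_map_linear => [|w]; first exact: vsubst_linear.
exact: vpull_total_deriv.
Qed.

Definition qmulX0 n i := lin0 (@qmulX_linear F V d n i).
Definition qmulXB n i := linB (@qmulX_linear F V d n i).
Definition qmulXZ n i := linZ (@qmulX_linear F V d n i).
Definition qderivB n j i := linB (@qderiv_linear F V d n j i).
Definition qpull0 a b (pi : 'I_b -> 'I_a) := lin0 (qpull_linear pi).
Definition qpullB a b (pi : 'I_b -> 'I_a) := linB (qpull_linear pi).
Definition qpullD a b (pi : 'I_b -> 'I_a) := linD (qpull_linear pi).
Definition qpullZ a b (pi : 'I_b -> 'I_a) := linZ (qpull_linear pi).
Definition qpull_sum a b (pi : 'I_b -> 'I_a) := lin_sum (qpull_linear pi).

Lemma qpull_mulX a b (pi : 'I_b -> 'I_a) i x :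
  qpull pi (qmulX i x) = \sum_(k | pi k == i) qmulX k (qpull pi x).
Proof.
have [u ->] := qpiK x; rewrite qmulXE !qpullE vpull_mulX qpi_sum.
by apply: eq_bigr => k _; rewrite qmulXE.
Qed.

Lemma qderiv_pull a b (pi : 'I_b -> 'I_a) l k x :
  qderiv l k (qpull pi x) = qpull pi (qderiv (pi l) (pi k) x).
Proof.
have [u ->] := qpiK x; rewrite qpullE !qderivE qpullE !vderiv_pull.
by congr (qpi d _); rewrite linearB.
Qed.

Lemma qpull_comp a b c (pi : 'I_b -> 'I_a) (rho : 'I_c -> 'I_b) x :
  qpull rho (qpull pi x) = qpull (pi \o rho) x.
Proof. by have [u ->] := qpiK x; rewrite !qpullE vpull_comp. Qed.

Lemma qpull_id a (pi : 'I_a -> 'I_a) x : pi =1 id -> qpull pi x = x.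
Proof. by have [u ->] := qpiK x => ?; rewrite !qpullE vpull_id. Qed.

Lemma qmulXC n i j (x : Q n) : qmulX i (qmulX j x) = qmulX j (qmulX i x).
Proof. by have [u ->] := qpiK x; rewrite !qmulXE vmulXC. Qed.

Lemma qderivxx n k (x : Q n) : qderiv k k x = 0.
Proof. by have [u ->] := qpiK x; rewrite qderivE subrr qpi0. Qed.

Lemma qderiv_mulX n l k m (x : Q n) : qderiv l k (qmulX m x) =
  qmulX m (qderiv l k x) + ((m == l)%:R - (m == k)%:R) *: x.
Proof.
have [u ->] := qpiK x; rewrite !(qmulXE, qderivE) !vderiv_mulX.
rewrite -qpiZ -qpiD; congr (qpi d _).
by rewrite opprD addrACA linearB /= scalerBl.
Qed.

Lemma q_ind n (P : Q n -> Prop) :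
  (forall a x y, P x -> P y -> P (a *: x + y)) ->
  (forall i x, P x -> P (qmulX i x)) ->
  (forall v, P (Qpi (vmono 0%MM v))) -> forall x, P x.
Proof.
move=> Plin PX P0 x; have [u ->] := qpiK x.
elim/vpoly_ind: u => [a y z Py Pz|i y Py|v //].
  by rewrite qpiP; apply: Plin.
by rewrite -qmulXE; apply: PX.
Qed.

End QModule.

(** * Functions with prescribed poles *)

(** [Ost F n] is used as a ring without division, so denominators come with explicit inverses. *)
Lemma common_denominator (R : comPzRingType) (g h z z' y y' : R) :
  z * y = 1 -> z' * y' = 1 -> g * y + h * y' = (g * z' + h * z) * (y * y').
Proof.
move=> zy zy'; transitivity (g * y * (z' * y') + h * y' * (z * y)).
  by rewrite zy zy' !mulr1.
by ring.
Qed.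

Lemma cancel_denominators (R : comPzRingType) (g b b' c c' z z' : R) :
  b * b' = 1 -> c * c' = 1 -> z * z' = 1 ->
  g = g * (z' * b') * c' * z * (b * c).
Proof.
move=> bK cK zK; transitivity (g * (b * b') * (c * c') * (z * z')).
  by rewrite bK cK zK !mulr1.
by ring.
Qed.

Section Regular.

Variables (F : fieldType).
Implicit Types n : nat.

Lemma Ost_inj n (f g : Ost F n) : Ost_val f = Ost_val g -> f = g.
Proof. exact: val_inj. Qed.

Lemma Ost_valM n (f g : Ost F n) : Ost_val (f * g) = Ost_val f * Ost_val g.
Proof. by []. Qed.

Lemma Ost_valD n (f g : Ost F n) : Ost_val (f + g) = Ost_val f + Ost_val g.
Proof. by []. Qed.

Lemma Ost_valZ n c (f : Ost F n) : Ost_val (c *: f) = c *: Ost_val f.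
Proof. by []. Qed.

Lemma Ost_val0 n : Ost_val (0 : Ost F n) = 0.
Proof. by []. Qed.

Lemma Ost_val_deriv n k (f : Ost F n) :
  Ost_val (Ost_deriv k f) = rat_deriv k (Ost_val f).
Proof. by []. Qed.

Lemma Ost_val_z n (i j : 'I_n) : Ost_val (Ost_z F i j) = zdiff F i j.
Proof. by []. Qed.

Lemma Ost_val1 n : Ost_val (1 : Ost F n) = 1.
Proof. by []. Qed.

Lemma Ost_scaleAl n c (f g : Ost F n) : c *: (f * g) = c *: f * g.
Proof. by apply: Ost_inj; rewrite Ost_valM !Ost_valZ Ost_valM scalerAl. Qed.

HB.instance Definition _ n :=
  GRing.Lmodule_isLalgebra.Build F (Ost F n) (@Ost_scaleAl n).

Lemma Ost_scaleE n c (f : Ost F n) : c *: f = (c *: 1) * f.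
Proof. by rewrite -Ost_scaleAl mul1r. Qed.

Fact Ost_zV_subproof n (i j : 'I_n) : (zdiff F i j)^-1 \in @Ost_pred F n.
Proof.
apply/Ost_predP; have [->|ij] := eqVneq i j; last exact: in_Ost_zV.
suff -> : (zdiff F j j)^-1 = 0 *: 1 :> ratfun F n by apply: in_Ost_const.
by rewrite scale0r /zdiff subrr; apply/eqP; rewrite invr_eq0; apply/eqP/tofrac0.
Qed.

(* This is 0 for i = j. *)
Definition Ost_zV n (i j : 'I_n) : Ost F n := MkOst (Ost_zV_subproof i j).

Lemma Ost_val_zV n (i j : 'I_n) : Ost_val (Ost_zV i j) = (zdiff F i j)^-1.
Proof. by []. Qed.

Lemma Ost_zK n (i j : 'I_n) : i != j -> Ost_z F i j * Ost_zV i j = 1.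
Proof. by move=> ij; apply: Ost_inj; rewrite Ost_valM mulfV ?zdiff_neq0. Qed.

Lemma Ost_zxx n (i : 'I_n) : Ost_z F i i = 0.
Proof. by apply: Ost_inj; rewrite /= /zdiff subrr; apply: tofrac0. Qed.

Lemma Ost_zN n (i j : 'I_n) : Ost_z F i j = - Ost_z F j i.
Proof.
apply/eqP; rewrite -addr_eq0; apply/eqP/Ost_inj; rewrite Ost_valD /= /zdiff.
by rewrite -tofracD -opprB addNr; apply: tofrac0.
Qed.

Lemma Ost_z_chasles n (i j k : 'I_n) : Ost_z F i j + Ost_z F j k = Ost_z F i k.
Proof.
by apply: Ost_inj; rewrite Ost_valD /= /zdiff -tofracD addrA subrK.
Qed.

(* The functions whose only poles are at z_i = z_j with e i j. *)
Inductive reg n (e : rel 'I_n) : Ost F n -> Prop :=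
| reg_const c : reg e (c *: 1)
| reg_z i j : reg e (Ost_z F i j)
| reg_zV i j : e i j -> reg e (Ost_zV i j)
| regD f g : reg e f -> reg e g -> reg e (f + g)
| regM f g : reg e f -> reg e g -> reg e (f * g).

(** This replaces induction on [in_Ost], a predicate on rational functions, by induction inside the
    subtype [Ost]. *)
Lemma reg_neq n (f : Ost F n) : reg (fun i j => i != j) f.
Proof.
have [f0 E] : exists f0, Ost_val f = f0 by exists (Ost_val f).
have := OstP f; rewrite E => Of; elim: Of f E => {f0}.
- move=> c f E; have -> : f = c *: 1 by apply: Ost_inj; rewrite E Ost_valZ.
  exact: reg_const.
- move=> i j f E; have -> : f = Ost_z F i j by apply: Ost_inj.
  exact: reg_z.
- move=> i j ij f E; have -> : f = Ost_zV i j by apply: Ost_inj.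
  exact: reg_zV.
- move=> g h Og IHg Oh IHh f E.
  pose G : Ost F n := MkOst (introT (Ost_predP g) Og).
  pose H : Ost F n := MkOst (introT (Ost_predP h) Oh).
  have -> : f = G + H by apply: Ost_inj.
  by apply: regD; [apply: IHg | apply: IHh].
move=> g h Og IHg Oh IHh f E.
pose G : Ost F n := MkOst (introT (Ost_predP g) Og).
pose H : Ost F n := MkOst (introT (Ost_predP h) Oh).
have -> : f = G * H by apply: Ost_inj.
by apply: regM; [apply: IHg | apply: IHh].
Qed.

Section RegClosure.

Variables (n : nat) (e : rel 'I_n).
Implicit Types f g : Ost F n.

Lemma reg0 : reg e 0.
Proof. by rewrite -(scale0r 1); apply: reg_const. Qed.

Lemma reg1 : reg e 1.
Proof. by rewrite -(scale1r 1); apply: reg_const. Qed.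

Lemma regZ c f : reg e f -> reg e (c *: f).
Proof.
  by move=> ef; rewrite Ost_scaleE; apply: regM => //; apply: reg_const.
Qed.

Lemma reg_lin a f g : reg e f -> reg e g -> reg e (a *: f + g).
Proof. by move=> ef eg; apply: regD => //; apply: regZ. Qed.

Lemma regN f : reg e f -> reg e (- f).
Proof. by move=> ef; rewrite -scaleN1r; apply: regZ. Qed.

Lemma regB f g : reg e f -> reg e g -> reg e (f - g).
Proof. by move=> ef eg; apply: regD => //; apply: regN. Qed.

Lemma reg_prod (I : Type) (r : seq I) (P : pred I) (f : I -> Ost F n) :
  (forall i, P i -> reg e (f i)) -> reg e (\prod_(i <- r | P i) f i).
Proof.
  by move=> ef; elim/big_rec: _ => [|i g Pi]; [exact: reg1|apply/regM/ef].
Qed.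

Lemma reg_sub (e' : rel 'I_n) f :
  (forall i j, e i j -> e' i j) -> reg e f -> reg e' f.
Proof.
move=> ee'; elim=> [c|i j|i j /ee'|g h _ + _|g h _ + _].
- exact: reg_const.
- exact: reg_z.
- exact: reg_zV.
- exact: regD.
exact: regM.
Qed.

End RegClosure.

Section Derivation.

Variables (n : nat).
Implicit Types (f g : Ost F n) (k : 'I_n).

Lemma Ost_derivD k f g : Ost_deriv k (f + g) = Ost_deriv k f + Ost_deriv k g.
Proof. by apply: Ost_inj; rewrite !(Ost_val_deriv, Ost_valD) rat_derivD. Qed.

Lemma Ost_derivM k f g :
  Ost_deriv k (f * g) = Ost_deriv k f * g + f * Ost_deriv k g.
Proof.
apply: Ost_inj.
by rewrite !(Ost_val_deriv, Ost_valD, Ost_valM) rat_derivM.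
Qed.

Lemma Ost_deriv_const k c : Ost_deriv k (c *: 1 : Ost F n) = 0.
Proof.
apply: Ost_inj.
by rewrite Ost_val_deriv Ost_valZ Ost_val1 rat_deriv_const Ost_val0.
Qed.

Lemma Ost_deriv1 k : Ost_deriv k (1 : Ost F n) = 0.
Proof. by rewrite -(scale1r 1) Ost_deriv_const. Qed.

Lemma Ost_derivP k a f g :
  Ost_deriv k (a *: f + g) = a *: Ost_deriv k f + Ost_deriv k g.
Proof.
rewrite Ost_derivD Ost_scaleE Ost_derivM Ost_deriv_const mul0r add0r.
by rewrite -Ost_scaleE.
Qed.

Lemma Ost_deriv0 k : Ost_deriv k (0 : Ost F n) = 0.
Proof. by rewrite -[in LHS](scale0r 1) Ost_deriv_const. Qed.

Lemma Ost_derivZ k a f : Ost_deriv k (a *: f) = a *: Ost_deriv k f.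
Proof. by have := Ost_derivP k a f 0; rewrite Ost_deriv0 !addr0. Qed.

Lemma Ost_deriv_z k i j :
  Ost_deriv k (Ost_z F i j) = ((i == k)%:R - (j == k)%:R) *: 1.
Proof.
apply: Ost_inj.
by rewrite Ost_val_deriv Ost_val_z rat_deriv_z Ost_valZ Ost_val1.
Qed.

Lemma Ost_deriv_zV k i j : Ost_deriv k (Ost_zV i j) =
  - ((i == k)%:R - (j == k)%:R) *: (Ost_zV i j * Ost_zV i j).
Proof.
have [->|ij] := eqVneq i j.
  rewrite subrr oppr0 scale0r -(Ost_deriv_const k 0) scale0r; congr Ost_deriv.
  apply: Ost_inj => /=; apply/eqP; rewrite invr_eq0 /zdiff subrr;
    apply/eqP/tofrac0.
apply: Ost_inj; rewrite Ost_val_deriv Ost_valZ Ost_valM !Ost_val_zV.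
by rewrite rat_deriv_zV // -scalerAl mul1r.
Qed.

Lemma reg_deriv (e : rel 'I_n) k f : reg e f -> reg e (Ost_deriv k f).
Proof.
elim=> [c|i j|i j ij|g h eg edg eh edh|g h eg edg eh edh].
- by rewrite Ost_deriv_const; apply: reg0.
- by rewrite Ost_deriv_z; apply: reg_const.
- by rewrite Ost_deriv_zV; apply: regZ; apply: regM; apply: reg_zV.
- by rewrite Ost_derivD; apply: regD.
by rewrite Ost_derivM; apply: regD; apply: regM.
Qed.

Lemma Ost_derivC k l f : Ost_deriv k (Ost_deriv l f) = Ost_deriv l (Ost_deriv k
  f).
Proof.
elim: (reg_neq f) => [c|i j|i j ij|g h eg edg eh edh|g h eg edg eh edh].
- by rewrite !(Ost_deriv_const, Ost_deriv0).
- by rewrite !(Ost_deriv_z, Ost_deriv_const).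
- rewrite !(Ost_deriv_zV, Ost_derivZ, Ost_derivM).
  rewrite -!Ost_scaleAl ![Ost_zV i j * (_ *: _)]mulrC -!Ost_scaleAl.
  by rewrite !scalerDr !scalerA [_ * _ in RHS]mulrC.
- by rewrite !Ost_derivD edg edh.
rewrite !(Ost_derivM, Ost_derivD) edg edh -!addrA; congr (_ + _).
by rewrite addrCA.
Qed.

End Derivation.

(** * Restriction of functions to diagonals *)

Section Substitution.

Implicit Types a b : nat.

HB.instance Definition _ a b (pi : 'I_a -> 'I_b) :=
  GRing.RMorphism.copy (@poly_subst F a b pi)
    (comp_mpoly [tuple 'X_(pi k) | k < a]).

Lemma poly_substX a b (pi : 'I_a -> 'I_b) i : poly_subst pi 'X_i = 'X_(pi i) :>
  {mpoly F[b]}.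
Proof. by rewrite /poly_subst comp_mpolyXU -tnth_nth tnth_mktuple. Qed.

Lemma poly_substM a b (pi : 'I_a -> 'I_b) : {morph @poly_subst F a b pi : p q /
  p * q}.
Proof. exact: rmorphM. Qed.

Lemma poly_substD a b (pi : 'I_a -> 'I_b) : {morph @poly_subst F a b pi : p q /
  p + q}.
Proof. exact: rmorphD. Qed.

Lemma poly_subst0 a b (pi : 'I_a -> 'I_b) : @poly_subst F a b pi 0 = 0.
Proof. exact: rmorph0. Qed.

Lemma poly_subst1 a b (pi : 'I_a -> 'I_b) : @poly_subst F a b pi 1 = 1.
Proof. exact: rmorph1. Qed.

Lemma poly_substXB a b (pi : 'I_a -> 'I_b) i j :
  poly_subst pi ('X_i - 'X_j) = 'X_(pi i) - 'X_(pi j) :> {mpoly F[b]}.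
Proof. by rewrite rmorphB /= !poly_substX. Qed.

Lemma poly_substC a b (pi : 'I_a -> 'I_b) c :
  poly_subst pi c%:MP = c%:MP :> {mpoly F[b]}.
Proof. exact: comp_mpolyC. Qed.

(** Two fractions representing f agree after cross multiplication, an identity that [poly_subst]
    preserves; hence the choice made by [xget] can only be g. *)
Lemma Ost_substE a b (pi : 'I_a -> 'I_b) (f : Ost F a) p q (g : Ost F b) :
  Ost_val f = frac_of p q -> poly_subst pi q != 0 ->
  Ost_val g = frac_of (poly_subst pi p) (poly_subst pi q) ->
  Ost_subst pi f = g.
Proof.
move=> fE q0 gE; rewrite /Ost_subst.
case: xgetP => [h _ [p' [q' [fE' q'0 hE]]]|/(_ g) []]; last by exists p, q.
apply: Ost_inj; rewrite gE hE; apply/frac_eq => //; rewrite -!poly_substM.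
congr poly_subst; apply/frac_eq; last by rewrite -fE -fE'.
- by apply: contraNneq q'0 => ->; rewrite poly_subst0.
by apply: contraNneq q0 => ->; rewrite poly_subst0.
Qed.

Lemma frac_ofD (R : idomainType) (p q r s : R) : q != 0 -> s != 0 ->
  frac_of p q + frac_of r s = frac_of (p * s + r * q) (q * s).
Proof.
  by move=> q0 s0; rewrite /frac_of addf_div ?tofrac_eq0 // tofracD !tofracM.
Qed.

Lemma frac_ofM (R : idomainType) (p q r s : R) :
  frac_of p q * frac_of r s = frac_of (p * r) (q * s).
Proof. by rewrite /frac_of mulf_div !tofracM. Qed.

Lemma frac_of1 (R : idomainType) (p : R) : frac_of p 1 = tofrac p.
Proof. by rewrite /frac_of tofrac1 divr1. Qed.

(** The value of [Ost_subst] is known only once a fraction with surviving denominator is exhibited,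
    so one induction builds the fraction, the value and the regularity of the value together. *)
Lemma reg_subst_ex a b (pi : 'I_a -> 'I_b) (e : rel 'I_a) (e' : rel 'I_b) f :
  (forall i j, e' i j -> i != j) -> (forall i j, e i j -> e' (pi i) (pi j)) ->
  reg e f ->
  exists p q g, [/\ Ost_val f = frac_of p q, poly_subst pi q != 0,
    Ost_val g = frac_of (poly_subst pi p) (poly_subst pi q) & reg e' g].
Proof.
move=> e'neq ee'; have nz q : poly_subst pi q != 0 -> q != 0 :> {mpoly F[a]}.
  by apply: contraNneq => ->; rewrite poly_subst0.
elim=> [c|i j|i j ij|g h _ [p [q [G [gE q0 GE rG]]]] _ [r [s [H [hE s0 HE rH]]]]
  |g h _ [p [q [G [gE q0 GE rG]]]] _ [r [s [H [hE s0 HE rH]]]]].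
- exists c%:MP, 1, (c *: 1); rewrite poly_subst1 poly_substC oner_eq0; split=>
  //.
  + by rewrite frac_of1; apply: mulr1.
  + by rewrite frac_of1; apply: mulr1.
  exact: reg_const.
- exists ('X_i - 'X_j), 1, (Ost_z F (pi i) (pi j)).
  rewrite poly_subst1 poly_substXB oner_eq0; split=> //.
  + by rewrite frac_of1.
  + by rewrite frac_of1.
  exact: reg_z.
- exists 1, ('X_i - 'X_j), (Ost_zV (pi i) (pi j)).
  rewrite poly_subst1 poly_substXB; split=> //.
  + by rewrite /frac_of tofrac1 mul1r.
  + by have := zdiff_neq0 F (e'neq _ _ (ee' _ _ ij)); rewrite tofrac_eq0.
  + by rewrite /frac_of tofrac1 mul1r.
  exact/reg_zV/ee'.
- exists (p * s + r * q), (q * s), (G + H).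
  rewrite !Ost_valD poly_substD !poly_substM mulf_neq0 // gE hE GE HE !frac_ofD
    ?nz //.
  by split=> //; apply: regD.
exists (p * r), (q * s), (G * H).
rewrite !Ost_valM !poly_substM mulf_neq0 // gE hE GE HE !frac_ofM.
by split=> //; apply: regM.
Qed.

(* Poles are allowed only between different fibres of pi. *)
Definition off a b (pi : 'I_a -> 'I_b) : rel 'I_a := fun i j => pi i != pi j.

Section SubstMorphism.

Variables (a b : nat) (pi : 'I_a -> 'I_b).
Implicit Types f g : Ost F a.

Let ex f : reg (off pi) f ->
  exists p q, [/\ Ost_val f = frac_of p q, poly_subst pi q != 0 &
    Ost_val (Ost_subst pi f) = frac_of (poly_subst pi p) (poly_subst pi q)].
Proof.
case/(@reg_subst_ex _ _ pi _ (fun i j => i != j)) => // p [q [g [fE q0 gE _]]].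
by exists p, q; split=> //; rewrite (Ost_substE fE q0 gE).
Qed.

Let nz q : poly_subst pi q != 0 -> q != 0 :> {mpoly F[a]}.
Proof. by apply: contraNneq => ->; rewrite poly_subst0. Qed.

Lemma Ost_substD f g : reg (off pi) f -> reg (off pi) g ->
  Ost_subst pi (f + g) = Ost_subst pi f + Ost_subst pi g.
Proof.
case/ex => p [q [fE q0 fsE]] /ex [r [s [gE s0 gsE]]].
apply: (@Ost_substE _ _ _ _ (p * s + r * q) (q * s)).
- by rewrite Ost_valD fE gE frac_ofD ?nz.
- by rewrite poly_substM mulf_neq0.
by rewrite Ost_valD fsE gsE (frac_ofD _ _ q0 s0) poly_substD !poly_substM.
Qed.

Lemma Ost_substM f g : reg (off pi) f -> reg (off pi) g ->
  Ost_subst pi (f * g) = Ost_subst pi f * Ost_subst pi g.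
Proof.
case/ex => p [q [fE q0 fsE]] /ex [r [s [gE s0 gsE]]].
apply: (@Ost_substE _ _ _ _ (p * r) (q * s)).
- by rewrite Ost_valM fE gE frac_ofM.
- by rewrite poly_substM mulf_neq0.
by rewrite Ost_valM fsE gsE frac_ofM !poly_substM.
Qed.

Lemma Ost_subst_const c : Ost_subst pi (c *: 1 : Ost F a) = c *: 1.
Proof.
apply: (@Ost_substE _ _ _ _ c%:MP 1); rewrite ?poly_subst1 ?poly_substC
  ?oner_eq0 //.
  by rewrite frac_of1; apply: mulr1.
by rewrite frac_of1; apply: mulr1.
Qed.

Lemma Ost_subst1 : Ost_subst pi (1 : Ost F a) = 1.
Proof. by rewrite -[in LHS](scale1r 1) Ost_subst_const scale1r. Qed.

Lemma Ost_subst0 : Ost_subst pi (0 : Ost F a) = 0.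
Proof. by rewrite -[in LHS](scale0r 1) Ost_subst_const scale0r. Qed.

Lemma Ost_subst_z i j : Ost_subst pi (Ost_z F i j) = Ost_z F (pi i) (pi j).
Proof.
apply: (@Ost_substE _ _ _ _ ('X_i - 'X_j) 1).
- by rewrite frac_of1.
- by rewrite poly_subst1 oner_eq0.
by rewrite poly_subst1 poly_substXB frac_of1.
Qed.

Lemma Ost_subst_zV i j : pi i != pi j ->
  Ost_subst pi (Ost_zV i j) = Ost_zV (pi i) (pi j).
Proof.
move=> ij; apply: (@Ost_substE _ _ _ _ 1 ('X_i - 'X_j)).
- by rewrite /frac_of tofrac1 mul1r.
- by have := zdiff_neq0 F ij; rewrite tofrac_eq0 poly_substXB.
by rewrite poly_subst1 poly_substXB /frac_of tofrac1 mul1r.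
Qed.

Lemma Ost_substP c f g : reg (off pi) f -> reg (off pi) g ->
  Ost_subst pi (c *: f + g) = c *: Ost_subst pi f + Ost_subst pi g.
Proof.
move=> rf rg; rewrite Ost_substD ?[c *: f]Ost_scaleE //; last first.
  by apply: regM => //; apply: reg_const.
by rewrite Ost_substM ?Ost_subst_const -?Ost_scaleE //; apply: reg_const.
Qed.

Lemma Ost_subst_prod (I : Type) (r : seq I) (P : pred I) (f : I -> Ost F a) :
  (forall i, P i -> reg (off pi) (f i)) ->
  Ost_subst pi (\prod_(i <- r | P i) f i)
    = \prod_(i <- r | P i) Ost_subst pi (f i).
Proof.
move=> rf; elim: r => [|i r IHr]; first by rewrite !big_nil Ost_subst1.
rewrite !big_cons; case: ifP => // Pi; rewrite Ost_substM ?IHr //.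
  exact: rf.
exact: reg_prod.
Qed.

Lemma reg_subst (e : rel 'I_a) (e' : rel 'I_b) f :
  (forall i j, e' i j -> i != j) -> (forall i j, e i j -> e' (pi i) (pi j)) ->
  reg e f -> reg e' (Ost_subst pi f).
Proof.
move=> e'n ee' /(reg_subst_ex e'n ee') [p [q [g [fE q0 gE rg]]]].
by rewrite (Ost_substE fE q0 gE).
Qed.

(** Chain rule for z_k = w_(pi k). On the generators both sides carry the coefficient given by
    [sumE]. *)
Lemma Ost_deriv_subst i f : reg (off pi) f ->
  Ost_deriv i (Ost_subst pi f) = \sum_(k | pi k == i) Ost_subst pi (Ost_deriv k
    f).
Proof.
have sumE k : \sum_(l | pi l == i) (k == l)%:R = (pi k == i)%:R :> F.
  rewrite -natr_sum big_mkcond (bigD1 k) //= eqxx big1 ?addn0 => [|l].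
    by case: eqP.
  by rewrite eq_sym => /negPf ->; case: eqP.
elim=> [c|k l|k l kl|g h rg IHg rh IHh|g h rg IHg rh IHh].
- rewrite Ost_subst_const Ost_deriv_const big1 // => k _.
  by rewrite Ost_deriv_const Ost_subst0.
- rewrite Ost_subst_z Ost_deriv_z -!sumE -sumrB scaler_suml.
  by apply: eq_bigr => m _; rewrite Ost_deriv_z Ost_subst_const.
- rewrite Ost_subst_zV // Ost_deriv_zV -!sumE -sumrB -sumrN scaler_suml.
  apply: eq_bigr => m _; rewrite Ost_deriv_zV Ost_scaleE [in RHS]Ost_scaleE.
  have rV := reg_zV kl; rewrite !Ost_substM ?Ost_subst_zV ?Ost_subst_const //.
    exact: reg_const.
  exact: regM.
- rewrite (Ost_substD rg rh) Ost_derivD IHg IHh -big_split.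
  by apply: eq_bigr => k _; rewrite Ost_derivD Ost_substD //; apply: reg_deriv.
rewrite (Ost_substM rg rh) Ost_derivM IHg IHh mulr_suml mulr_sumr -big_split.
apply: eq_bigr => k _; have [rdg rdh] := (reg_deriv k rg, reg_deriv k rh).
by rewrite Ost_derivM Ost_substD ?Ost_substM //; apply: regM.
Qed.

End SubstMorphism.

Lemma off_inj a b (pi : 'I_a -> 'I_b) : injective pi ->
  off pi = (fun i j => i != j).
Proof.
  by move=> pi_inj; apply/funext => i; apply/funext => j; rewrite /off inj_eq.
Qed.

Lemma reg_inj a b (pi : 'I_a -> 'I_b) f : injective pi -> reg (off pi) f.
Proof. by move/off_inj ->; apply: reg_neq. Qed.

Lemma Ost_subst_comp a b c (pi : 'I_a -> 'I_b) (rho : 'I_b -> 'I_c) f :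
  reg (off (rho \o pi)) f ->
  Ost_subst rho (Ost_subst pi f) = Ost_subst (rho \o pi) f.
Proof.
have sub : forall i j, off (rho \o pi) i j -> off pi i j.
  by move=> i j; apply: contraNneq => E; rewrite /= E.
have rs g : reg (off (rho \o pi)) g -> reg (off rho) (Ost_subst pi g).
  by apply: reg_subst => // i j; apply: contraNneq => ->.
elim=> [e|i j|i j ij|g h rg IHg rh IHh|g h rg IHg rh IHh].
- by rewrite !Ost_subst_const.
- by rewrite !Ost_subst_z.
- by rewrite !Ost_subst_zV //; apply: sub.
- rewrite !Ost_substD ?IHg ?IHh //; try exact: rs; exact: reg_sub sub _.
rewrite !Ost_substM ?IHg ?IHh //; try exact: rs; exact: reg_sub sub _.
Qed.

Lemma Ost_subst_id a (f : Ost F a) : Ost_subst (@id 'I_a) f = f.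
Proof.
have rf g : reg (off (@id 'I_a)) g by apply: reg_inj.
elim: (rf f) => [e|i j|i j ij|g h rg IHg rh IHh|g h rg IHg rh IHh].
- by rewrite !Ost_subst_const.
- by rewrite !Ost_subst_z.
- by rewrite !Ost_subst_zV.
- by rewrite Ost_substD // IHg IHh.
by rewrite Ost_substM // IHg IHh.
Qed.

End Substitution.

(** With no pole allowed, [reg] describes the translation invariant polynomials. *)
Definition norel n : rel 'I_n := fun _ _ => false.

Definition zVprod n (L : seq ('I_n * 'I_n)) : Ost F n :=
  \prod_(kl <- L) Ost_zV kl.1 kl.2.
Definition zprod n (L : seq ('I_n * 'I_n)) : Ost F n :=
  \prod_(kl <- L) Ost_z F kl.1 kl.2.

Lemma zVprod_cat n (L L' : seq ('I_n * 'I_n)) :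
  zVprod (L ++ L') = zVprod L * zVprod L'.
Proof. by rewrite /zVprod big_cat. Qed.

Lemma reg_zprod n (e : rel 'I_n) L : reg e (zprod L).
Proof. by apply: reg_prod => kl _; apply: reg_z. Qed.

Lemma reg_zVprod n (e : rel 'I_n) L :
  all (fun kl => e kl.1 kl.2) L -> reg e (zVprod L).
Proof.
rewrite /zVprod; elim: L => [|kl L IHL] /=; first by rewrite big_nil => _;
  apply: reg1.
by case/andP => ekl /IHL eL; rewrite big_cons; apply: regM => //; apply: reg_zV.
Qed.

Lemma zprodK n (L : seq ('I_n * 'I_n)) : all (fun kl => kl.1 != kl.2) L ->
  zprod L * zVprod L = 1.
Proof.
rewrite /zVprod /zprod; elim: L => [|kl L IHL] /=; first by rewrite !big_nil
  mulr1.
by case/andP => ekl /IHL eL; rewrite !big_cons mulrACA eL Ost_zK // mulr1.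
Qed.

(** The poles outside e' are factored out into L, sums being brought to a common denominator. With
    e' = [norel] this clears all denominators; with e' = [off pi] it isolates the poles inside the
    blocks. *)
Lemma reg_decomp n (e e' : rel 'I_n) f :
  (forall i j, e i j -> i != j) -> reg e f ->
  exists L g, [/\ reg e' g, all (fun kl => e kl.1 kl.2 && ~~ e' kl.1 kl.2) L &
    f = g * zVprod L].
Proof.
move=> en.
have LK L : all (fun kl => e kl.1 kl.2 && ~~ e' kl.1 kl.2) L -> zprod L * zVprod
  L = 1.
  by move=> eL; apply/zprodK/(sub_all _ eL) => kl /andP[/en].
elim=> [c|i j|i j ij|g h rg [L [g' [rg' eL gE]]] rh [M [h' [rh' eM hE]]]
  |g h rg [L [g' [rg' eL gE]]] rh [M [h' [rh' eM hE]]]].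
- by exists [::], (c *: 1); rewrite /zVprod big_nil mulr1; split=> //; apply:
  reg_const.
- by exists [::], (Ost_z F i j); rewrite /zVprod big_nil mulr1; split=> //;
  apply: reg_z.
- have [e'ij|e'ij] := boolP (e' i j).
    by exists [::], (Ost_zV i j); rewrite /zVprod big_nil mulr1; split=> //;
      apply: reg_zV.
  exists [:: (i, j)], 1; rewrite /zVprod big_seq1 mul1r /= ij e'ij.
  by split=> //; apply: reg1.
- exists (L ++ M), (g' * zprod M + h' * zprod L); rewrite all_cat eL eM; split=>
  //.
    by apply: regD; apply: regM => //; apply: reg_zprod.
  by rewrite zVprod_cat gE hE; apply: common_denominator; apply: LK.
exists (L ++ M), (g' * h'); rewrite all_cat eL eM; split=> //; first exact:
  regM.
by rewrite zVprod_cat gE hE mulrACA.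
Qed.

(** The substitution z_l = z_k, convertible to the map used in [no_pole]. *)
Definition merge n (k l : 'I_n) : 'I_n -> 'I_n := fun i => if i == l then k else
  i.

Lemma reg_norel n a (pi : 'I_n -> 'I_a) (f : Ost F n) :
  reg (@norel n) f -> reg (off pi) f.
Proof. exact: reg_sub. Qed.

Lemma reg_merge n (k l : 'I_n) (f : Ost F n) : reg (@norel n) f ->
  reg (@norel n) (Ost_subst (merge k l) f).
Proof. exact: reg_subst. Qed.

(* If moreover f vanishes on z_l = z_k, this is its divisibility by z_kl, within
   the translation invariant polynomials. *)
Lemma merge_divides n (k l : 'I_n) (f : Ost F n) : reg (@norel n) f ->
  exists2 h, reg (@norel n) h & f - Ost_subst (merge k l) f = Ost_z F k l * h.
Proof.
have zE i : exists c : F, Ost_z F i (merge k l i) = Ost_z F k l * (c *: 1).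
  rewrite /merge; case: eqP => [->|_].
    by exists (-1); rewrite scaleN1r mulrN1; apply: Ost_zN.
  by exists 0; rewrite scale0r mulr0 Ost_zxx.
elim=> [c|i j|i j //|g h rg [g' rg' gE] rh [h' rh' hE]
  |g h rg [g' rg' gE] rh [h' rh' hE]].
- by exists 0; [exact: reg0 | rewrite Ost_subst_const subrr mulr0].
- have [[c cE] [c' c'E]] := (zE i, zE j); exists (c *: 1 - c' *: 1).
    by apply: regB; apply: reg_const.
  rewrite mulrBr -cE -c'E Ost_subst_z -(Ost_z_chasles i (merge k l i) j).
  rewrite -(Ost_z_chasles (merge k l i) j (merge k l j)) opprD !addrA.
  by rewrite addrK.
- exists (g' + h'); first exact: regD.
  rewrite Ost_substD; [|exact: reg_norel..].
  by rewrite mulrDr -gE -hE opprD addrACA.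
exists (g' * h + Ost_subst (merge k l) g * h').
  by apply: regD; apply: regM => //; apply: reg_merge.
rewrite Ost_substM; [|exact: reg_norel..].
rewrite mulrDr mulrA -gE mulrCA -hE mulrBl mulrBr addrA subrK.
by [].
Qed.

Lemma reg_norel_poly n (f : Ost F n) : reg (@norel n) f ->
  exists p, Ost_val f = tofrac p.
Proof.
elim=> [c|i j|i j //|g h rg [p gE] rh [q hE]|g h rg [p gE] rh [q hE]].
- by exists c%:MP; apply: mulr1.
- by exists ('X_i - 'X_j).
- by exists (p + q); rewrite Ost_valD gE hE tofracD.
by exists (p * q); rewrite Ost_valM gE hE tofracM.
Qed.

Lemma tofrac_inj (R : idomainType) : injective (@tofrac R).
Proof. by move=> x y /eqP; rewrite tofrac_eq => /eqP. Qed.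

(** With f = p / q, the identity g q = p z_kl c restricts to zero on z_k = z_l, where q does not
    vanish identically. So g vanishes there, and [merge_divides] applies. *)
Lemma no_pole_divides n (k l : 'I_n) (f g c : Ost F n) :
  no_pole k l f -> reg (@norel n) g -> reg (@norel n) c ->
  g = f * Ost_z F k l * c -> exists2 h, reg (@norel n) h & g = Ost_z F k l * h.
Proof.
case=> p [q [fE q0]] rg rc gE.
have [g0 g0E] := reg_norel_poly rg; have [c0 c0E] := reg_norel_poly rc.
have qn0 : q != 0 by apply: contraNneq q0 => ->; rewrite poly_subst0.
have E : g0 * q = p * ('X_k - 'X_l) * c0.
  apply: tofrac_inj; rewrite !tofracM -g0E -c0E gE !Ost_valM fE Ost_val_z
    /zdiff.
  rewrite /frac_of; have : tofrac q != 0 by rewrite tofrac_eq0.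
  move=> Q0; rewrite -!mulrA; congr (_ * _).
  by rewrite [X in _^-1 * X]mulrA [X in _^-1 * X]mulrC mulKf.
have g00 : poly_subst (merge k l) g0 = 0.
  have := congr1 (poly_subst (merge k l)) E.
  rewrite !poly_substM poly_substXB /merge eqxx.
  have -> : (if k == l then k else k) = k by case: ifP.
  by rewrite subrr mulr0 mul0r => /eqP; rewrite mulf_eq0 (negPf q0) orbF =>
    /eqP.
have sg0 : Ost_subst (merge k l) g = 0.
  apply: (@Ost_substE _ _ _ _ g0 1); rewrite ?poly_subst1 ?oner_eq0 //.
    by rewrite frac_of1.
  by rewrite frac_of1 g00; apply/esym/tofrac0.
by have [h rh] := merge_divides k l rg; rewrite sg0 subr0; exists h.
Qed.

(** All denominators of f are cleared and sorted into the list B of pairs inside a fibre and the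
    list G of pairs across fibres. The factors of B then cancel one after the other against the
    numerator. *)
Lemma reg_of_no_pole n a (pi : 'I_n -> 'I_a) (f : Ost F n) :
  (forall k l, k != l -> pi k = pi l -> no_pole k l f) -> reg (off pi) f.
Proof.
move=> fnp; have [L [g [rg nL fE]]] := reg_decomp (@norel n) (fun _ _ => id)
  (reg_neq f).
pose bad := fun kl : 'I_n * 'I_n => pi kl.1 == pi kl.2.
pose B := filter bad L; pose G := filter (predC bad) L.
have {}fE : f = g * zVprod B * zVprod G.
  rewrite fE -mulrA; congr (_ * _); rewrite -zVprod_cat.
  by apply: perm_big; rewrite perm_sym perm_filterC.
have nB : all (fun kl => (kl.1 != kl.2) && bad kl) B.
  apply/allP => kl; rewrite mem_filter => /andP[bkl /(allP nL)].
  by rewrite bkl => /andP[->].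
have nG : all (fun kl => (kl.1 != kl.2) && ~~ bad kl) G.
  apply/allP => kl; rewrite mem_filter => /andP[/= bkl /(allP nL)].
  by rewrite bkl => /andP[->].
have GK : zprod G * zVprod G = 1.
  by apply: zprodK; apply: sub_all nG => kl /andP[].
move: B G nB nG GK g rg fE => B G nB nG GK {nL}; elim: B nB => [|[k l] B IHB] nB
  g rg fE.
  rewrite fE {1}/zVprod big_nil mulr1; apply: regM; first exact: reg_norel.
  by apply: reg_zVprod; apply: sub_all nG => kl /andP[].
case/andP: nB => /= /andP[kl /eqP pikl] nB.
have BK : zprod B * zVprod B = 1.
  by apply: zprodK; apply: sub_all nB => ij /andP[].
have zK := Ost_zK kl; move: fE; rewrite {1}/zVprod big_cons -/(zVprod B) /= =>
  fE.
(* The numerator g is f times z_kl times the remaining denominators, so z_kl divides it. *)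
have [||h rh gE] := @no_pole_divides n k l f g (zprod B * zprod G) (fnp _ _ kl
  pikl) rg.
- by apply: regM; apply: reg_zprod.
- by rewrite fE; apply: cancel_denominators.
apply: (IHB nB h rh); rewrite fE gE; congr (_ * _); rewrite mulrA; congr (_ *
  _).
by rewrite mulrAC zK mul1r.
Qed.

(** Merging two indices of one fibre moves no index to another fibre, so denominators across fibres
    survive. *)
Lemma no_pole_of_reg n a (pi : 'I_n -> 'I_a) (k l : 'I_n) (f : Ost F n) :
  reg (off pi) f -> pi k = pi l -> no_pole k l f.
Proof.
move=> rf pikl; have pm i : pi (merge k l i) = pi i.
  by rewrite /merge; case: eqP => // ->.
have [|i j|p [q [g [fE q0 _ _]]]] :=
    @reg_subst_ex _ _ (merge k l) (off pi) (fun i j => i != j) f _ _ rf => //.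
  by apply: contraNneq => E; rewrite -pm E pm.
by exists p, q.
Qed.

End Regular.

(** * The operators lambda_k - d/dz_k *)

Notation upd v i x := (@dfwith _ _ v i x) (only parsing).

Section Families.

Variables (I : eqType) (T : I -> Type).
Implicit Types (u : forall i, T i) (i : I).

Lemma eq_dfam (u u' : forall i, T i) : (forall i, u i = u' i) -> u = u'.
Proof. exact: functional_extensionality_dep. Qed.

Lemma dfwith_id u i : dfwith u (u i) = u.
Proof. by apply: eq_dfam => j; case: dfwithP. Qed.

Lemma dfwith2 u i (x y : T i) : dfwith (dfwith u x) y = dfwith u y.
Proof.
apply: eq_dfam => j; case: (dfwithP (dfwith u x)) => [|k ik]; first by rewrite
  dfwith_in.
by rewrite !dfwith_out.
Qed.

Lemma dfwithC u i j (x : T i) (y : T j) : i != j ->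
  dfwith (dfwith u x) y = dfwith (dfwith u y) x.
Proof.
move=> ij; apply: eq_dfam => k; have [<-|jk] := eqVneq j k.
  by rewrite dfwith_in dfwith_out // dfwith_in.
rewrite dfwith_out //; have [<-|ik] := eqVneq i k; first by rewrite !dfwith_in.
by rewrite !dfwith_out.
Qed.

End Families.

Lemma dfwith_map (I : eqType) (T U : I -> Type) (f : forall i, T i -> U i)
    (u : forall i, T i) i (x : T i) :
  (fun j => f j (dfwith u x j)) = dfwith (fun j => f j (u j)) (f i x).
Proof.
apply: eq_dfam => j; have [<-|ij] := eqVneq i j; first by rewrite !dfwith_in.
by rewrite !dfwith_out.
Qed.

(** [is_chiral] is stated with [[eta _ with _ |-> _]], while the dependent families below require
    [dfwith]. *)
Lemma dfwith_eta (I : eqType) (T : Type) (v : I -> T) i x :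
  upd v i x = [eta v with i |-> x].
Proof.
apply/funext => j /=; have [->|ij] := eqVneq j i; first by rewrite dfwith_in.
by rewrite dfwith_out // eq_sym.
Qed.

(** Reduces a statement about arbitrary families to families of generators, those satisfying S, one
    slot at a time. In the proof, k bounds the initial slots that are still arbitrary. *)
Lemma slot_ind n (T : 'I_n -> Type) (S : forall i, T i -> Prop)
    (P : (forall i, T i) -> Prop) :
  (forall u i (x : T i), (forall y, S i y -> P (dfwith u y)) -> P (dfwith u x))
    ->
  (forall u, (forall i, S i (u i)) -> P u) -> forall u, P u.
Proof.
move=> Pslot PS u.
suff {u} H k u : (forall i : 'I_n, (k <= i)%N -> S i (u i)) -> P u.
  by apply: (H n) => i; rewrite leqNgt ltn_ord.
elim: k u => [|k IHk] u uS; first by apply: PS => i; apply: uS.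
have [kn|nk] := ltnP k n; last first.
  by apply: IHk => i ki; have := leq_trans nk ki; rewrite leqNgt ltn_ord.
pose i : 'I_n := Ordinal kn.
rewrite -(dfwith_id u i); apply: Pslot => y Sy; apply: IHk => j.
case: dfwithP => [//|{}j ij kj]; apply: uS; rewrite ltn_neqAle kj andbT.
by move: ij; rewrite -val_eqE.
Qed.

Section ShiftOperators.

Variables (F : fieldType) (V : superspace F) (d : {linear V -> V}).
Local Notation Q n := (@Defs.qpoly F V n d).

Variable (n : nat).
Implicit Types (Phi Psi : Ost F n -> Q n).

Lemma shift_opE k Phi g : shift_op k Phi g = qmulX k (Phi g) - Phi (Ost_deriv k
  g).
Proof. by []. Qed.

Lemma shift_opC k l Phi : shift_op k (shift_op l Phi) = shift_op l (shift_op k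
  Phi).
Proof.
apply/funext => g; rewrite !shift_opE !qmulXB qmulXC Ost_derivC !opprB.
by rewrite addrACA [RHS]addrACA; congr (_ + _); rewrite addrC.
Qed.

Lemma iter_shift_opC p k l Phi :
  iter p (shift_op l) (shift_op k Phi) = shift_op k (iter p (shift_op l) Phi).
Proof. by elim: p => //= p ->; rewrite shift_opC. Qed.

Lemma shift_monomial0 Phi : shift_monomial 0%MM Phi = Phi.
Proof.
by rewrite /shift_monomial; elim: (enum _) => //= k s ->; rewrite mnm0E.
Qed.

(** The operators are composed in the order of the enumeration; since they commute, the additional
    one can be taken outermost. *)
Lemma shift_monomialS a k Phi :
  shift_monomial (a + U_(k))%MM Phi = shift_op k (shift_monomial a Phi).
Proof.
rewrite /shift_monomial.
suff gen s : uniq s ->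
    foldr (fun l => iter ((a + U_(k))%MM l) (shift_op l)) Phi s
    = iter (k \in s) (shift_op k) (foldr (fun l => iter (a l) (shift_op l)) Phi
      s).
  by rewrite gen ?enum_uniq // mem_enum.
elim: s => //= l s IHs /andP[ls /IHs ->]; rewrite in_cons mnmDE mnm1E.
have [->|kl] := eqVneq k l; first by rewrite (negPf ls) addn1.
by rewrite addn0 /=; case: (k \in s) => //=; rewrite iter_shift_opC.
Qed.

Lemma shift_monomial_ind (P : (Ost F n -> Q n) -> Prop) a Phi :
  (forall k Psi, P Psi -> P (shift_op k Psi)) -> P Phi -> P (shift_monomial a
    Phi).
Proof.
move=> PS P0; rewrite /shift_monomial; elim: (enum _) => //= k s IHs.
by elim: (a k) => //= p IHp; apply: PS.
Qed.

Lemma shift_monomial_linear a c Phi Psi Theta :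
  (forall g, Theta g = c *: Phi g + Psi g) ->
  forall g, shift_monomial a Theta g
    = c *: shift_monomial a Phi g + shift_monomial a Psi g.
Proof.
move=> E; rewrite /shift_monomial; elim: (enum _) => [|k s IHs] //=.
elim: (a k) => [|p IHp] //= g; rewrite !shift_opE !IHp qmulX_linear.
by rewrite scalerBr opprD addrACA.
Qed.

(** The operators evaluate Phi only at g and at its iterated derivatives, and these stay in
    [reg e]. *)
Lemma shift_monomial_eq (e : rel 'I_n) a Phi Psi :
  (forall g, reg e g -> Phi g = Psi g) ->
  forall g, reg e g -> shift_monomial a Phi g = shift_monomial a Psi g.
Proof.
move=> E; rewrite /shift_monomial; elim: (enum _) => [|k s IHs] //=.
elim: (a k) => [|p IHp] //= g rg; rewrite !shift_opE !IHp //.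
exact: reg_deriv.
Qed.

Lemma shift_monomial_zero a Phi : (forall g, Phi g = 0) ->
  forall g, shift_monomial a Phi g = 0.
Proof.
move=> Phi0; apply: (@shift_monomial_ind (fun Psi => forall g, Psi g = 0)) => //
  k Psi Psi0 g.
by rewrite shift_opE !Psi0 qmulX0 subr0.
Qed.

End ShiftOperators.

(** * Chiral maps and their pullbacks *)

Section ChiralMaps.

Variables (F : fieldType) (V : superspace F) (d : {linear V -> V}).
Local Notation Q n := (@Defs.qpoly F V n d).
Local Notation P n := (@Pch F V d n).
Local Notation Qpi := (@qpi F V _ d).

Lemma Pch_chiral n (Y : P n) : is_chiral (Y : _ -> _ -> Q n).
Proof. by case: Y => Y /= /chiral_predP. Qed.

Lemma Pch_lin n (Y : P n) v a f g : Y v (a *: f + g) = a *: Y v f + Y v g.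
Proof. exact: (chiral_linear (Pch_chiral Y)). Qed.

Lemma Pch_multi n (Y : P n) v i a x y f :
  Y (upd v i (a *: x + y)) f = a *: Y (upd v i x) f + Y (upd v i y) f.
Proof. by rewrite !dfwith_eta (chiral_multilinear (Pch_chiral Y)). Qed.

Lemma Pch_slot0 n (Y : P n) v i f : v i = 0 -> Y v f = 0.
Proof.
move=> vi; have <- : upd v i 0 = v by rewrite -vi dfwith_id.
by have := Pch_multi Y v i (-1) 0 0 f; rewrite scaler0 addr0 scaleN1r addNr.
Qed.

Lemma Pch_deriv n (Y : P n) v i f :
  Y (upd v i (d (v i))) f + qmulX i (Y v f) = Y v (Ost_deriv i f).
Proof. by rewrite dfwith_eta (chiral_deriv (Pch_chiral Y)). Qed.

Lemma Pch_z n (Y : P n) v i j f :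
  Y v (Ost_z F i j * f) = qderiv j i (Y v f).
Proof. exact: (chiral_zmul (Pch_chiral Y)). Qed.

Lemma Pch_eqP n (X Y : P n) : (forall v f, X v f = Y v f) -> X = Y.
Proof.
  by move=> XY; apply/val_inj/funext => v; apply/funext => f; apply: XY.
Qed.

(** The map g |-> Y(w; g|) to which the inductions reduce; for bijective pi it relabels the
    variables of Y. *)
Definition pullmap n M (pi : 'I_M -> 'I_n) (Y : P n) w (g : Ost F M) : Q M :=
  qpull pi (Y w (Ost_subst pi g)).

Section PullMap.

Variables (n M : nat) (pi : 'I_M -> 'I_n) (Y : P n).
Local Notation R := (reg (off pi)).

Lemma pullmap_lin w a g h : R g -> R h ->
  pullmap pi Y w (a *: g + h) = a *: pullmap pi Y w g + pullmap pi Y w h.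
Proof.
  by move=> rg rh; rewrite /pullmap Ost_substP // Pch_lin qpull_linear.
Qed.

Lemma pullmap_multi w i a x y g :
  pullmap pi Y (upd w i (a *: x + y)) g
  = a *: pullmap pi Y (upd w i x) g + pullmap pi Y (upd w i y) g.
Proof. by rewrite /pullmap Pch_multi qpull_linear. Qed.

Lemma pullmap_slot0 w i g : w i = 0 -> pullmap pi Y w g = 0.
Proof. by move=> wi; rewrite /pullmap (Pch_slot0 _ _ wi) qpull0. Qed.

Lemma pullmap_z w k l g : R g ->
  pullmap pi Y w (Ost_z F k l * g) = qderiv l k (pullmap pi Y w g).
Proof.
move=> rg; rewrite /pullmap Ost_substM //; last exact: reg_z.
by rewrite Ost_subst_z Pch_z qderiv_pull.
Qed.

(** Sesquilinearity of Y in slot i, spread over the fibre: the pullback turns lambda_i into the sum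
    of the lambda_k, and the chain rule turns d/dw_i into the sum of the d/dz_k. This is the
    constant case of [grhs_total_deriv]. *)
Lemma pullmap_deriv w i g : R g ->
  pullmap pi Y (upd w i (d (w i))) g
    + \sum_(k | pi k == i) shift_op k (pullmap pi Y w) g = 0.
Proof.
move=> rg; under eq_bigr do rewrite shift_opE.
rewrite sumrB /pullmap -qpull_mulX addrA -qpullD Pch_deriv Ost_deriv_subst //.
have Ysum (r : seq 'I_M) (p : pred 'I_M) (f : 'I_M -> Ost F n) :
    Y w (\sum_(k <- r | p k) f k) = \sum_(k <- r | p k) Y w (f k).
  exact: (lin_sum (Pch_lin Y w)).
by rewrite Ysum qpull_sum subrr.
Qed.

End PullMap.
End ChiralMaps.

(** * The right-hand side of the composition formula *)

(* rho i enumerates the fibre of pi over i, in any order. *)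
Record blocks n M (m : 'I_n -> nat) (pi : 'I_M -> 'I_n)
    (rho : forall i, 'I_(m i) -> 'I_M) : Prop := Blocks {
  blocks_pi : forall i j, pi (rho i j) = i;
  blocks_inj : forall i, injective (rho i);
  blocks_surj : forall k, exists j, rho (pi k) j = k }.

Section BlockIndices.

Variables (n M : nat) (m : 'I_n -> nat) (pi : 'I_M -> 'I_n).
Variable (rho : forall i, 'I_(m i) -> 'I_M).
Hypothesis B : blocks pi rho.

Lemma block_bigop (T : Type) (idx : T) (op : Monoid.com_law idx) i (f : 'I_M ->
  T) :
  \big[op/idx]_(k | pi k == i) f k = \big[op/idx]_(j < m i) f (rho j).
Proof.
rewrite -big_filter -(big_map (@rho i) xpredT f).
apply/perm_big/uniq_perm => [||k].
- exact/filter_uniq/index_enum_uniq.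
- by rewrite map_inj_uniq ?index_enum_uniq //; apply: (blocks_inj B).
rewrite mem_filter mem_index_enum andbT; apply/eqP/mapP => [<-|[j _ ->]].
  by have [j jk] := blocks_surj B k; exists j; rewrite ?mem_index_enum ?jk.
exact: (blocks_pi B).
Qed.

Definition brestr i (a : 'X_{1..M}) : 'X_{1..m i} := [multinom a (rho j) | j < m
  i].

Lemma brestrE i (a : 'X_{1..M}) (j : 'I_(m i)) : brestr i a j = a (rho j).
Proof. by rewrite mnmE. Qed.

Lemma brestr_inj (a b : 'X_{1..M}) : (forall i, brestr i a = brestr i b) -> a =
  b.
Proof.
move=> ab; apply/mnmP => k; have [j <-] := blocks_surj B k.
by rewrite -!brestrE ab.
Qed.

Lemma brestr_add i (a b : 'X_{1..M}) : brestr i (a + b) = (brestr i a + brestr i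
  b)%MM.
Proof. by apply/mnmP => j; rewrite mnmDE !brestrE mnmDE. Qed.

Lemma brestr0 i : brestr i 0 = 0%MM.
Proof. by apply/mnmP => j; rewrite brestrE !mnm0E. Qed.

Lemma brestr1 i (j : 'I_(m i)) : brestr i U_(rho j) = U_(j)%MM.
Proof.
by apply/mnmP => k; rewrite brestrE !mnm1E (inj_eq (@blocks_inj _ _ _ _ _ B i)).
Qed.

Lemma brestr1_out i i' (j : 'I_(m i)) : i != i' -> brestr i' U_(rho j) = 0%MM.
Proof.
move=> ii'; apply/mnmP => k; rewrite brestrE mnm1E mnm0E.
by case: eqP => // /(congr1 pi); rewrite !(blocks_pi B) => /eqP; rewrite (negPf
  ii').
Qed.

Lemma brestr_deg (a : 'X_{1..M}) : mdeg a = (\sum_i mdeg (brestr i a))%N.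
Proof.
rewrite mdegE (partition_big pi xpredT) //=; apply: eq_bigr => i _.
rewrite mdegE block_bigop; apply: eq_bigr => j _.
by rewrite brestrE.
Qed.

Lemma brestr_all (b : forall i, 'X_{1..m i}) : exists a, forall i, brestr i a =
  b i.
Proof.
pose jn k := projT1 (cid (blocks_surj B k)).
have jnE k : rho (jn k) = k := projT2 (cid (blocks_surj B k)).
exists [multinom b (pi k) (jn k) | k < M] => i; apply/mnmP => j.
(* The types depend on the block, so the equality i' = i has to be extracted and eliminated before
   the positions can be compared. *)
have gen i' (j' : 'I_(m i')) : rho j' = rho j -> b i' j' = b i j.
  move=> E; have ii' : i' = i by rewrite -(blocks_pi B j') E (blocks_pi B).
  by case: _ / ii' in j j' E *; rewrite (blocks_inj B E).
by rewrite brestrE mnmE; apply: gen.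
Qed.

End BlockIndices.

Lemma fsbig_seq (T : choiceType) (R : nmodType) (s : seq T) (f : T -> R) :
  uniq s -> (forall a, a \notin s -> f a = 0) ->
  \sum_(a \in [set: T]) f a = \sum_(a <- s) f a.
Proof.
move=> us fs; rewrite (@fsbigTE _ _ _ _ [fset a in s]%fset) => [|a]; last first.
  by rewrite in_fset => /fs.
by apply/perm_big/uniq_perm => // a; rewrite in_fset.
Qed.

Section BlockRHS.

Variables (F : fieldType) (V : superspace F) (d : {linear V -> V}).
Local Notation Q n := (@Defs.qpoly F V n d).
Local Notation Qpi := (@qpi F V _ d).

Variables (n M : nat) (m : 'I_n -> nat) (pi : 'I_M -> 'I_n).
Variable (rho : forall i, 'I_(m i) -> 'I_M).
Hypothesis B : blocks pi rho.
Variable Y : Pch d n.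

Local Notation R := (reg (off pi)).
Implicit Types (u : forall i, vpoly V (m i)) (x : forall i, Q (m i)).

Definition bcoef u (a : 'X_{1..M}) : 'I_n -> V := fun i => u i (brestr rho i a).

(* chiral_comp_rhs for arbitrary blocks *)
Definition grhs u (g : Ost F M) : Q M :=
  \sum_(a \in [set: 'X_{1..M}]) shift_monomial a (pullmap pi Y (bcoef u a)) g.

Lemma bcoef_upd u i (v : vpoly V (m i)) a :
  bcoef (dfwith u v) a = upd (bcoef u a) i (v (brestr rho i a)).
Proof.
  exact: (dfwith_map (fun i (w : vpoly V (m i)) => w (brestr rho i a))).
Qed.

(** If the total degree exceeds the sum of the bounds for the blocks, some block exceeds its own
    bound, and the coefficient of u there is zero. *)
Lemma bcoef_vanish u : exists N, forall a, (N <= mdeg a)%N -> exists i, bcoef u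
  a i = 0.
Proof.
have bound i : exists N, forall b, (N <= mdeg b)%N -> u i b = 0.
  have [s us] := vpoly_support (u i); exists (\max_(b <- s) mdeg b).+1 => b bN.
  apply: us; apply: contraTN bN => bs; rewrite -ltnNge ltnS.
  by rewrite (big_rem b bs) leq_maxl.
pose N i := projT1 (cid (bound i)).
have NE i : forall b, (N i <= mdeg b)%N -> u i b = 0 := projT2 (cid (bound i)).
exists (\sum_i N i).+1 => a; rewrite (brestr_deg B) => aN.
have [i Ni] : exists i, (N i <= mdeg (brestr rho i a))%N.
  apply/existsP; apply: contraTT aN => /existsPn Na; rewrite -ltnNge ltnS.
  by apply: leq_sum => i _; apply: ltnW; rewrite ltnNge Na.
by exists i; apply: NE.
Qed.

(** Every larger bound N' is allowed, so that the sums for several families can be compared over one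
    finite range. *)
Lemma grhs_trunc u : exists N, forall N', (N <= N')%N -> forall g,
  grhs u g = \sum_(a : 'X_{1..M < N'}) shift_monomial a (pullmap pi Y (bcoef u
    a)) g.
Proof.
have [N uN] := bcoef_vanish u; exists N => N' NN' g.
rewrite /grhs (@fsbig_seq _ _ [seq bmnm a | a : 'X_{1..M < N'}]) ?big_image //.
  by rewrite map_inj_uniq ?enum_uniq //; apply: val_inj.
move=> a aN'; apply: shift_monomial_zero => h.
have [|i ui0] := uN a; last exact: pullmap_slot0 ui0.
rewrite (leq_trans NN') // leqNgt; apply: contra aN' => aN'.
by apply/mapP; exists (BMultinom aN'); rewrite ?mem_enum.
Qed.

Lemma grhs_multi u i c (v w : vpoly V (m i)) g :
  grhs (dfwith u (c *: v + w)) g = c *: grhs (dfwith u v) g + grhs (dfwith u w)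
    g.
Proof.
have [[N1 E1] [N2 E2] [N3 E3]] := And3 (grhs_trunc (dfwith u (c *: v + w)))
  (grhs_trunc (dfwith u v)) (grhs_trunc (dfwith u w)).
pose N := maxn N1 (maxn N2 N3).
rewrite (E1 N) ?leq_maxl // (E2 N) ?(E3 N) /N ?leq_max ?leqnn ?orbT //.
rewrite scaler_sumr -big_split; apply: eq_bigr => a _.
apply: shift_monomial_linear => h; rewrite !bcoef_upd.
exact: pullmap_multi.
Qed.

Lemma grhs_mono a w g :
  grhs (fun i => vmono (brestr rho i a) (w i)) g = shift_monomial a (pullmap pi
    Y w) g.
Proof.
rewrite /grhs (@fsbig_seq _ _ [:: a]) //; last first.
  move=> b; rewrite inE => ba; apply: shift_monomial_zero => h.
  have [i ab] : exists i, brestr rho i a != brestr rho i b.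
    apply/existsP; apply: contraNT ba => /existsPn ab; apply/eqP/esym.
    by apply: (brestr_inj B) => i; apply/eqP; rewrite -[_ == _]negbK ab.
  by apply: (@pullmap_slot0 _ _ _ _ _ _ _ _ i); rewrite /bcoef /= (negPf ab).
rewrite big_seq1; congr (shift_monomial a (pullmap pi Y _) g).
by apply/funext => i; rewrite /bcoef /= eqxx.
Qed.

(** The exponents in the separate slots are assembled into one global exponent a by [brestr_all],
    the form in which [grhs_mono] evaluates the sum. *)
Lemma mono_ind (P : (forall i, vpoly V (m i)) -> Prop) :
  (forall u i c v w, P (dfwith u v) -> P (dfwith u w) ->
     P (@dfwith _ _ u i (c *: v + w))) ->
  (forall a w, P (fun i => vmono (brestr rho i a) (w i))) -> forall u, P u.
Proof.
move=> Plin Pmono.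
apply: (slot_ind (S := fun i v => exists b w, v = vmono b w)) => [u i v Pv|u
  umono].
  have [s ->] := vpoly_sum v.
  elim: s => [|b s IHs]; first by rewrite big_nil -(raddf0 (vmono 0%MM)); apply:
    Pv; exists 0%MM, 0.
  by rewrite big_cons -[vmono _ _]scale1r; apply: Plin => //; apply: Pv; exists
    b, (v b).
pose b i := projT1 (cid (umono i)); pose w i := projT1 (cid (projT2 (cid (umono
  i)))).
have uE i : u i = vmono (b i) (w i) := projT2 (cid (projT2 (cid (umono i)))).
have [a aE] := brestr_all B b.
have -> : u = fun i => vmono (brestr rho i a) (w i) by apply: eq_dfam => i;
  rewrite aE.
exact: Pmono.
Qed.

Lemma grhs_mulX u i j g :
  grhs (dfwith u (vmulX j (u i))) g = shift_op (@rho i j) (grhs u) g.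
Proof.
elim/mono_ind: u g => [u i' c v w Hv Hw g|a w g].
  rewrite shift_opE !grhs_multi.
  have [E|ii'] := eqVneq i' i.
    case: _ / E in j Hv Hw *; move: (Hv g) (Hw g).
    rewrite !dfwith_in !dfwith2 vmulX_linear grhs_multi => -> ->.
    rewrite !shift_opE qmulX_linear scalerBr opprD addrACA.
    by [].
  move: (Hv g) (Hw g); rewrite !dfwith_out // !(dfwithC _ _ _ ii') grhs_multi =>
    -> ->.
  by rewrite !shift_opE qmulX_linear scalerBr opprD addrACA.
(* For monomials, multiplying slot i by its j-th variable raises the global exponent at rho j by
   one. *)
have -> : dfwith (fun i => vmono (brestr rho i a) (w i))
    (vmulX j (vmono (brestr rho i a) (w i)))
    = fun i' => vmono (brestr rho i' (a + U_(rho j))%MM) (w i').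
  apply: eq_dfam => i'; rewrite brestr_add; have [<-|ii'] := eqVneq i i'.
    by rewrite dfwith_in vmulX_mono (brestr1 B).
  by rewrite dfwith_out // (brestr1_out B) // addm0.
rewrite grhs_mono shift_monomialS; congr (shift_op _ _ g).
by apply/funext => h; rewrite grhs_mono.
Qed.

Lemma grhs_const w g :
  grhs (fun i => vmono 0%MM (w i)) g = pullmap pi Y w g.
Proof.
rewrite -(shift_monomial0 (pullmap pi Y w)) -grhs_mono.
by congr (grhs _ g); apply: eq_dfam => i; rewrite brestr0.
Qed.

Lemma vfam_ind (P : (forall i, vpoly V (m i)) -> Prop) :
  (forall u i c v w, P (dfwith u v) -> P (dfwith u w) ->
     P (@dfwith _ _ u i (c *: v + w))) ->
  (forall u i j, P u -> P (dfwith u (vmulX j (u i)))) ->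
  (forall w, P (fun i => vmono 0%MM (w i))) -> forall u, P u.
Proof.
move=> Plin PX P0.
apply: (slot_ind (S := fun i v => exists w, v = vmono 0%MM w)) => [u i v Pv|u
  umono].
  elim/vpoly_ind: v => [c v w Hv Hw|j v Hv|v]; first exact: Plin.
    by have := PX _ i j Hv; rewrite dfwith_in dfwith2.
  by apply: Pv; exists v.
pose w i := projT1 (cid (umono i)).
have -> : u = fun i => vmono 0%MM (w i).
  by apply: eq_dfam => i; apply: (projT2 (cid (umono i))).
exact: P0.
Qed.

Lemma grhs_total_deriv u i g : R g ->
  grhs (dfwith u (total_deriv d (u i))) g = 0.
Proof.
elim/vfam_ind: u g => [u i' c v w Hv Hw g rg|u i' j Hu g rg|w g rg].
- move: (Hv g rg) (Hw g rg); have [E|ii'] := eqVneq i' i.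
    case: _ / E in Hv Hw *; rewrite !dfwith_in !dfwith2 total_deriv_linear.
    by rewrite grhs_multi => -> ->; rewrite scaler0 addr0.
  rewrite !dfwith_out // !(dfwithC _ _ _ ii') grhs_multi => -> ->.
  by rewrite scaler0 addr0.
- have [E|ii'] := eqVneq i' i.
    case: _ / E in Hu *; rewrite dfwith_in dfwith2 -vmulX_total_deriv.
    have := grhs_mulX (dfwith u (total_deriv d (u i'))) j g.
    rewrite dfwith_in dfwith2 => ->; rewrite shift_opE !Hu ?qmulX0 ?subr0 //.
    exact: reg_deriv.
  rewrite dfwith_out // dfwithC //.
  have := grhs_mulX (dfwith u (total_deriv d (u i))) j g.
  rewrite dfwith_out 1?eq_sym // => ->; rewrite shift_opE !Hu ?qmulX0 ?subr0 //.
  exact: reg_deriv.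
(* On constants, d replaces w_i by d (w_i) and each lambda_j acts as the operator of index rho j;
   the sum of these vanishes by [pullmap_deriv]. *)
rewrite total_deriv_mono; under eq_bigr do rewrite -vmulX_mono.
set u0 := fun i => vmono 0%MM (w i) : vpoly V (m i).
have gsum (r : seq 'I_(m i)) : grhs (dfwith u0 (\sum_(j <- r) vmulX j (vmono
  0%MM (w i)))) g
    = \sum_(j <- r) shift_op (rho j) (pullmap pi Y w) g.
  elim: r => [|j r IHr].
    rewrite !big_nil; have := grhs_multi u0 (-1) (0 : vpoly V (m i)) 0 g.
    by rewrite scaler0 addr0 scaleN1r addNr.
  rewrite !big_cons -[vmulX _ _]scale1r grhs_multi scale1r IHr; congr (_ + _).
  have := grhs_mulX u0 j g; rewrite /u0 => ->; congr (shift_op _ _ g).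
  by apply/funext => h; rewrite grhs_const.
rewrite -[vmono _ _]scale1r grhs_multi scale1r gsum.
have -> : @dfwith _ _ u0 i (vmono 0%MM (d (w i)))
    = fun i' => vmono 0%MM (upd w i (d (w i)) i') : vpoly V (m i').
  apply: eq_dfam => j; have [<-|ij] := eqVneq i j; first by rewrite !dfwith_in.
  by rewrite !dfwith_out.
by rewrite grhs_const; have := pullmap_deriv Y w i rg; rewrite (block_bigop B).
Qed.

(** The slots are changed from u to u' one by one, each time by an element of the image of
    [total_deriv]. *)
Lemma grhs_eq u u' g : R g -> (forall i, Qpi (u i) = Qpi (u' i)) ->
  grhs u g = grhs u' g.
Proof.
move=> rg; elim/(@slot_ind _ _ (fun i v => v = u' i)): u => [u i v Pv uu'|u uu'
  _].
  have [w vE] := qpi_eq (etrans (congr1 (qpi d) (esym (dfwith_in u v))) (uu'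
    i)).
  rewrite -(Pv _ erefl) => [|j]; last first.
    have [<-|ij] := eqVneq i j; first by rewrite dfwith_in.
    by have := uu' j; rewrite !dfwith_out.
  rewrite vE -[X in X + total_deriv _ _]scale1r grhs_multi scale1r.
  have := grhs_total_deriv (dfwith u w) i rg; rewrite dfwith_in dfwith2 => ->.
  by rewrite addr0.
by congr (grhs _ g); apply: eq_dfam.
Qed.

(* Locked, since rewriting would otherwise unify it with arbitrary sums. *)
Fact qrhs_key : unit. Proof. exact: tt. Qed.
Definition qrhs x g := locked_with qrhs_key (grhs (fun i => repr (x i)) g).

Lemma qrhs_unlock x g : qrhs x g = grhs (fun i => repr (x i)) g.
Proof. by rewrite /qrhs unlock. Qed.

Lemma qrhsE u x g : R g -> (forall i, Qpi (u i) = x i) -> grhs u g = qrhs x g.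
Proof.
  by move=> rg ux; rewrite qrhs_unlock; apply: grhs_eq => // i;
    rewrite ux -[LHS]imquot_piK.
Qed.

Lemma qrhs_upd x i (v : vpoly V (m i)) g : R g ->
  qrhs (dfwith x (Qpi v)) g = grhs (dfwith (fun i => repr (x i)) v) g.
Proof.
move=> rg; apply/esym/qrhsE => // j; have [<-|ij] := eqVneq i j.
  by rewrite !dfwith_in.
by rewrite !dfwith_out //; apply: imquot_piK.
Qed.

Lemma qrhs_multi x i c (y z : Q (m i)) g : R g ->
  qrhs (dfwith x (c *: y + z)) g = c *: qrhs (dfwith x y) g + qrhs (dfwith x z)
    g.
Proof.
move=> rg; have [v ->] := qpiK y; have [w ->] := qpiK z.
by rewrite -qpiP !qrhs_upd // grhs_multi.
Qed.

Lemma qrhs_slot0 x i g : R g -> x i = 0 -> qrhs x g = 0.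
Proof.
move=> rg xi0; have <- : @dfwith _ _ x i 0 = x by rewrite -xi0 dfwith_id.
by have := qrhs_multi x (-1) (0 : Q (m i)) 0 rg; rewrite scaler0 addr0 scaleN1r
  addNr.
Qed.

Lemma qrhs_mulX x i j g : R g ->
  qrhs (dfwith x (qmulX j (x i))) g = shift_op (@rho i j) (qrhs x) g.
Proof.
move=> rg; have xE : x i = Qpi (repr (x i)) by rewrite -[LHS]imquot_piK.
rewrite xE qmulXE qrhs_upd // grhs_mulX; congr (shift_op _ _ g).
by apply/funext => h; rewrite qrhs_unlock.
Qed.

Lemma qrhs_const w g : R g ->
  qrhs (fun i => Qpi (vmono 0%MM (w i))) g = pullmap pi Y w g.
Proof. by move=> rg; rewrite -grhs_const; apply/esym/qrhsE. Qed.

Lemma qfam_ind (P : (forall i, Q (m i)) -> Prop) :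
  (forall x i c y z, P (dfwith x y) -> P (dfwith x z) ->
     P (@dfwith _ _ x i (c *: y + z))) ->
  (forall x i j, P x -> P (dfwith x (qmulX j (x i)))) ->
  (forall w, P (fun i => Qpi (vmono 0%MM (w i)))) -> forall x, P x.
Proof.
move=> Plin PX P0.
apply: (slot_ind (S := fun i y => exists w, y = Qpi (vmono 0%MM w))) => [x i y
  Py|x xmono].
  elim/q_ind: y => [c y z Hy Hz|j y Hy|v]; first exact: Plin.
    by have := PX _ i j Hy; rewrite dfwith_in dfwith2.
  by apply: Py; exists v.
pose w i := projT1 (cid (xmono i)).
have -> : x = fun i => Qpi (vmono 0%MM (w i)).
  by apply: eq_dfam => i; apply: (projT2 (cid (xmono i))).
exact: P0.
Qed.

Lemma qrhs_lin x c g h : R g -> R h ->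
  qrhs x (c *: g + h) = c *: qrhs x g + qrhs x h.
Proof.
elim/qfam_ind: x c g h => [x i e y z Hy Hz c g h rg rh|x i j Hx c g h rg rh|w c
  g h rg rh].
- have rgh := reg_lin c rg rh; rewrite !qrhs_multi // Hy // Hz // !scalerDr.
  by rewrite !scalerA [e * c]mulrC addrACA.
- have rgh := reg_lin c rg rh; rewrite !qrhs_mulX // !shift_opE Hx //
  qmulX_linear.
  rewrite Ost_derivP Hx; [|exact: reg_deriv..].
  by rewrite scalerBr opprD addrACA.
have rgh := reg_lin c rg rh; rewrite !qrhs_const //; exact: pullmap_lin.
Qed.

Lemma qrhs_z x k l g : R g ->
  qrhs x (Ost_z F k l * g) = qderiv l k (qrhs x g).
Proof.
elim/qfam_ind: x g => [x i e y z Hy Hz g rg|x i j Hx g rg|w g rg].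
- have rzg := regM (reg_z F _ k l) rg; rewrite !qrhs_multi // Hy // Hz //.
  by rewrite qderiv_linear.
- have rzg := regM (reg_z F _ k l) rg; rewrite !qrhs_mulX // !shift_opE Hx //.
  rewrite qderivB qderiv_mulX Ost_derivM Ost_deriv_z -Ost_scaleE.
  have rdg := reg_deriv (rho j) rg; rewrite qrhs_lin //; last first.
    by apply: regM => //; apply: reg_z.
  rewrite Hx // opprD addrA; congr (_ - _); congr (_ + _).
  by rewrite -scaleNr opprB ![rho j == _]eq_sym.
have rzg := regM (reg_z F _ k l) rg; rewrite !qrhs_const //; exact: pullmap_z.
Qed.

(** On constants both sides vanish: the derivatives of a constant are zero, and a pullback depends
    on the variables of a block only through their sum. In the inductive step, the commutators of
    the lambda-derivatives with lambda_k agree in the slot and outside, as rho is injective on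
    blocks. *)
Lemma qrhs_block_z x i (j j' : 'I_(m i)) g : R g ->
  qrhs (dfwith x (qderiv j' j (x i))) g = qrhs x (Ost_z F (rho j) (rho j') * g).
Proof.
move=> rg; rewrite qrhs_z //.
elim/qfam_ind: x g rg => [x i' c y z Hy Hz g rg|x i' k Hx g rg|w g rg].
- have [E|ii'] := eqVneq i' i.
    case: _ / E in j j' Hy Hz *; move: (Hy g rg) (Hz g rg).
    rewrite !dfwith_in !dfwith2 qderiv_linear !qrhs_multi // => -> ->.
    by rewrite qderiv_linear.
  move: (Hy g rg) (Hz g rg); rewrite !dfwith_out // !(dfwithC _ _ _ ii').
  by rewrite !qrhs_multi // => -> ->; rewrite qderiv_linear.
- have rdg := reg_deriv (@rho i' k) rg; have [E|ii'] := eqVneq i' i.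
    case: _ / E in j j' Hx *; rewrite dfwith_in dfwith2 qderiv_mulX addrC.
    rewrite qrhs_multi // dfwith_id qrhs_mulX // shift_opE qderivB qderiv_mulX.
    have := qrhs_mulX (dfwith x (qderiv j' j (x i'))) k rg.
    rewrite dfwith_in dfwith2 => ->; rewrite shift_opE !Hx //.
    rewrite !(inj_eq (@blocks_inj _ _ _ _ _ B i')).
    by rewrite addrA; congr (_ - _); rewrite addrC.
  rewrite dfwith_out // dfwithC //.
  have := qrhs_mulX (dfwith x (qderiv j' j (x i))) k rg.
  rewrite dfwith_out 1?eq_sym // => ->; rewrite qrhs_mulX // !shift_opE !Hx //.
  rewrite qderivB qderiv_mulX; congr (_ - _).
  have ne (l : 'I_(m i)) : (rho k == rho l) = false.
    by apply: contraNF ii' => /eqP/(congr1 pi); rewrite !(blocks_pi B) => ->.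
  by rewrite !ne subrr scale0r addr0.
rewrite qrhs_const // /pullmap qderiv_pull !(blocks_pi B) qderivxx qpull0.
rewrite qderivE !vderiv0 subrr qpi0.
by apply: (@qrhs_slot0 _ i); rewrite ?dfwith_in.
Qed.

End BlockRHS.

Section SlotSums.

Variables (F : fieldType) (V : superspace F) (d : {linear V -> V}).
Local Notation Q n := (@Defs.qpoly F V n d).
Variables (n M : nat) (m : 'I_n -> nat) (pi : 'I_M -> 'I_n).
Variable (rho : forall i, 'I_(m i) -> 'I_M).
Hypothesis B : blocks pi rho.
Variable Y : Pch d n.
Implicit Types (x : forall i, Q (m i)).

Lemma qrhs_slot_sum x i (I : Type) (r : seq I) (p : pred I) (y : I -> Q (m i)) g
  :
  reg (off pi) g ->
  qrhs pi rho Y (dfwith x (\sum_(k <- r | p k) y k)) g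
    = \sum_(k <- r | p k) qrhs pi rho Y (dfwith x (y k)) g.
Proof.
move=> rg; apply: (lin_sum (f := fun z : Q (m i) => qrhs pi rho Y (dfwith x z)
  g)).
by move=> a z w; apply: qrhs_multi.
Qed.

Lemma qrhs_sum x (I : Type) (r : seq I) (p : pred I) (g : I -> Ost F M) :
  (forall k, reg (off pi) (g k)) ->
  qrhs pi rho Y x (\sum_(k <- r | p k) g k)
    = \sum_(k <- r | p k) qrhs pi rho Y x (g k).
Proof.
move=> rg; elim: r => [|k r IHr].
  rewrite !big_nil; have := qrhs_lin B Y x (-1) (reg0 F _) (reg0 F _).
  by rewrite scaler0 addr0 scaleN1r addNr.
rewrite !big_cons; case: (p k) => //; rewrite -IHr -[g k]scale1r.
rewrite qrhs_lin ?scale1r //; elim: r {IHr} => [|l r IHr].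
  by rewrite big_nil; apply: reg0.
by rewrite big_cons; case: (p l) => //; apply: regD.
Qed.

End SlotSums.

(** * Compatibility with maps between block structures *)

Section Intertwine.

Variables (F : fieldType) (V : superspace F) (d : {linear V -> V}).
Local Notation Q n := (@Defs.qpoly F V n d).
Variables (n M M' : nat) (m m' : 'I_n -> nat).
Variables (pi : 'I_M -> 'I_n) (rho : forall i, 'I_(m i) -> 'I_M).
Variables (pi' : 'I_M' -> 'I_n) (rho' : forall i, 'I_(m' i) -> 'I_M').
Hypotheses (B : blocks pi rho) (B' : blocks pi' rho').
Variables (th : 'I_M' -> 'I_M) (eta : forall i, 'I_(m' i) -> 'I_(m i)).
Hypothesis pi_th : forall k, pi (th k) = pi' k.
Hypothesis th_rho : forall i j, th (@rho' i j) = @rho i (eta j).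
Variable Y : Pch d n.

Let reg_th (g : Ost F M') : reg (off pi') g -> reg (off th) g.
Proof.
by apply: reg_sub => k l; apply: contraNneq => E; rewrite -!pi_th E.
Qed.

Let reg_pull (g : Ost F M') : reg (off pi') g -> reg (off pi) (Ost_subst th g).
Proof.
apply: reg_subst => k l; first by apply: contraNneq => ->.
by rewrite /off !pi_th.
Qed.

(** The fibre of th over rho i j lies in the i-th block of pi', where th restricts to eta i. *)
Lemma intertwine_bigop i j (f : 'I_M' -> Q M') :
  \sum_(k | th k == @rho i j) f k = \sum_(j' | @eta i j' == j) f (rho' j').
Proof.
transitivity (\sum_(k | pi' k == i) if th k == @rho i j then f k else 0).
  rewrite -big_mkcondr; apply: eq_bigl => k; case: (th k =P _) => [E|_].
    by rewrite -pi_th E (blocks_pi B) eqxx.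
  by rewrite andbF.
rewrite (block_bigop B') [RHS]big_mkcond; apply: eq_bigr => j' _.
by rewrite th_rho (inj_eq (@blocks_inj _ _ _ _ _ B i)).
Qed.

(* By induction on y: th sends the variables of the i-th block of pi' to those
  of
   the i-th block of pi, and eta i is the restriction of th to this block. *)
Lemma qrhs_intertwine y g : reg (off pi') g ->
  qrhs pi' rho' Y (fun i => qpull (@eta i) (y i)) g
    = qpull th (qrhs pi rho Y y (Ost_subst th g)).
Proof.
have map_upd x i (z : Q (m i)) : (fun i' => qpull (@eta i') (dfwith x z i'))
    = dfwith (fun i' => qpull (@eta i') (x i')) (qpull (@eta i) z).
  exact: (dfwith_map (fun i' (z : Q (m i')) => qpull (@eta i') z)).
elim/qfam_ind: y g => [y i c x z Hx Hz g rg|y i j Hy g rg|w g rg].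
- have rg' := reg_pull rg; move: (Hx g rg) (Hz g rg).
  rewrite (map_upd y i x) (map_upd y i z) (map_upd y i (c *: x + z)).
  rewrite qpull_linear (qrhs_multi B' Y _ _ _ _ rg) => -> ->.
  by rewrite (qrhs_multi B Y _ _ _ _ rg') qpull_linear.
- have rg' := reg_pull rg.
  rewrite (map_upd y i (qmulX j (y i))) qpull_mulX (qrhs_slot_sum B') //.
  rewrite (qrhs_mulX B Y _ _ rg') shift_opE.
  rewrite qpullB qpull_mulX intertwine_bigop (Ost_deriv_subst _ (reg_th rg)).
  rewrite (qrhs_sum B); last by move=> k; apply/reg_pull/reg_deriv.
  rewrite qpull_sum intertwine_bigop -sumrB; apply: eq_bigr => k _.
  have := qrhs_mulX B' Y (fun i' => qpull (@eta i') (y i')) k rg => ->.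
  by rewrite shift_opE !Hy //; apply: reg_deriv.
have -> : (fun i => qpull (@eta i) (qpi d (vmono 0%MM (w i))))
    = fun i => qpi d (vmono 0%MM (w i)).
  by apply: eq_dfam => i; rewrite qpullE vpull0.
have E : pi' = pi \o th by apply/funext => k; rewrite /= pi_th.
have rg' := reg_pull rg; rewrite !qrhs_const // /pullmap qpull_comp.
rewrite Ost_subst_comp -E //.
Qed.

End Intertwine.

(** * Decomposition of functions along blocks *)

Section BlockProducts.

Variables (F : fieldType) (n M : nat) (m : 'I_n -> nat) (pi : 'I_M -> 'I_n).
Variable (rho : forall i, 'I_(m i) -> 'I_M).
Hypothesis B : blocks pi rho.
Implicit Types f : forall i, Ost F (m i).

Definition bprod f : Ost F M := \prod_i Ost_subst (@rho i) (f i).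

Let reg_rho i (f : Ost F (m i)) : reg (off (@rho i)) f.
Proof. by apply: reg_inj; apply: (blocks_inj B). Qed.

Lemma bprodM f f' : bprod (fun i => f i * f' i) = bprod f * bprod f'.
Proof.
  by rewrite /bprod -big_split; apply: eq_bigr => i _; rewrite Ost_substM.
Qed.

Lemma bprod1 : bprod (fun i => 1) = 1.
Proof. by rewrite /bprod big1 // => i _; rewrite Ost_subst1. Qed.

Lemma bprod_upd f i (g : Ost F (m i)) :
  bprod (dfwith f g) = Ost_subst (@rho i) g * \prod_(i' | i' != i) Ost_subst
    (@rho i') (f i').
Proof.
rewrite /bprod (bigD1 i) //= dfwith_in; congr (_ * _).
by apply: eq_bigr => j ji; rewrite dfwith_out // eq_sym.
Qed.

Lemma bprod_mul f i (g : Ost F (m i)) :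
  bprod (dfwith f (g * f i)) = Ost_subst (@rho i) g * bprod f.
Proof. by rewrite bprod_upd Ost_substM // -mulrA -bprod_upd dfwith_id. Qed.

Lemma Ost_deriv_prod0 (I : Type) (r : seq I) (p : pred I) k (f : I -> Ost F M) :
  (forall i, p i -> Ost_deriv k (f i) = 0) ->
  Ost_deriv k (\prod_(i <- r | p i) f i) = 0.
Proof.
move=> f0; elim/big_rec: _ => [|i g pi0 IH]; first exact: Ost_deriv1.
by rewrite Ost_derivM f0 // IH mul0r mulr0 addr0.
Qed.

Lemma bprod_deriv f i (j : 'I_(m i)) :
  Ost_deriv (rho j) (bprod f) = bprod (dfwith f (Ost_deriv j (f i))).
Proof.
rewrite -{1}(dfwith_id f i) !bprod_upd Ost_derivM Ost_deriv_prod0 ?mulr0 ?addr0.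
  rewrite Ost_deriv_subst // (eq_bigl (pred1 j)) ?big_pred1_eq // => j'.
  by rewrite (inj_eq (@blocks_inj _ _ _ _ _ B i)).
move=> i' ii'; rewrite Ost_deriv_subst // big1 // => j' /eqP/(congr1 pi).
by rewrite !(blocks_pi B) => E; rewrite E eqxx in ii'.
Qed.

(** Each inverse with both indices in one block comes from a function on that block. The relation e
    is carried along for associativity, where the block functions must in turn have restricted
    poles. *)
Lemma bprod_zV (e : rel 'I_M) (L : seq ('I_M * 'I_M)) :
  (forall k l, e k l -> k != l) ->
  all (fun kl => e kl.1 kl.2 && (pi kl.1 == pi kl.2)) L ->
  exists2 f, zVprod F L = bprod f &
    forall i, reg (fun j j' => e (@rho i j) (@rho i j')) (f i).
Proof.
move=> en; elim: L => [_|[k l] L IHL /= /andP[/andP[ekl /eqP pikl] /IHL [f fE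
  rf]]].
  exists (fun i => 1); first by rewrite /zVprod big_nil bprod1.
  by move=> i; apply: reg1.
have [j kE] := blocks_surj B k; have [j' lE] := blocks_surj B l.
rewrite -pikl in j' lE; exists (dfwith f (Ost_zV F j j' * f (pi k))).
  rewrite bprod_mul /zVprod big_cons -/(zVprod F L) fE Ost_subst_zV kE lE //.
  exact: en.
move=> i; have [<-|ii'] := eqVneq (pi k) i; last by rewrite dfwith_out.
by rewrite dfwith_in; apply: regM => //; apply: reg_zV; rewrite kE lE.
Qed.

(** Linearity of the composition in h needs a common block product for two functions: f collects the
    denominators of both, and each g is multiplied by the denominators of the other. *)
Lemma block_decomp2 (h h' : Ost F M) : exists g g' f,
  [/\ reg (off pi) g, reg (off pi) g', h = g * bprod f & h' = g' * bprod f].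
Proof.
have [L [g [rg eL hE]]] := reg_decomp (off pi) (fun _ _ => id) (reg_neq h).
have [L' [g' [rg' eL' hE']]] := reg_decomp (off pi) (fun _ _ => id) (reg_neq
  h').
have [|f fE _] := @bprod_zV (fun k l => k != l) (L ++ L') (fun _ _ => id).
  rewrite all_cat; apply/andP; split; [move: eL|move: eL'];
  by apply: sub_all => kl; rewrite negbK.
have LK l : all (fun kl => (kl.1 != kl.2) && ~~ off pi kl.1 kl.2) l ->
    zprod F l * zVprod F l = 1.
  by move=> el; apply: zprodK; apply: sub_all el => kl /andP[].
exists (g * zprod F L'), (g' * zprod F L), f; split.
- by apply: regM => //; apply: reg_zprod.
- by apply: regM => //; apply: reg_zprod.
- by rewrite -fE zVprod_cat hE mulrACA [zprod F L' * _]LK ?mulr1.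
by rewrite -fE zVprod_cat hE' [zVprod F L * _]mulrC mulrACA [zprod F L * _]LK
  ?mulr1.
Qed.

Lemma block_decomp (h : Ost F M) : exists g f,
  reg (off pi) g /\ h = g * bprod f.
Proof. by have [g [_ [f [rg _ hE _]]]] := block_decomp2 h h; exists g, f. Qed.

End BlockProducts.

(** * Composition without signs *)

Section WellDefined.

Variables (F : fieldType) (V : superspace F) (d : {linear V -> V}).
Local Notation Q n := (@Defs.qpoly F V n d).
Variables (n M : nat) (m : 'I_n -> nat) (pi : 'I_M -> 'I_n).
Variable (rho : forall i, 'I_(m i) -> 'I_M).
Hypothesis B : blocks pi rho.
Variable Y : Pch d n.
Variable W : forall i, Ost F (m i) -> Q (m i).
Hypothesis W_lin : forall i, linear (@W i).
Hypothesis W_z : forall i j k f, W (Ost_z F j k * f) = qderiv k j (@W i f).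
Local Notation R := (reg (off pi)).
Implicit Types f : forall i, Ost F (m i).

(** W i stands for f_i |-> X_i(v; f_i), of which well-definedness requires only linearity and the
    rule for z_jk. *)
Definition wval f g : Q M := qrhs pi rho Y (fun i => W (f i)) g.

Lemma wval_upd f i (h : Ost F (m i)) g :
  wval (dfwith f h) g = qrhs pi rho Y (dfwith (fun i => W (f i)) (W h)) g.
Proof. by rewrite /wval (dfwith_map (fun i (h : Ost F (m i)) => W h)). Qed.

Let reg_rho i (f : Ost F (m i)) : reg (off (@rho i)) f.
Proof. by apply: reg_inj; apply: (blocks_inj B). Qed.

Lemma reg_rho_norel i (c : Ost F (m i)) (e : rel 'I_M) :
  (forall k l, e k l -> k != l) ->
  reg (@norel _) c -> reg e (Ost_subst (@rho i) c).
Proof. by move=> en; apply: reg_subst. Qed.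

Let off_neq k l : off pi k l -> k != l.
Proof. by apply: contraNneq => ->. Qed.

(** Only polynomial factors may be moved, as g must not acquire poles inside a block. The generator
    z_jk is moved by [qrhs_block_z]. *)
Lemma wval_mul f i (c : Ost F (m i)) g : R g -> reg (@norel _) c ->
  wval (dfwith f (c * f i)) g = wval f (Ost_subst (@rho i) c * g).
Proof.
move=> rg rc; have rsub (h : Ost F (m i)) : reg (@norel _) h -> R (Ost_subst
  (@rho i) h).
  by apply: reg_rho_norel; apply: off_neq.
elim: rc f g rg => [a|j k|j k //|b b' rb IHb rb' IHb'|b b' rb IHb rb' IHb'] f g
  rg.
- have -> : a *: 1 * f i = a *: f i + 0 by rewrite -Ost_scaleE addr0.
  rewrite wval_upd W_lin (lin0 (@W_lin i)) qrhs_multi //.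
  rewrite [X in _ + X](@qrhs_slot0 _ _ _ _ _ _ _ _ B Y _ i g rg) ?dfwith_in //
    -wval_upd dfwith_id.
  rewrite Ost_subst_const -Ost_scaleE -[a *: g]addr0 /wval qrhs_lin //; last
    exact: reg0.
  have -> : qrhs pi rho Y (fun i => W (f i)) (0 : Ost F M) = 0 :> Q M.
    have := qrhs_lin B Y (fun i => W (f i)) (-1) (reg0 F _) (reg0 F _).
    by rewrite scaler0 addr0 scaleN1r addNr.
  by [].
- by rewrite wval_upd W_z qrhs_block_z // Ost_subst_z.
- have rbg := regM (rsub _ rb) rg; have rcg := regM (rsub _ rb') rg.
  have -> : (b + b') * f i = 1 *: (b * f i) + b' * f i by rewrite scale1r
    mulrDl.
  rewrite wval_upd W_lin qrhs_multi // -(wval_upd f (b * f i)) -(wval_upd f (b'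
    * f i)).
  rewrite IHb // IHb' // Ost_substD // mulrDl -[_ * g in RHS]scale1r.
  by rewrite /wval qrhs_lin.
rewrite -mulrA; have := IHb (dfwith f (b' * f i)) g rg.
rewrite dfwith_in dfwith2 => ->; rewrite IHb'; last exact: regM (rsub _ rb) rg.
by rewrite Ost_substM // mulrCA mulrA.
Qed.

Lemma wval_mul_all f c g : R g -> (forall i, reg (@norel _) (c i)) ->
  wval (fun i => c i * f i) g = wval f (bprod rho c * g).
Proof.
move=> rg rc.
have gen (s : seq 'I_n) : uniq s -> forall h, R h ->
    wval (fun i => if i \in s then c i * f i else f i) h
    = wval f ((\prod_(i <- s) Ost_subst (@rho i) (c i)) * h).
  elim: s => [|i s IHs] /=; first by move=> _ h _; rewrite big_nil mul1r.
  case/andP => si us h rh.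
  pose fs i := if i \in s then c i * f i else f i.
  have -> : (fun j => if j \in i :: s then c j * f j else f j) = dfwith fs (c i
    * fs i).
    apply: eq_dfam => j; rewrite in_cons; have [<-|ij] := eqVneq i j.
      by rewrite dfwith_in /fs (negPf si).
    by rewrite dfwith_out.
  rewrite wval_mul // IHs // ?big_cons -?mulrA 1?mulrCA //.
  by apply: regM => //; apply: reg_rho_norel => //; apply: off_neq.
have -> : (fun i => c i * f i)
    = fun i => if i \in index_enum 'I_n then c i * f i else f i.
  by apply: eq_dfam => i; rewrite mem_index_enum.
exact: gen (index_enum_uniq _) g rg.
Qed.

Lemma clear_denominators k (f : Ost F k) : exists L c,
  [/\ reg (@norel k) c, all (fun ij => ij.1 != ij.2) L & f = c * zVprod F L].
Proof.
have [L [c [rc eL fE]]] := reg_decomp (@norel k) (fun _ _ => id) (reg_neq f).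
by exists L, c; split=> //; apply: sub_all eL => ij /andP[].
Qed.

Lemma wval_welldef f f' g g' : R g -> R g' ->
  g * bprod rho f = g' * bprod rho f' -> wval f g = wval f' g'.
Proof.
move=> rg rg' E.
pose L i := projT1 (cid (clear_denominators (f i))).
pose c i := projT1 (cid (projT2 (cid (clear_denominators (f i))))).
have H i : [/\ reg (@norel _) (c i), all (fun ij => ij.1 != ij.2) (L i) &
    f i = c i * zVprod F (L i)] := projT2 (cid (projT2 (cid (clear_denominators
      (f i))))).
pose L' i := projT1 (cid (clear_denominators (f' i))).
pose c' i := projT1 (cid (projT2 (cid (clear_denominators (f' i))))).
have H' i : [/\ reg (@norel _) (c' i), all (fun ij => ij.1 != ij.2) (L' i) &
    f' i = c' i * zVprod F (L' i)] := projT2 (cid (projT2 (cid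
      (clear_denominators (f' i))))).
pose e i := zVprod F (L i ++ L' i); pose D i := zprod F (L i ++ L' i).
have eD i : e i * D i = 1.
  rewrite mulrC zprodK // all_cat; apply/andP.
  by split; [case: (H i)|case: (H' i)].
pose C i := c i * zprod F (L' i); pose C' i := c' i * zprod F (L i).
have rC i : reg (@norel _) (C i).
  by case: (H i) => rc _ _; apply: regM => //; apply: reg_zprod.
have rC' i : reg (@norel _) (C' i).
  by case: (H' i) => rc _ _; apply: regM => //; apply: reg_zprod.
have fE : f = fun i => C i * e i.
  apply: eq_dfam => i; case: (H i) => _ _ ->; case: (H' i) => _ neq _.
  by rewrite /C /e zVprod_cat mulrACA [zprod F _ * _]zprodK ?mulr1.
have fE' : f' = fun i => C' i * e i.
  apply: eq_dfam => i; case: (H' i) => _ _ ->; case: (H i) => _ neq _.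
  rewrite /C' /e zVprod_cat [zVprod F (L i) * _]mulrC mulrACA.
  by rewrite [zprod F _ * _]zprodK ?mulr1.
rewrite fE fE' !wval_mul_all //; congr wval.
(* Both sides of the hypothesis are multiplied by the block product of D, which inverts that of e;
   what remains compares the polynomial factors C and C' moved into g and g'. *)
have CE : bprod rho C = bprod rho f * bprod rho D.
  by rewrite -(bprodM B) fE; congr bprod; apply: eq_dfam => i; rewrite -mulrA eD
    mulr1.
have CE' : bprod rho C' = bprod rho f' * bprod rho D.
  by rewrite -(bprodM B) fE'; congr bprod; apply: eq_dfam => i; rewrite -mulrA
    eD mulr1.
by rewrite CE CE' [LHS]mulrAC [RHS]mulrAC [_ f * g]mulrC [_ f' * g']mulrC E.
Qed.

End WellDefined.

Section RawComposition.

Variables (F : fieldType) (V : superspace F) (d : {linear V -> V}).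
Local Notation Q n := (@Defs.qpoly F V n d).
Variables (n M : nat) (m : 'I_n -> nat) (pi : 'I_M -> 'I_n).
Variable (rho : forall i, 'I_(m i) -> 'I_M).
Hypothesis B : blocks pi rho.
Variables (Y : Pch d n) (X : forall i, Pch d (m i)).
Local Notation R := (reg (off pi)).
Implicit Types (f : forall i, Ost F (m i)) (v : 'I_M -> V).

Definition slotvals v f : forall i, Q (m i) := fun i => X i (v \o @rho i) (f i).

(** A value chosen among those of all decompositions of h: one exists by [block_decomp], and all
    agree by [wval_welldef]. *)
Definition raw_fun v (h : Ost F M) : Q M :=
  xget 0 [set y | exists g f, [/\ R g, h = g * bprod rho f &
    y = qrhs pi rho Y (slotvals v f) g]]%classic.

Lemma raw_funE v g f : R g ->
  raw_fun v (g * bprod rho f) = qrhs pi rho Y (slotvals v f) g.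
Proof.
move=> rg; rewrite /raw_fun; case: xgetP => [y _ [g' [f' [rg' E ->]]]|noy].
  apply: (@wval_welldef _ _ _ _ _ _ _ _ B Y (fun i => X i (v \o @rho i))) => //.
    by move=> i a h h'; apply: Pch_lin.
  by move=> i j k h; apply: Pch_z.
by case: (noy (qrhs pi rho Y (slotvals v f) g)); exists g, f.
Qed.

Lemma slotvals_updv v f i (j : 'I_(m i)) x :
  slotvals (upd v (rho j) x) f
  = dfwith (slotvals v f) (X i (upd (v \o @rho i) j x) (f i)).
Proof.
apply: eq_dfam => i'; rewrite /slotvals; have [<-|ii'] := eqVneq i i'.
  rewrite dfwith_in; congr (X i _ (f i)); apply/funext => j' /=.
  have [<-|jj'] := eqVneq j j'; first by rewrite !dfwith_in.
  by rewrite !dfwith_out // (inj_eq (@blocks_inj _ _ _ _ _ B i)).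
rewrite dfwith_out //; congr (X i' _ (f i')); apply/funext => j' /=.
rewrite dfwith_out //; apply: contraNneq ii' => /(congr1 pi).
by rewrite !(blocks_pi B) => ->.
Qed.

Lemma slotvals_updf v f i (h : Ost F (m i)) :
  slotvals v (dfwith f h) = dfwith (slotvals v f) (X i (v \o @rho i) h).
Proof.
  exact: (dfwith_map (fun i (h : Ost F (m i)) => X i (v \o @rho i) h)).
Qed.

Lemma raw_fun_lin v : linear (raw_fun v).
Proof.
move=> a h h'; have [g [g' [f [rg rg' -> ->]]]] := block_decomp2 B h h'.
rewrite scalerAl -mulrDl !raw_funE //; last exact: reg_lin.
exact: qrhs_lin.
Qed.

Lemma raw_fun_chiral : is_chiral (raw_fun : chiral_map d M).
Proof.
split=> [v a h h'|v k a x y h|v k h|v k l h].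
- exact: raw_fun_lin.
- have [g [f [rg ->]]] := block_decomp B h; have [j <-] := blocks_surj B k.
  rewrite -!dfwith_eta !raw_funE // !slotvals_updv Pch_multi.
  exact: qrhs_multi.
- have [g [f [rg ->]]] := block_decomp B h; have [j <-] := blocks_surj B k.
  rewrite -!dfwith_eta Ost_derivM (bprod_deriv B).
  rewrite (linD (raw_fun_lin v)) !raw_funE //; last exact: reg_deriv.
  rewrite slotvals_updv slotvals_updf.
  (* Sesquilinearity of X_i yields the term with d v and a factor lambda_j in the slot. The latter
     acts as the operator of index rho j, whose derivative of g cancels the one coming from the
     Leibniz rule. *)
  have -> : X _ (v \o @rho (pi k)) (Ost_deriv j (f (pi k)))
      = 1 *: X _ (upd (v \o @rho (pi k)) j (d (v (rho j)))) (f (pi k))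
        + qmulX j (slotvals v f (pi k)).
    by rewrite scale1r Pch_deriv.
  rewrite (qrhs_multi B Y _ _ _ _ rg) scale1r [RHS]addrCA; congr (_ + _).
  by rewrite (qrhs_mulX B Y (slotvals v f) j rg) shift_opE addrC subrK.
have [g [f [rg ->]]] := block_decomp B h.
rewrite mulrA !raw_funE //; last by apply: regM => //; apply: reg_z.
exact: qrhs_z.
Qed.

End RawComposition.

(** * Relabelling and signless composition of chiral maps *)

Section RawOperations.

Variables (F : fieldType) (V : superspace F) (d : {linear V -> V}).
Local Notation Q n := (@Defs.qpoly F V n d).
Local Notation P n := (@Pch F V d n).

Lemma PchZE n a (X Y : P n) v f : (a *: X + Y : P n) v f = a *: X v f + Y v f.
Proof. by []. Qed.

Definition mkP n (X : chiral_map d n) (Xc : is_chiral X) : P n :=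
  MkPch (introT (chiral_predP X) Xc).

Section Relabel.

Variables (M M' : nat) (th : 'I_M' -> 'I_M) (th' : 'I_M -> 'I_M').
Hypotheses (thK : cancel th th') (th'K : cancel th' th).

Lemma relabel_chiral (X : P M) :
  is_chiral (fun v f => pullmap th X (v \o th') f : Q M').
Proof.
have rth (f : Ost F M') : reg (off th) f by exact: reg_inj (can_inj thK).
have updE v k (x : V) : upd v k x \o th' = upd (v \o th') (th k) x.
  apply/funext => j /=; have [<-|kj] := eqVneq (th k) j.
    by rewrite thK !dfwith_in.
  by rewrite !dfwith_out //; apply: contraNneq kj => ->; rewrite th'K.
split=> [v a f g|v i a x y f|v i f|v i j f].
- exact: pullmap_lin.
- by rewrite -!dfwith_eta !updE; apply: pullmap_multi.
- rewrite -dfwith_eta updE.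
  (* The fibre of th over th i is i alone, so the sum over the fibre has a single term. *)
  have := pullmap_deriv X (v \o th') (th i) (rth f); rewrite /= thK.
  rewrite (eq_bigl (pred1 i)) ?big_pred1_eq => [/eqP|j]; last first.
    by rewrite (inj_eq (can_inj thK)).
  by rewrite shift_opE addrA subr_eq0 => /eqP.
exact: pullmap_z.
Qed.

Definition relabel (X : P M) : P M' := mkP (relabel_chiral X).

Lemma relabelE X v f : relabel X v f = qpull th (X (v \o th') (Ost_subst th f)).
Proof. by []. Qed.

Lemma relabel_linear a X Y : relabel (a *: X + Y) = a *: relabel X + relabel Y.
Proof.
by apply: Pch_eqP => v f; rewrite PchZE !relabelE PchZE qpull_linear.
Qed.

End Relabel.

Lemma qrhs_linY n M (m : 'I_n -> nat) (pi : 'I_M -> 'I_n)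
    (rho : forall i, 'I_(m i) -> 'I_M) (B : blocks pi rho) a (X Y : P n) x g :
  reg (off pi) g ->
  qrhs pi rho (a *: X + Y) x g = a *: qrhs pi rho X x g + qrhs pi rho Y x g.
Proof.
elim/qfam_ind: x g => [x i c y z Hy Hz g rg|x i j Hx g rg|w g rg].
- rewrite !(qrhs_multi B) // Hy // Hz // !scalerDr !scalerA [c * a]mulrC.
  by rewrite addrACA.
- rewrite !(qrhs_mulX B) // !shift_opE !Hx //; last exact: reg_deriv.
  by rewrite qmulX_linear scalerBr opprD addrACA.
by rewrite !(qrhs_const B) // /pullmap PchZE qpull_linear.
Qed.

Section RawComp.

Variables (n M : nat) (m : 'I_n -> nat) (pi : 'I_M -> 'I_n).
Variable (rho : forall i, 'I_(m i) -> 'I_M).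
Hypothesis B : blocks pi rho.

Definition raw_comp (Y : P n) (X : forall i, P (m i)) : P M :=
  mkP (raw_fun_chiral B Y X).

Lemma raw_compE Y X v g f : reg (off pi) g ->
  raw_comp Y X v (g * bprod rho f) = qrhs pi rho Y (slotvals rho X v f) g.
Proof. exact: raw_funE. Qed.

Lemma raw_comp_linY a Y Y' X :
  raw_comp (a *: Y + Y') X = a *: raw_comp Y X + raw_comp Y' X.
Proof.
apply: Pch_eqP => v h; have [g [f [rg ->]]] := block_decomp B h.
by rewrite PchZE !raw_compE // qrhs_linY.
Qed.

Lemma raw_comp_multi Y X i a (x y : P (m i)) :
  raw_comp Y (dfwith X (a *: x + y))
  = a *: raw_comp Y (dfwith X x) + raw_comp Y (dfwith X y).
Proof.
apply: Pch_eqP => v h; have [g [f [rg ->]]] := block_decomp B h.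
have updX z : slotvals rho (dfwith X z) v f
    = dfwith (slotvals rho X v f) (z (v \o @rho i) (f i)).
  exact: (dfwith_map (fun i (z : P (m i)) => z (v \o @rho i) (f i))).
rewrite PchZE !raw_compE // !updX PchZE; exact: (qrhs_multi B).
Qed.

End RawComp.

Section Rank.

Variables (n : nat) (m : 'I_n -> nat).

Lemma blocks_rank : blocks (@tagnat.sig1 n m) (@tagnat.Rank n m).
Proof.
split=> [i j|i j j'|k]; first exact: tagnat.Rank1K.
  by move/eqP; rewrite -val_eqE /= tagnat.eq_Rank eqxx => /eqP/val_inj.
by exists (tagnat.sig2 k); apply: tagnat.sig2K.
Qed.

Lemma chiral_comp_rhsE (Y : P n) (u : forall i, vpoly V (m i)) g :
  chiral_comp_rhs Y u g = grhs (@tagnat.sig1 n m) (@tagnat.Rank n m) Y u g.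
Proof.
rewrite /chiral_comp_rhs /grhs /pullmap /qpull.
have -> : (fun i => \sum_(j < m i) 'X_(tagnat.Rank i j)) = fibsum F
  (@tagnat.sig1 n m).
  by apply/funext => i; rewrite /fibsum (block_bigop blocks_rank).
by [].
Qed.

Lemma regular_on_blocksP (g : Ost F (\sum_i m i)) :
  regular_on_blocks g <-> reg (off (@tagnat.sig1 n m)) g.
Proof.
split=> [rg|rg k l _ kl]; first exact: reg_of_no_pole.
exact: no_pole_of_reg rg kl.
Qed.

End Rank.

End RawOperations.

(** * Parity *)

Section SuperspaceProjections.

Variables (F : fieldType) (W : lmodType F) (par : bool -> W -> Prop).
Hypothesis sW : is_superspace par.

Let ex w : exists c : W * W, [/\ par false c.1, par true c.2 & w = c.1 + c.2].
Proof. by have [c [Hc _]] := of_parity_decomp sW w; exists c. Qed.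

Definition sproj b w : W :=
  let c := projT1 (cid (ex w)) in if b then c.2 else c.1.

Lemma sproj_par b w : par b (sproj b w).
Proof. by rewrite /sproj; case: cid => c [] /= ? ? _; case: b. Qed.

Lemma sproj_sum w : w = sproj false w + sproj true w.
Proof. by rewrite /sproj; case: cid => c [] /= ? ? <-. Qed.

Lemma sproj_uniq x y : par false x -> par true y ->
  sproj false (x + y) = x /\ sproj true (x + y) = y.
Proof.
move=> px py; have [c [_ Hc]] := of_parity_decomp sW (x + y).
have E1 : c = (x, y) by apply: Hc.
have E2 : c = (sproj false (x + y), sproj true (x + y)).
  by apply: Hc; split; [exact: sproj_par..|exact: sproj_sum].
by split; [have := congr1 fst E2 | have := congr1 snd E2]; rewrite E1 => /= <-.
Qed.

(** The projections are obtained by choice; linearity follows from uniqueness of the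
    decomposition. *)
Lemma sproj_linear b : linear (sproj b).
Proof.
move=> a x y; have parP := of_parityP sW.
have [|E1 E2] := @sproj_uniq (a *: sproj false x + sproj false y)
  (a *: sproj true x + sproj true y) (parP _ _ _ _ (sproj_par _ _) (sproj_par _
    _)).
  by apply: parP; apply: sproj_par.
move: E1 E2; rewrite addrACA -scalerDr -!sproj_sum => E1 E2.
by case: b.
Qed.

Lemma sproj_hom b c x : par b x -> sproj c x = if b == c then x else 0.
Proof.
move=> px; have p0 := of_parity0 sW.
case: b px => px; [have [] := sproj_uniq (p0 false) px; rewrite add0r
                  |have [] := sproj_uniq px (p0 true); rewrite addr0];
by case: c.
Qed.

(* The parity involution, whose eigenspaces are the homogeneous subspaces. *)
Definition sinv w : W := sproj false w - sproj true w.

Lemma sinv_linear : linear sinv.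
Proof.
by move=> a x y; rewrite /sinv !sproj_linear opprD addrACA -scalerBr.
Qed.

Lemma sinv_hom b x : par b x -> sinv x = (-1) ^+ b *: x.
Proof.
move=> px; rewrite /sinv !(sproj_hom _ px); case: b px => /=.
  by rewrite sub0r scaleN1r.
by rewrite subr0 scale1r.
Qed.

Lemma sinvK : involutive sinv.
Proof.
move=> w; rewrite [RHS]sproj_sum.
have := linB sinv_linear (sproj false w) (sproj true w).
rewrite (sinv_hom (sproj_par false w)) (sinv_hom (sproj_par true w)).
by rewrite expr0 expr1 scale1r scaleN1r opprK.
Qed.

(** Averaging over the involution gives the projection [sproj b]. Applied to coefficients, it lifts
    a homogeneous class to a polynomial with homogeneous coefficients. *)
Lemma par_lin_cancel (two : 2%:R != 0 :> F) b w :
  par b ((2%:R)^-1 *: (w + (-1) ^+ b *: sinv w)).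
Proof.
suff -> : (2%:R)^-1 *: (w + (-1) ^+ b *: sinv w) = sproj b w by apply:
  sproj_par.
have E (x : W) : x + x = 2%:R *: x by rewrite scaler_nat mulr2n.
apply: (scalerI two); rewrite scalerA mulfV // scale1r -E {1}(sproj_sum w)
  /sinv.
case: b => /=; rewrite ?scaleN1r ?scale1r ?opprB.
  by rewrite addrC addrA subrK.
by rewrite addrACA subrr addr0.
Qed.

End SuperspaceProjections.

(** * Multilinear maps on superspaces *)

Definition multilin (F : fieldType) n (T : 'I_n -> lmodType F) (U : lmodType F)
    (A : (forall i, T i) -> U) : Prop :=
  forall (x : forall i, T i) i a (y z : T i),
    A (dfwith x (a *: y + z)) = a *: A (dfwith x y) + A (dfwith x z).

Section Multilinear.

Variables (F : fieldType) (n : nat) (T : 'I_n -> lmodType F) (U : lmodType F).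
Variable par : forall i, bool -> T i -> Prop.
Hypothesis sT : forall i, is_superspace (@par i).
Implicit Types (A : (forall i, T i) -> U) (x : forall i, T i).

Lemma multilin_slot0 A x i : multilin A -> x i = 0 -> A x = 0.
Proof.
move=> Am xi0; have <- : @dfwith _ _ x i 0 = x by rewrite -xi0 dfwith_id.
by have := Am x i (-1) 0 0; rewrite scaler0 addr0 scaleN1r addNr.
Qed.

Lemma multilin_hom_ext A A' : multilin A -> multilin A' ->
  (forall (p : 'I_n -> bool) x, (forall i, par (p i) (x i)) -> A x = A' x) ->
  forall x, A x = A' x.
Proof.
move=> Am A'm AA'.
apply: (slot_ind (S := fun i y => exists b, par b y)) => [x i y Py|x xh].
  rewrite (sproj_sum (@sT i) y) -[sproj _ false y]scale1r Am A'm.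
  by rewrite !Py //; [exists true|exists false]; apply: sproj_par.
apply: (AA' (fun i => projT1 (cid (xh i)))) => i; exact: (projT2 (cid (xh i))).
Qed.

(** The sum extends to all arguments a multilinear formula that depends on parities, such as a
    Koszul sign: on homogeneous arguments every other summand has a zero component. *)
Lemma sum_hom (A : ('I_n -> bool) -> (forall i, T i) -> U) (q : 'I_n -> bool) x
  :
  (forall p, multilin (A p)) -> (forall i, par (q i) (x i)) ->
  \sum_(p : {ffun 'I_n -> bool}) A p (fun i => sproj (@sT i) (p i) (x i)) = A q
    x.
Proof.
move=> Am xq; pose q' : {ffun 'I_n -> bool} := [ffun i => q i].
rewrite (bigD1 q') //= big1 ?addr0 => [|p pq'].
  have -> : q' = q :> ('I_n -> bool) by apply/funext => i; rewrite ffunE.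
  by congr (A q _); apply: eq_dfam => i; rewrite (sproj_hom (@sT i) _ (xq i))
    eqxx.
have [i piq] : exists i, p i != q i.
  apply/existsP; apply: contraNT pq' => /existsPn pq; apply/eqP/ffunP => i.
  by rewrite ffunE; apply/eqP; rewrite -[_ == _]negbK pq.
apply: (multilin_slot0 (i := i) (Am p)).
by rewrite (sproj_hom (@sT i) _ (xq i)) eq_sym (negPf piq).
Qed.

End Multilinear.

Section Parity.

Variables (F : fieldType) (V : superspace F) (d : {linear V -> V}).
Hypothesis two : 2%:R != 0 :> F.
Hypothesis d_even : forall b (v : V), of_parity b v -> of_parity b (d v).
Local Notation Q n := (@Defs.qpoly F V n d).
Local Notation P n := (@Pch F V d n).
Local Notation Qpi := (@qpi F V _ d).
Local Notation sV := (superspaceP V).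
Local Notation s := (sinv sV).

Lemma sproj_d b v : sproj sV b (d v) = d (sproj sV b v).
Proof.
rewrite {1}(sproj_sum sV v) raddfD.
have [] := sproj_uniq sV (d_even (sproj_par sV false v)) (d_even (sproj_par sV
  true v)).
by case: b.
Qed.

Lemma sinv_d v : s (d v) = d (s v).
Proof. by rewrite /sinv !sproj_d raddfB. Qed.

Section QInvolution.

Variable n : nat.

Definition vsinv (u : vpoly V n) : vpoly V n := vlift (fun a v => vmono a (s v))
  u.

Lemma vsinv_linear : linear vsinv.
Proof.
apply: (@vlift_linear _ _ _ _ (fun a => lin_of (_ : linear (fun v => vmono a (s
  v))))).
by move=> a b v w; rewrite sinv_linear linearP.
Qed.

Lemma vsinv_mono a v : vsinv (vmono a v) = vmono a (s v).
Proof.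
apply: (@vlift_mono _ _ _ _ (fun a => lin_of (_ : linear (fun v => vmono a (s
  v))))).
by move=> b c x w; rewrite sinv_linear linearP.
Qed.

Lemma vsinv_coef u a : vsinv u a = s (u a).
Proof.
have [r ->] := vpoly_sum u; rewrite (lin_sum vsinv_linear).
rewrite (eq_bigr (fun b => vmono b (s (u b)))) => [|b _]; last by rewrite
  vsinv_mono.
rewrite !vcoef_sum (lin_sum (sinv_linear sV)); apply: eq_bigr => b _ /=.
by case: eqP; rewrite ?mulr1n ?mulr0n ?(lin0 (sinv_linear sV)).
Qed.

Lemma vsinv_mulX i u : vsinv (vmulX i u) = vmulX i (vsinv u).
Proof.
have [r {1 2}->] := vpoly_sum u.
rewrite (lin_sum (@vmulX_linear F V n i)) !(lin_sum vsinv_linear) (lin_sum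
  (@vmulX_linear F V n i)).
apply: eq_bigr => b _; by rewrite vmulX_mono !vsinv_mono vmulX_mono.
Qed.

Lemma vsinv_total_deriv u : vsinv (total_deriv d u) = total_deriv d (vsinv u).
Proof.
have [r {1 2}->] := vpoly_sum u.
rewrite (lin_sum (@total_deriv_linear F V n d)) !(lin_sum vsinv_linear) (lin_sum
  (@total_deriv_linear F V n d)).
apply: eq_bigr => b _; rewrite vsinv_mono !total_deriv_mono.
rewrite (linD vsinv_linear) vsinv_mono sinv_d (lin_sum vsinv_linear).
by congr (_ + _); apply: eq_bigr => i _; rewrite vsinv_mono.
Qed.

Lemma vsinv_deriv k u : vsinv (vderiv k u) = vderiv k (vsinv u).
Proof.
have [r {1 2}->] := vpoly_sum u.
rewrite (lin_sum (@vderiv_linear F V n k)) !(lin_sum vsinv_linear) (lin_sum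
  (@vderiv_linear F V n k)).
apply: eq_bigr => b _; rewrite vsinv_mono !vderiv_mono (linZ vsinv_linear).
by rewrite vsinv_mono.
Qed.

Definition qsinv : Q n -> Q n := imquot_map (total_deriv d) vsinv.

Lemma qsinvE u : qsinv (Qpi u) = Qpi (vsinv u).
Proof.
  by apply: imquot_mapE; [exact: vsinv_linear|exact: vsinv_total_deriv].
Qed.

Lemma qsinv_linear : linear qsinv.
Proof.
  by apply: imquot_map_linear; [exact: vsinv_linear|exact: vsinv_total_deriv].
Qed.

Lemma qsinvK : involutive qsinv.
Proof.
move=> x; have [u ->] := qpiK x; rewrite !qsinvE; congr (qpi d _).
by apply/vpolyP => a; rewrite !vsinv_coef sinvK.
Qed.

Lemma qsinv_mulX i x : qsinv (qmulX i x) = qmulX i (qsinv x).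
Proof. by have [u ->] := qpiK x; rewrite qmulXE !qsinvE qmulXE vsinv_mulX. Qed.

Lemma qsinv_deriv j i x : qsinv (qderiv j i x) = qderiv j i (qsinv x).
Proof.
have [u ->] := qpiK x; rewrite qderivE !qsinvE qderivE.
by rewrite (linB vsinv_linear) !vsinv_deriv.
Qed.

(** Replaces the existence of a homogeneous representative by an equation. Conversely, averaging any
    representative of an eigenvector over [vsinv] leaves its class unchanged and makes its
    coefficients homogeneous. *)
Lemma q_parityP b x : @q_parity F V d n b x <-> qsinv x = (-1) ^+ b *: x.
Proof.
split=> [[u [<- up]]|].
  rewrite qsinvE -qpiZ; congr (qpi d _); apply/vpolyP => a.
  by rewrite vsinv_coef (sinv_hom sV (up a)).
have [u ->] := qpiK x; rewrite qsinvE => E.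
exists ((2%:R)^-1 *: (u + (-1) ^+ b *: vsinv u)); split; last first.
  move=> a; have := par_lin_cancel sV two b (u a); rewrite -vsinv_coef.
  by [].
rewrite qpiZ qpiD qpiZ E scalerA -signr_addb addbb scale1r.
by rewrite -mulr2n -scaler_nat scalerA mulVf // scale1r.
Qed.

Lemma q_parity_lin b a x y : @q_parity F V d n b x -> q_parity b y ->
  q_parity b (a *: x + y).
Proof.
move=> /q_parityP xb /q_parityP yb; apply/q_parityP.
by rewrite qsinv_linear xb yb scalerDr !scalerA mulrC.
Qed.

End QInvolution.

End Parity.

Lemma multilin_scale (F : fieldType) n (T : 'I_n -> lmodType F) (U : lmodType F)
    (A : (forall i, T i) -> U) (c : 'I_n -> F) (x : forall i, T i) :
  multilin A -> A (fun i => c i *: x i) = (\prod_i c i) *: A x.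
Proof.
move=> Am; have scale_slot (y : forall i, T i) i a (z : T i) :
    A (dfwith y (a *: z)) = a *: A (dfwith y z).
  rewrite -[a *: z]addr0 Am [X in _ + X](multilin_slot0 (i := i) Am) ?addr0 //.
  by rewrite dfwith_in.
have gen (r : seq 'I_n) : uniq r ->
    A (fun i => if i \in r then c i *: x i else x i) = (\prod_(i <- r) c i) *: A
      x.
  elim: r => [|i r IHr] /=; first by rewrite big_nil scale1r.
  case/andP => ir ur; rewrite big_cons -scalerA -IHr //.
  pose y i := if i \in r then c i *: x i else x i.
  have -> : (fun j => if j \in i :: r then c j *: x j else x j) = dfwith y (c i
    *: y i).
    apply: eq_dfam => j; rewrite in_cons; have [<-|ij] := eqVneq i j.
      by rewrite dfwith_in /y (negPf ir).
    by rewrite dfwith_out.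
  by rewrite scale_slot dfwith_id.
have -> : (fun i => c i *: x i)
    = fun i => if i \in index_enum 'I_n then c i *: x i else x i.
  by apply: eq_dfam => i; rewrite mem_index_enum.
exact: gen (index_enum_uniq _).
Qed.

(** * Parity of chiral maps and insertion of signs *)

Section PchParity.

Variables (F : fieldType) (V : superspace F) (d : {linear V -> V}).
Hypothesis two : 2%:R != 0 :> F.
Hypothesis d_even : forall b (v : V), of_parity b v -> of_parity b (d v).
Local Notation Q n := (@Defs.qpoly F V n d).
Local Notation P n := (@Pch F V d n).
Local Notation Qpi := (@qpi F V _ d).
Local Notation sV := (superspaceP V).
Local Notation s := (sinv sV).

Lemma vsinv_pull a b (pi : 'I_b -> 'I_a) (u : vpoly V a) :
  vsinv (vpull pi u) = vpull pi (vsinv u).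
Proof.
elim/vpoly_ind: u => [c x y Hx Hy|i x Hx|v].
- by rewrite !(linearP, vsinv_linear) Hx Hy.
- rewrite [X in _ = vpull pi X]vsinv_mulX (vpull_mulX pi i x) (vpull_mulX pi i
  (vsinv x)) (lin_sum (@vsinv_linear F V b)).
  by apply: eq_bigr => k _; rewrite vsinv_mulX Hx.
by rewrite vsinv_mono !vpull0 vsinv_mono.
Qed.

Lemma qsinv_pull a b (pi : 'I_b -> 'I_a) (x : Q a) :
  qsinv (qpull pi x) = qpull pi (qsinv x).
Proof.
have [u ->] := qpiK x.
by rewrite qpullE !(qsinvE d_even) qpullE vsinv_pull.
Qed.

Lemma q_parity_mulX n b i (x : Q n) : q_parity b x -> q_parity b (qmulX i x).
Proof.
move=> /(q_parityP two d_even) xb; apply/(q_parityP two d_even).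
by rewrite (qsinv_mulX d_even) xb qmulXZ.
Qed.

Lemma q_parity_pull a b (pi : 'I_b -> 'I_a) c (x : Q a) :
  q_parity c x -> q_parity c (qpull pi x).
Proof.
move=> /(q_parityP two d_even) xb; apply/(q_parityP two d_even).
by rewrite qsinv_pull xb qpullZ.
Qed.

Lemma q_parity0 n b : q_parity b (0 : Q n).
Proof.
by apply/(q_parityP two d_even); rewrite (lin0 (@qsinv_linear F V d d_even n))
  scaler0.
Qed.

Lemma q_parityZ n b a (x : Q n) : q_parity b x -> q_parity b (a *: x).
Proof.
by move=> xb; have := q_parity_lin two d_even a xb (q_parity0 n b); rewrite
  addr0.
Qed.

Lemma Pch_multilin n (X : P n) f :
  @multilin F n (fun=> V) _ (fun v => X v f).
Proof. by move=> v i a y z; apply: Pch_multi. Qed.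

Lemma Pch_hom_ext n (X Y : P n) :
  (forall p v f, (forall i, of_parity (p i) (v i)) -> X v f = Y v f) -> X = Y.
Proof.
move=> XY; apply: Pch_eqP => v f.
apply: (multilin_hom_ext (fun _ => sV) (Pch_multilin X f) (Pch_multilin Y f)) =>
  p x xp.
exact: XY xp.
Qed.

Lemma Psinv_chiral n (X : P n) : is_chiral (fun v f => qsinv (X (s \o v) f) : Q
  n).
Proof.
have sL := @qsinv_linear F V d d_even n.
have updE v i x : s \o upd v i x = upd (s \o v) i (s x).
  by apply/funext => j /=; have [<-|ij] := eqVneq i j; rewrite ?dfwith_in //
    !dfwith_out.
split=> [v a f g|v i a x y f|v i f|v i j f].
- by rewrite Pch_lin sL.
- by rewrite -!dfwith_eta !updE sinv_linear Pch_multi sL.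
- rewrite -dfwith_eta updE (sinv_d d_even) -(qsinv_mulX d_even) -(linD sL).
  by congr qsinv; apply: (Pch_deriv X (s \o v)).
by rewrite Pch_z (qsinv_deriv d_even).
Qed.

(** Conjugation by the parity involutions. Its eigenspaces are the homogeneous chiral maps, so the
    parts of X are (X + [Psinv X]) / 2 and (X - [Psinv X]) / 2. *)
Definition Psinv n (X : P n) : P n := mkP (Psinv_chiral X).

Lemma PsinvE n (X : P n) v f : Psinv X v f = qsinv (X (s \o v) f).
Proof. by []. Qed.

Lemma PsinvK n : involutive (@Psinv n).
Proof.
move=> X; apply: Pch_eqP => v f; rewrite !PsinvE (qsinvK d_even).
by congr (X _ f); apply/funext => i /=; rewrite sinvK.
Qed.

Lemma Psinv_linear n : linear (@Psinv n).
Proof.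
by move=> a X Y; apply: Pch_eqP => v f; rewrite PchZE !PsinvE PchZE
  (qsinv_linear d_even).
Qed.

Lemma prod_sign n (p : 'I_n -> bool) :
  \prod_i (-1) ^+ p i = (-1) ^+ parity_sum p :> F.
Proof. by rewrite /parity_sum signr_odd -expr_sum. Qed.

Lemma Psinv_hom n (X : P n) p v f : (forall i, of_parity (p i) (v i)) ->
  Psinv X v f = (-1) ^+ parity_sum p *: qsinv (X v f).
Proof.
move=> vp; rewrite PsinvE.
have -> : s \o v = fun i => (-1) ^+ p i *: v i.
  by apply/funext => i /=; rewrite (sinv_hom sV (vp i)).
rewrite (multilin_scale (T := fun=> V) _ _ (Pch_multilin X f)) prod_sign.
by rewrite (linZ (@qsinv_linear F V d d_even n)).
Qed.

Lemma Pch_parityP n b (X : P n) : Pch_parity n b X <-> Psinv X = (-1) ^+ b *: X.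
Proof.
split=> [Xb|XE p v f vp].
  apply: Pch_hom_ext => p v f vp; rewrite (Psinv_hom X f vp).
  rewrite ((q_parityP two d_even _ _).1 (Xb p v f vp)) scalerA.
  by rewrite signr_addb mulrCA -signr_addb addbb mulr1.
apply/(q_parityP two d_even); have := Psinv_hom X f vp; rewrite XE => E.
have {E} -> : qsinv (X v f) = (-1) ^+ parity_sum p *: ((-1) ^+ b *: X v f).
  rewrite -[(-1) ^+ b *: X v f]/(((-1) ^+ b *: X : P n) v f) E scalerA.
  by rewrite -signr_addb addbb scale1r.
by rewrite scalerA -signr_addb addbC.
Qed.

Lemma Pch_superspace n : is_superspace (@Pch_parity F V d n).
Proof.
have sL := @Psinv_linear n.
split=> [b|b a X Y /Pch_parityP Xb /Pch_parityP Yb|X].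
- by apply/Pch_parityP; rewrite (lin0 sL) scaler0.
- by apply/Pch_parityP; rewrite sL Xb Yb scalerDr !scalerA mulrC.
have half (Z : P n) : (2%:R)^-1 *: (Z + Z) = Z.
  by rewrite -mulr2n -scaler_nat scalerA mulVf // scale1r.
exists ((2%:R)^-1 *: (X + Psinv X), (2%:R)^-1 *: (X - Psinv X)); split.
  split=> /=.
  - apply/Pch_parityP; rewrite (linZ sL) (linD sL) PsinvK scale1r.
    by rewrite [_ + X]addrC.
  - apply/Pch_parityP; rewrite (linZ sL) (linB sL) PsinvK scaleN1r.
    by rewrite -scalerN opprB.
  by rewrite -scalerDr addrACA subrr addr0 half.
move=> [X0 X1] /= [/Pch_parityP E0 /Pch_parityP E1 ->].
rewrite (linD sL) E0 E1 scale1r scaleN1r; congr (_, _).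
  by rewrite addrACA subrr addr0 half.
by rewrite opprD opprK addrACA subrr add0r half.
Qed.

Lemma Pch_sumE n (I : Type) (r : seq I) (X : I -> P n) v f :
  (\sum_(i <- r) X i : P n) v f = \sum_(i <- r) X i v f.
Proof. exact: (lin_sum (f := fun X : P n => X v f)). Qed.

Section Twist.

Variable n : nat.

Lemma restr_chiral (X : P n) (p : 'I_n -> bool) :
  is_chiral (fun v f => X (fun i => sproj sV (p i) (v i)) f : Q n).
Proof.
have updE v i x : (fun j => sproj sV (p j) (upd v i x j))
    = upd (fun j => sproj sV (p j) (v j)) i (sproj sV (p i) x).
  by apply/funext => j; have [<-|ij] := eqVneq i j; rewrite ?dfwith_in //
    !dfwith_out.
split=> [v a f g|v i a x y f|v i f|v i j f].
- exact: Pch_lin.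
- by rewrite -!dfwith_eta !updE sproj_linear Pch_multi.
- rewrite -dfwith_eta updE (sproj_d d_even).
  exact: (Pch_deriv X (fun j => sproj sV (p j) (v j))).
exact: Pch_z.
Qed.

(** Multiplies X by e p at arguments of parities p, and is extended to all arguments by [sum_hom].
    It is chiral because d commutes with the parity projections. *)
Definition twist (e : ('I_n -> bool) -> F) (X : P n) : P n :=
  \sum_(p : {ffun 'I_n -> bool}) e p *: mkP (restr_chiral X p).

Lemma twist_hom e X p v f : (forall i, of_parity (p i) (v i)) ->
  twist e X v f = e p *: X v f.
Proof.
move=> vp; rewrite /twist Pch_sumE.
have Am (q : 'I_n -> bool) : @multilin F n (fun=> V) _ (fun v => e q *: X v f).
  by move=> x i a y z; rewrite Pch_multi scalerDr !scalerA mulrC.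
exact: (sum_hom (fun _ => sV) Am vp).
Qed.

Lemma twist_linear e : linear (twist e).
Proof.
move=> a X Y; apply: Pch_hom_ext => p v f vp.
by rewrite PchZE !(twist_hom _ _ _ vp) PchZE scalerDr !scalerA mulrC.
Qed.

End Twist.

Section HomValues.

Variables (n M : nat) (m : 'I_n -> nat) (pi : 'I_M -> 'I_n).
Variable (rho : forall i, 'I_(m i) -> 'I_M).
Hypothesis B : blocks pi rho.
Implicit Types (Y : P n) (x : forall i, Q (m i)) (g : Ost F M).

Lemma qrhs_multilin Y g : reg (off pi) g ->
  multilin (fun x => qrhs pi rho Y x g).
Proof. by move=> rg x i a y z; apply: qrhs_multi. Qed.

Lemma hom_reps x (p : 'I_n -> bool) : (forall i, q_parity (p i) (x i)) ->
  exists u : forall i, vpoly V (m i), (forall i, Qpi (u i) = x i) /\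
    forall i a, of_parity (p i) (u i a).
Proof.
move=> xp; exists (fun i => projT1 (cid (xp i))).
by split=> i; have [] := projT2 (cid (xp i)).
Qed.

(** The right-hand side evaluates Y only at coefficients of representatives, which may be chosen
    homogeneous of parities p; a sign of Y determined by p thus leaves the whole sum. *)
Lemma qrhs_hom_ext Y Y' x p c g : reg (off pi) g ->
  (forall i, q_parity (p i) (x i)) ->
  (forall w f, (forall i, of_parity (p i) (w i)) -> Y w f = c *: Y' w f) ->
  qrhs pi rho Y x g = c *: qrhs pi rho Y' x g.
Proof.
move=> rg xp YY'; have [u [ux up]] := hom_reps xp.
have -> : c *: qrhs pi rho Y' x g = qrhs pi rho (c *: Y') x g.
  have := qrhs_linY B c Y' 0 x rg; rewrite addr0 => ->.
  have := qrhs_linY B (-1) (0 : P n) 0 x rg.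
  by rewrite scaler0 addr0 scaleN1r addNr => ->; rewrite addr0.
rewrite -!(qrhsE B _ rg ux) /grhs; apply: eq_fsbigr => a _.
congr (shift_monomial a _ g); apply/funext => h; rewrite /pullmap.
by congr (qpull pi _); apply: YY' => i; apply: up.
Qed.

Lemma qrhs_parity Y b x p g : reg (off pi) g -> Pch_parity n b Y ->
  (forall i, q_parity (p i) (x i)) ->
  q_parity (b (+) parity_sum p) (qrhs pi rho Y x g).
Proof.
move=> rg Yb xp; have [u [ux up]] := hom_reps xp.
rewrite -(qrhsE B _ rg ux); have [N E] := grhs_trunc B Y u.
rewrite (E N) //; apply: (big_ind (q_parity (b (+) parity_sum p))) => [|y z py
  pz|a _].
- exact: q_parity0.
- by have := q_parity_lin two d_even 1 py pz; rewrite scale1r.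
apply: (@shift_monomial_ind _ _ _ _ (fun Psi => forall h, q_parity (b (+)
  parity_sum p) (Psi h)))
  => [k Psi Pp h|h].
  rewrite shift_opE -scaleN1r addrC; apply: (q_parity_lin two d_even) => //.
  exact: q_parity_mulX.
by apply: q_parity_pull; apply: Yb => i; apply: up.
Qed.

End HomValues.

End PchParity.

(** * Action, unit and composition *)

Section ParitySums.

Lemma parity_sumE n (p : 'I_n -> bool) : parity_sum p = \big[addb/false]_i p i.
Proof.
rewrite /parity_sum (big_morph odd oddD (erefl : odd 0 = false)).
by apply: eq_bigr => i _; rewrite oddb.
Qed.

Lemma parity_sum_addb n (p q : 'I_n -> bool) :
  parity_sum (fun i => p i (+) q i) = parity_sum p (+) parity_sum q.
Proof. by rewrite !parity_sumE big_split. Qed.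

Lemma parity_sum_rank n (m : 'I_n -> nat) (p : 'I_(\sum_i m i) -> bool) :
  parity_sum (fun i => parity_sum (fun j => p (tagnat.Rank i j))) = parity_sum
    p.
Proof.
rewrite parity_sumE [RHS]parity_sumE (partition_big (@tagnat.sig1 n m) xpredT)
  //=.
apply: eq_bigr => i _; rewrite parity_sumE.
by rewrite (block_bigop (blocks_rank m) addb i).
Qed.

Lemma parity_sum_perm n (p : 'I_n -> bool) (sigma : 'S_n) :
  parity_sum (fun i => p (sigma i)) = parity_sum p.
Proof. by rewrite !parity_sumE [RHS](reindex_inj (@perm_inj _ sigma)). Qed.

End ParitySums.

Section Structure.

Variables (F : fieldType) (V : superspace F) (d : {linear V -> V}).
Hypothesis two : 2%:R != 0 :> F.
Hypothesis d_even : forall b (v : V), of_parity b v -> of_parity b (d v).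
Local Notation Q n := (@Defs.qpoly F V n d).
Local Notation P n := (@Pch F V d n).
Local Notation Qpi := (@qpi F V _ d).
Local Notation sP := (Pch_superspace two d_even).

Definition actS n (X : P n) (sigma : 'S_n) : P n :=
  twist d_even (fun p => (-1) ^+ perm_sign p sigma)
    (relabel (permK sigma) (permKV sigma) X).

Lemma actS_hom n (X : P n) (sigma : 'S_n) p v f : (forall i, of_parity (p i) (v
  i)) ->
  actS X sigma v f = (-1) ^+ perm_sign p sigma *:
    qpull sigma (X (v \o (sigma^-1)%g) (Ost_subst sigma f)).
Proof. by move=> vp; rewrite /actS (twist_hom _ _ _ _ vp). Qed.

Lemma actS_spec : chiral_act_spec actS.
Proof.
move=> n X sigma p v f vp; rewrite (actS_hom _ _ _ vp); congr (_ *: _).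
rewrite /qpull; congr (qsubst _ _); apply/funext => i; rewrite /fibsum.
rewrite (eq_bigl (pred1 ((sigma^-1)%g i))) ?big_pred1_eq // => k /=.
by rewrite (can2_eq (permK sigma) (permKV sigma)).
Qed.

Lemma Ost1_const (f : Ost F 1) : exists c : F, f = c *: 1.
Proof.
elim: (reg_neq f) => [c|i j|i j|g h _ [a ->] _ [b ->]|g h _ [a ->] _ [b ->]].
- by exists c.
- by exists 0; rewrite !ord1 Ost_zxx scale0r.
- by rewrite !ord1 eqxx.
- by exists (a + b); rewrite scalerDl.
by exists (a * b); rewrite -Ost_scaleE scalerA.
Qed.

Definition Ost1_coef (f : Ost F 1) : F := projT1 (cid (Ost1_const f)).

Lemma Ost1_coefK (f : Ost F 1) : f = Ost1_coef f *: 1.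
Proof. exact: projT2 (cid (Ost1_const f)). Qed.

Lemma Ost1_coefZ c : Ost1_coef (c *: 1) = c.
Proof.
have /eqP := Ost1_coefK (c *: 1); rewrite -subr_eq0 -scalerBl.
rewrite scaler_eq0 oner_eq0 orbF subr_eq0 => /eqP.
by [].
Qed.

Lemma Ost1_coef_linear a f g :
  Ost1_coef (a *: f + g) = a * Ost1_coef f + Ost1_coef g.
Proof.
rewrite {1}(Ost1_coefK f) {1}(Ost1_coefK g) scalerA -scalerDl.
exact: Ost1_coefZ.
Qed.

Lemma unit_chiral :
  is_chiral (fun v f => Ost1_coef f *: Qpi (vmono 0%MM (v ord0)) : Q 1).
Proof.
have c0 : Ost1_coef 0 = 0 by rewrite -(scale0r 1) Ost1_coefZ.
split=> [v a f g|v i a x y f|v i f|v i j f].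
- by rewrite Ost1_coef_linear scalerDl scalerA.
- rewrite !ord1 /= linearP qpiP scalerDr !scalerA mulrC.
  by [].
- rewrite [f]Ost1_coefK Ost_deriv_const Ost1_coefZ c0 scale0r qmulXZ -scalerDr.
  rewrite qmulXE vmulX_mono -qpiD !ord1 /=.
  (* For n = 1 the element d v + lambda v is the image of v under [total_deriv], hence zero in the
     quotient. *)
  have := total_deriv_mono d (0%MM : 'X_{1..1}) (v ord0); rewrite big_ord1 =>
    <-.
  by rewrite qpi_deriv scaler0.
by rewrite !ord1 Ost_zxx mul0r c0 scale0r qderivxx.
Qed.

Definition unitS : P 1 := mkP unit_chiral.

Lemma unitSE v f : unitS v f = Ost1_coef f *: Qpi (vmono 0%MM (v ord0)).
Proof. by []. Qed.

Lemma unitS_spec : chiral_unit_spec unitS.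
Proof. by move=> v; rewrite unitSE -(scale1r 1) Ost1_coefZ scale1r. Qed.

Section Comp.

Variables (n : nat) (m : 'I_n -> nat).
Implicit Types (Y : P n) (X : forall i, P (m i)).

Definition comp_sign (q : 'I_n -> bool) (p : 'I_(\sum_i m i) -> bool) : F :=
  (-1) ^+ eval_sign q (fun i => parity_sum (fun j => p (tagnat.Rank i j))).

(** The sign depends on the parities of the X_i and of the vectors: the sum over q decomposes the
    former, [twist] the latter. *)
Definition compS Y X : P (\sum_i m i)%N :=
  \sum_(q : {ffun 'I_n -> bool}) twist d_even (comp_sign q)
    (raw_comp (blocks_rank m) Y (fun i => sproj (sP (m i)) (q i) (X i))).

Lemma comp_multilin (q : 'I_n -> bool) Y :
  multilin (fun X => twist d_even (comp_sign q) (raw_comp (blocks_rank m) Y X)).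
Proof. by move=> X i a x y; rewrite raw_comp_multi twist_linear. Qed.

Lemma compS_homX Y X q : (forall i, Pch_parity _ (q i) (X i)) ->
  compS Y X = twist d_even (comp_sign q) (raw_comp (blocks_rank m) Y X).
Proof.
  by move=> Xq; apply: (sum_hom (fun i => sP (m i)) (comp_multilin^~ Y) Xq).
Qed.

Lemma compS_hom Y X q p v h : (forall i, Pch_parity _ (q i) (X i)) ->
  (forall k, of_parity (p k) (v k)) ->
  compS Y X v h = comp_sign q p *: raw_comp (blocks_rank m) Y X v h.
Proof. by move=> Xq vp; rewrite (compS_homX _ Xq) (twist_hom _ _ _ _ vp). Qed.

End Comp.

Lemma compS_multilinear : multilinear_comp (OperadData actS unitS compS).
Proof.
split=> n m.
  move=> X a Y Y' /=; rewrite /compS scaler_sumr -big_split; apply: eq_bigr => q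
    _.
  by rewrite raw_comp_linY twist_linear.
move=> Y X i a x y /=; rewrite /compS scaler_sumr -big_split; apply: eq_bigr =>
  q _.
have E z : (fun j => sproj (sP (m j)) (q j) (dfwith X z j))
    = dfwith (fun j => sproj (sP (m j)) (q j) (X j)) (sproj (sP (m i)) (q i) z).
  exact: (dfwith_map (fun j (z : P (m j)) => sproj (sP (m j)) (q j) z)).
by rewrite (E x) (E y) (E (a *: x + y)) sproj_linear comp_multilin.
Qed.

Lemma compS_spec : chiral_comp_spec compS.
Proof.
move=> n m Y X q p v g f u Xq vp rg uE; rewrite (compS_hom _ _ Xq vp).
congr (_ *: _); rewrite chiral_comp_rhsE.
have {}rg := (regular_on_blocksP g).1 rg.
rewrite (qrhsE (blocks_rank m) Y rg uE).
exact: (raw_compE (blocks_rank m) Y X v f rg).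
Qed.

Lemma structure_chiral : is_chiral_structure (OperadData actS unitS compS).
Proof.
split; [exact: actS_spec|exact: unitS_spec|exact: compS_multilinear|exact:
  compS_spec].
Qed.

(** The specifications fix the values at homogeneous arguments. Every h has a decomposition of the
    required form, every element of O_1 is a scalar, and multilinearity extends equality to all
    arguments. *)
Lemma structure_unique (S S' : operad_data (@Pch F V d)) :
  is_chiral_structure S -> is_chiral_structure S' -> S = S'.
Proof.
case: S S' => [act one comp] [act' one' comp'].
case=> /= A1 U1 [_ M1] C1 [/= A2 U2 [_ M2] C2].
have -> : act = act'.
  apply: eq_dfam => n; apply/funext => X; apply/funext => sigma.
  by apply: Pch_hom_ext => p v f vp; rewrite (A1 _ _ _ _ _ _ vp) (A2 _ _ _ _ _ _
    vp).
have -> : one = one'.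
  apply: Pch_eqP => v f; rewrite (Ost1_coefK f) -[_ *: 1]addr0 !Pch_lin U1 U2.
  by rewrite !(lin0 (Pch_lin _ v)).
congr OperadData.
apply: eq_dfam => n; apply: eq_dfam => m; apply/funext => Y.
apply: eq_dfam => X.
apply: (multilin_hom_ext (fun i => sP (m i)) (A := comp n m Y) (A' := comp' n m
  Y)).
- by move=> x i a y z; apply: M1.
- by move=> x i a y z; apply: M2.
move=> q {}X Xq; apply: Pch_hom_ext => p v h vp.
have [g [f [rg ->]]] := block_decomp (blocks_rank m) h.
have {}rg := (regular_on_blocksP g).2 rg.
pose u i := repr (X i (fun j => v (tagnat.Rank i j)) (f i)).
have uE i : Qpi (u i) = X i (fun j => v (tagnat.Rank i j)) (f i) by exact:
  imquot_piK.
by rewrite [LHS](C1 _ _ _ _ _ _ _ _ _ _ Xq vp rg uE) [RHS](C2 _ _ _ _ _ _ _ _ _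
  _ Xq vp rg uE).
Qed.

Lemma actS_linear n (sigma : 'S_n) a (X Y : P n) :
  actS (a *: X + Y) sigma = a *: actS X sigma + actS Y sigma.
Proof. by rewrite /actS relabel_linear twist_linear. Qed.

Lemma actS_even n (sigma : 'S_n) b (X : P n) :
  Pch_parity _ b X -> Pch_parity _ b (actS X sigma).
Proof.
move=> Xb p v f vp; rewrite (actS_hom _ _ _ vp); apply: (q_parityZ two d_even).
apply: (q_parity_pull two d_even).
rewrite -(parity_sum_perm p (sigma^-1)%g); apply: Xb => i; exact: vp.
Qed.

Lemma slotvals_parity n M (m : 'I_n -> nat) (rho : forall i, 'I_(m i) -> 'I_M)
    (X : forall i, P (m i)) q p v f :
  (forall i, Pch_parity _ (q i) (X i)) -> (forall k, of_parity (p k) (v k)) ->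
  forall i, q_parity (q i (+) parity_sum (fun j => p (rho i j))) (slotvals rho X
    v f i).
Proof. by move=> Xq vp i; apply: Xq => j; apply: vp. Qed.

Lemma compS_even n (m : 'I_n -> nat) b (p : 'I_n -> bool) (Y : P n) (X : forall
  i, P (m i)) :
  Pch_parity _ b Y -> (forall i, Pch_parity _ (p i) (X i)) ->
  Pch_parity _ (b (+) parity_sum p) (compS Y X).
Proof.
move=> Yb Xp r v h vr; rewrite (compS_hom _ _ Xp vr).
have [g [f [rg ->]]] := block_decomp (blocks_rank m) h.
apply: (q_parityZ two d_even); rewrite raw_compE //.
have := qrhs_parity two d_even (blocks_rank m) rg Yb (slotvals_parity
  (@tagnat.Rank n m) f Xp vr).
by rewrite parity_sum_addb parity_sum_rank addbA.
Qed.

Lemma unitS_even : Pch_parity _ false unitS.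
Proof.
move=> p v f vp; rewrite unitSE; apply: (q_parityZ two d_even).
exists (vmono 0%MM (v ord0)); split=> // a /=.
have -> : parity_sum p = p ord0 by rewrite parity_sumE big_ord1.
case: eqP => _; rewrite ?mulr1n ?mulr0n; first exact: vp.
exact: of_parity0 (superspaceP V) _.
Qed.

(** Transport along an equality of arities is relabelling by [cast_ord], so casts are treated like
    permutations. *)
Lemma arity_castE n n' (e : n = n') (X : P n) v f :
  (arity_cast e X : P n') v f
  = qpull (cast_ord (esym e)) (X (v \o cast_ord e) (Ost_subst (cast_ord (esym
    e)) f)).
Proof.
case: _ / e v f => v f /=; have E : cast_ord (esym (erefl n)) = id.
  by apply/funext => i; apply: val_inj.
rewrite E Ost_subst_id qpull_id //; congr (X _ f).
Qed.

End Structure.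

(** * Associativity and equivariance without signs *)

Section OuterPermutation.

Variables (F : fieldType) (V : superspace F) (d : {linear V -> V}).
Hypothesis two : 2%:R != 0 :> F.
Hypothesis d_even : forall b (v : V), of_parity b v -> of_parity b (d v).
Local Notation Q n := (@Defs.qpoly F V n d).
Local Notation P n := (@Pch F V d n).
Variables (n M : nat) (m : 'I_n -> nat) (pi : 'I_M -> 'I_n).
Variable (rho : forall i, 'I_(m i) -> 'I_M).
Hypothesis B : blocks pi rho.
Variable sigma : 'S_n.

Definition perm_rho i : 'I_(m ((sigma^-1)%g i)) -> 'I_M := @rho ((sigma^-1)%g
  i).

Lemma blocks_perm : blocks (sigma \o pi) perm_rho.
Proof.
split=> [i j|i|k].
- by rewrite /perm_rho /= (blocks_pi B) permKV.
- exact: (blocks_inj B).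
have [j jk] := blocks_surj B k; rewrite /perm_rho /=.
have E : pi k = (sigma^-1)%g (sigma (pi k)) by rewrite permK.
by case: _ / E; exists j.
Qed.

Lemma off_perm : off (sigma \o pi) = off pi.
Proof.
apply/funext => i; apply/funext => j.
by rewrite /off /= (inj_eq (@perm_inj _ sigma)).
Qed.

Lemma qrhs_relabel X (x : forall i, Q (m i)) g : reg (off pi) g ->
  qrhs pi rho (relabel (permK sigma) (permKV sigma) X : P n) x g
  = qrhs (sigma \o pi) perm_rho X (fun i => x ((sigma^-1)%g i)) g.
Proof.
move=> rg; rewrite !qrhs_unlock /grhs; apply: eq_fsbigr => a _.
have E h : reg (off pi) h ->
    pullmap pi (relabel (permK sigma) (permKV sigma) X : P n) (bcoef rho (fun i
      => repr (x i)) a) h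
    = pullmap (sigma \o pi) X (bcoef perm_rho (fun i => repr (x ((sigma^-1)%g
      i))) a) h.
  by move=> rh; rewrite /pullmap relabelE qpull_comp Ost_subst_comp ?off_perm.
exact: (shift_monomial_eq a E rg).
Qed.

(** Acting on the outer map amounts to renumbering the blocks; the sign is that of the parities of
    the slot values. *)
Lemma qrhs_actS X (x : forall i, Q (m i)) p g : reg (off pi) g ->
  (forall i, q_parity (p i) (x i)) ->
  qrhs pi rho (actS d_even X sigma : P n) x g
  = (-1) ^+ perm_sign p sigma *:
    qrhs (sigma \o pi) perm_rho X (fun i => x ((sigma^-1)%g i)) g.
Proof.
move=> rg xp; rewrite -qrhs_relabel //; apply: (qrhs_hom_ext B rg xp) => w f wp.
by rewrite (actS_hom d_even X sigma f wp).
Qed.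

End OuterPermutation.

(** * Associativity of the right-hand sides *)

Section Associativity.

Variables (F : fieldType) (V : superspace F) (d : {linear V -> V}).
Local Notation Q n := (@Defs.qpoly F V n d).
Local Notation P n := (@Pch F V d n).
Variables (n M N : nat) (m m' : 'I_n -> nat) (l : 'I_M -> nat).
Variables (pi1 : 'I_N -> 'I_M) (rho1 : forall k, 'I_(l k) -> 'I_N).
Variables (pi2 : 'I_M -> 'I_n) (rho2 : forall i, 'I_(m i) -> 'I_M).
Variables (pi' : 'I_N -> 'I_n) (rho' : forall i, 'I_(m' i) -> 'I_N).
Variables (eta : forall i, 'I_(m' i) -> 'I_(m i)).
Variables (rhoi : forall i (j : 'I_(m i)), 'I_(l (@rho2 i j)) -> 'I_(m' i)).
Hypotheses (B1 : blocks pi1 rho1) (B2 : blocks pi2 rho2) (B' : blocks pi' rho').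
Hypothesis Bi : forall i, blocks (@eta i) (@rhoi i).
Hypothesis pi12 : forall k, pi2 (pi1 k) = pi' k.
Hypothesis pi1_rho' : forall i x, pi1 (@rho' i x) = @rho2 i (eta x).
Hypothesis rho'_rhoi : forall i j y, @rho' i (@rhoi i j y) = @rho1 (@rho2 i j)
  y.
Variables (f : P n) (g : forall i, P (m i)).

Let reg1' (G : Ost F N) : reg (off pi') G -> reg (off pi1) G.
Proof. by apply: reg_sub => k k'; apply: contraNneq => E; rewrite -!pi12 E. Qed.

Lemma reg_refine (Gi : forall i, Ost F (m' i)) :
  (forall i, reg (off (@eta i)) (Gi i)) -> reg (off pi1) (bprod rho' Gi).
Proof.
move=> rGi; apply: reg_prod => i _; apply: (reg_subst _ _ (rGi i)) => [k k'|x
  y].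
  by apply: contraNneq => ->.
by rewrite /off !pi1_rho' (inj_eq (@blocks_inj _ _ _ _ _ B2 i)).
Qed.

(** The values of the inner compositions, which fill the slots of f when the g_i are composed
    first. *)
Let nest (x : forall k, Q (l k)) (Gi : forall i, Ost F (m' i)) : forall i, Q (m'
  i) :=
  fun i => qrhs (@eta i) (@rhoi i) (g i) (fun j => x (@rho2 i j)) (Gi i).

Let nest_upd x Gi i (j : 'I_(m i)) (y : Q (l (@rho2 i j))) :
  nest (dfwith x y) Gi = dfwith (nest x Gi)
    (qrhs (@eta i) (@rhoi i) (g i) (dfwith (fun j => x (@rho2 i j)) y) (Gi i)).
Proof.
apply: eq_dfam => i'; rewrite /nest; have [<-|ii'] := eqVneq i i'.
  rewrite dfwith_in; have -> // : (fun j' => dfwith x y (@rho2 i j'))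
      = dfwith (fun j => x (@rho2 i j)) y.
  apply: eq_dfam => j'; have [<-|jj'] := eqVneq j j'; first by rewrite
    !dfwith_in.
  by rewrite !dfwith_out // (inj_eq (@blocks_inj _ _ _ _ _ B2 i)).
rewrite dfwith_out //; have -> // : (fun j' => dfwith x y (@rho2 i' j'))
    = fun j' => x (@rho2 i' j').
apply: eq_dfam => j'; rewrite dfwith_out //; apply: contraNneq ii' => /(congr1
  pi2).
by rewrite !(blocks_pi B2) => ->.
Qed.

(** Induction on the innermost values x. A factor lambda_k differentiates the product of G and the
    G_i on the right; on the left, the inner operator gives the derivative of G_i and the outer one
    that of G. On constants the inner compositions are pullbacks along eta, so [qrhs_intertwine]
    applies. *)
Lemma qrhs_assoc (x : forall k, Q (l k)) G (Gi : forall i, Ost F (m' i)) :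
  reg (off pi') G -> (forall i, reg (off (@eta i)) (Gi i)) ->
  qrhs pi' rho' f (nest x Gi) G
  = qrhs pi1 rho1 (raw_comp B2 f g) x (G * bprod rho' Gi).
Proof.
elim/qfam_ind: x G Gi => [x k c y z Hy Hz G Gi rG rGi|x k y Hx G Gi rG rGi|w G
  Gi rG rGi].
- have rGG := regM (reg1' rG) (reg_refine rGi).
  have [j kE] := blocks_surj B2 k; case: _ / kE in y z Hy Hz *.
  rewrite (qrhs_multi B1 _ _ _ _ _ rGG) -Hy // -Hz // !nest_upd.
  by rewrite (qrhs_multi (Bi _)) // (qrhs_multi B').
- have rGG := regM (reg1' rG) (reg_refine rGi).
  have [j kE] := blocks_surj B2 k; case: _ / kE in y *; set i := pi2 k in j y *.
  rewrite (qrhs_mulX B1 _ _ _ rGG) shift_opE nest_upd.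
  have := qrhs_mulX (Bi i) (g i) (fun j => x (rho2 j)) y (rGi i).
  move=> /= ->; rewrite shift_opE.
  set t := rhoi y.
  pose Gt := dfwith Gi (Ost_deriv t (Gi i)).
  have rGt i' : reg (off (@eta i')) (Gt i').
    rewrite /Gt; have [<-|ii'] := eqVneq i i'; last by rewrite dfwith_out.
    by rewrite dfwith_in; apply: reg_deriv.
  have tE : rho1 y = rho' t by rewrite rho'_rhoi.
  rewrite tE Ost_derivM (bprod_deriv B') -/Gt.
  rewrite -[Ost_deriv _ G * _]scale1r (qrhs_lin B1); first last.
  + exact: regM (reg1' rG) (reg_refine rGt).
  + exact: regM (reg1' (reg_deriv _ rG)) (reg_refine rGi).
  rewrite scale1r -!Hx //; last exact: reg_deriv.
  have -> : nest x Gt = dfwith (nest x Gi)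
      (qrhs (@eta i) (@rhoi i) (g i) (fun j => x (rho2 j)) (Ost_deriv t (Gi
        i))).
    exact: (dfwith_map (fun i h => qrhs (@eta i) (@rhoi i) (g i) (fun j => x
      (rho2 j)) h)).
  rewrite -scaleN1r addrC (qrhs_multi B') // scaleN1r.
  have := qrhs_mulX B' f (nest x Gi) t rG => /= ->.
  by rewrite shift_opE addrC opprD addrA.
have rGG := regM (reg1' rG) (reg_refine rGi).
rewrite (qrhs_const B1) //.
pose y i := g i (w \o @rho2 i) (Ost_subst (@eta i) (Gi i)).
have -> : nest (fun k => qpi d (vmono 0%MM (w k))) Gi = fun i => qpull (@eta i)
  (y i).
  by apply: eq_dfam => i; rewrite /nest (qrhs_const (Bi i)).
rewrite (qrhs_intertwine B2 B' pi12 pi1_rho' f y rG) /pullmap; congr (qpull pi1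
  _).
rewrite Ost_substM; [|exact: reg1'|exact: reg_refine].
have -> : Ost_subst pi1 (bprod rho' Gi)
    = bprod rho2 (fun i => Ost_subst (@eta i) (Gi i)).
  rewrite Ost_subst_prod => [|i _].
    apply: eq_bigr => i _.
    have E : pi1 \o @rho' i = @rho2 i \o @eta i by apply/funext => j; apply:
      pi1_rho'.
    have rE : reg (off (pi1 \o @rho' i)) (Gi i).
      apply: reg_sub (rGi i) => j j'; rewrite E /off /=.
      by rewrite (inj_eq (@blocks_inj _ _ _ _ _ B2 i)).
    by rewrite Ost_subst_comp // E Ost_subst_comp // -E.
  apply: (reg_subst _ _ (rGi i)) => [k k'|a b]; first by apply: contraNneq =>
    ->.
  by rewrite /off !pi1_rho' (inj_eq (@blocks_inj _ _ _ _ _ B2 i)).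
rewrite raw_compE //; apply: (reg_subst _ _ rG) => k k'; first by apply:
  contraNneq => ->.
by rewrite /off !pi12.
Qed.

End Associativity.

(** * Koszul signs *)

Section PairSums.

(** The common form of all Koszul exponents modulo 2. After reindexing, an identity between them
    becomes a boolean check for each pair. *)
Definition pairsum n (phi : 'I_n -> 'I_n -> bool) : bool :=
  \big[addb/false]_(i < n) \big[addb/false]_(j < n | (i < j)%N) phi i j.

Lemma eq_pairsum n (phi psi : 'I_n -> 'I_n -> bool) :
  (forall i j : 'I_n, (i < j)%N -> phi i j = psi i j) -> pairsum phi = pairsum
    psi.
Proof. by move=> E; apply: eq_bigr => i _; apply: eq_bigr => j; apply: E. Qed.

Lemma pairsumE n (phi : 'I_n -> 'I_n -> bool) :
  pairsum phi = \big[addb/false]_(i < n) \big[addb/false]_(j < n) ((i < j)%N &&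
    phi i j).
Proof.
apply: eq_bigr => i _; rewrite big_mkcond; apply: eq_bigr => j _.
by case: ifP.
Qed.

Lemma pairsumD n (phi psi : 'I_n -> 'I_n -> bool) :
  pairsum (fun i j => phi i j (+) psi i j) = pairsum phi (+) pairsum psi.
Proof.
  by rewrite /pairsum -big_split; apply: eq_bigr => i _; rewrite big_split.
Qed.

Lemma perm_neq n (sigma : 'S_n) (i j : 'I_n) :
  (i < j)%N -> (sigma j < sigma i)%N = ~~ (sigma i < sigma j)%N.
Proof.
move=> ij; case: (ltngtP (sigma i) (sigma j)) => // E.
by rewrite (perm_inj (ord_inj E)) ltnn in ij.
Qed.

(** Each unordered pair is met once on either side, and sigma decides in which order phi reads
    it. *)
Lemma pairsum_perm n (phi : 'I_n -> 'I_n -> bool) (sigma : 'S_n) :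
  pairsum (fun a b => phi ((sigma^-1)%g a) ((sigma^-1)%g b))
  = pairsum (fun i j => if (sigma i < sigma j)%N then phi i j else phi j i).
Proof.
transitivity (\big[addb/false]_(i < n) \big[addb/false]_(j < n)
    ((sigma i < sigma j)%N && phi i j)).
  rewrite /pairsum (reindex_inj (@perm_inj _ sigma)); apply: eq_bigr => i _.
  rewrite (reindex_inj (@perm_inj _ sigma)) big_mkcond; apply: eq_bigr => j _.
  by rewrite !permK; case: ifP.
transitivity (pairsum (fun i j => (sigma i < sigma j)%N && phi i j)
    (+) pairsum (fun i j => (sigma j < sigma i)%N && phi j i)).
  rewrite !pairsumE [X in _ (+) X]exchange_big -big_split; apply: eq_bigr => i
    _.
  rewrite -big_split; apply: eq_bigr => j _ /=.
  by case: (ltngtP i j) => [||/ord_inj ->]; rewrite ?addbF // ltnn.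
rewrite -pairsumD; apply: eq_pairsum => i j /(perm_neq sigma) ->.
by case: (sigma i < sigma j)%N; rewrite ?addbF.
Qed.

Lemma odd_sum (I : Type) (r : seq I) (p : pred I) (E : I -> nat) :
  odd (\sum_(i <- r | p i) E i) = \big[addb/false]_(i <- r | p i) odd (E i).
Proof. exact: (big_morph odd oddD (erefl : odd 0 = false)). Qed.

Lemma odd_eval_sign n (p q : 'I_n -> bool) :
  odd (eval_sign p q) = pairsum (fun i j => p j && q i).
Proof.
rewrite /eval_sign odd_sum; apply: eq_bigr => i _; rewrite odd_sum.
by apply: eq_bigr => j _; rewrite oddM !oddb.
Qed.

Lemma odd_perm_sign n (p : 'I_n -> bool) (sigma : 'S_n) :
  odd (perm_sign p sigma) = pairsum (fun i j => (sigma j < sigma i)%N && (p i &&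
    p j)).
Proof.
rewrite /perm_sign odd_sum; apply: eq_bigr => i _; rewrite odd_sum big_mkcondr.
by apply: eq_bigr => j _; rewrite oddM !oddb; case: ifP.
Qed.

(** A pair is inverted by the product exactly when one of the two steps, but not both, inverts
    it. *)
Lemma odd_perm_signM n (p : 'I_n -> bool) (sigma tau : 'S_n) :
  odd (perm_sign p (tau * sigma)%g)
  = odd (perm_sign p tau) (+) odd (perm_sign (fun i => p ((tau^-1)%g i)) sigma).
Proof.
rewrite !odd_perm_sign.
have := pairsum_perm (fun i j => (sigma (tau j) < sigma (tau i))%N && (p i && p
  j)) tau.
under eq_pairsum do rewrite !permKV.
move=> ->; rewrite -pairsumD; apply: eq_pairsum => i j ij.
rewrite !permM (perm_neq tau ij).
have := perm_neq (tau * sigma)%g ij; rewrite !permM => ->.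
by case: (tau i < tau j)%N; case: (sigma (tau i) < sigma (tau j))%N;
  case: (p i); case: (p j).
Qed.

Lemma ltn_Rank n (m : 'I_n -> nat) (i i' : 'I_n) (j : 'I_(m i)) (j' : 'I_(m i'))
  :
  (i < i')%N -> (tagnat.Rank i j < tagnat.Rank i' j')%N.
Proof.
move=> ii'; rewrite !tagnat.RankEsum; apply: (@leq_trans (\sum_(k < n | (k <
  i')%N) m k)%N); last exact: leq_addr.
rewrite [X in (_ < X)%N](bigD1 i) //= addnC -addSn; apply: leq_add => //.
rewrite [X in (_ <= X)%N](bigID (fun k : 'I_n => (k < i)%N)) /=.
apply: leq_trans (leq_addr _ _); rewrite leq_eqVlt; apply/orP; left; apply/eqP.
apply: eq_bigl => k; case: (ltngtP k i) => ki; rewrite ?andbF //.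
by rewrite (ltn_trans ki ii') -val_eqE /= (ltn_eqF ki).
Qed.

Lemma ltn_Rank2 n (m : 'I_n -> nat) (i : 'I_n) (j j' : 'I_(m i)) :
  (tagnat.Rank i j < tagnat.Rank i j')%N = (j < j')%N.
Proof. by rewrite !tagnat.RankEsum ltn_add2l. Qed.

Lemma rank_bigop n (m : 'I_n -> nat) (f : 'I_(\sum_i m i) -> bool) :
  \big[addb/false]_k f k
  = \big[addb/false]_i \big[addb/false]_(j < m i) f (tagnat.Rank i j).
Proof.
rewrite (partition_big (@tagnat.sig1 n m) xpredT) //=.
by apply: eq_bigr => i _; rewrite (block_bigop (blocks_rank m) addb i).
Qed.

(** [Rank] orders the indices lexicographically, so a pair lies either in one block or in two blocks
    in increasing order. *)
Lemma pairsum_rank n (m : 'I_n -> nat) (phi : 'I_(\sum_i m i) -> 'I_(\sum_i m i)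
  -> bool) :
  pairsum phi
  = \big[addb/false]_i pairsum (fun j j' : 'I_(m i) => phi (tagnat.Rank i j)
    (tagnat.Rank i j'))
    (+) pairsum (fun i i' => \big[addb/false]_(j < m i) \big[addb/false]_(j' < m
      i')
          phi (tagnat.Rank i j) (tagnat.Rank i' j')).
Proof.
rewrite {1}/pairsum rank_bigop {2}/pairsum -big_split; apply: eq_bigr => i _.
rewrite [X in _ = addb _ X]exchange_big {1}/pairsum -big_split; apply: eq_bigr
  => j _.
rewrite big_mkcond rank_bigop (bigD1 i) //; congr addb.
  by rewrite [RHS]big_mkcond; apply: eq_bigr => j' _; rewrite ltn_Rank2.
rewrite [LHS]big_mkcond [RHS]big_mkcond; apply: eq_bigr => i' _.
case: (ltngtP i i') => [ii'|ii'|/ord_inj E].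
- have -> : i' != i by rewrite -val_eqE /= (gtn_eqF ii').
  by apply: eq_bigr => j' _; rewrite ltn_Rank.
- have -> : i' != i by rewrite -val_eqE /= (ltn_eqF ii').
  by apply: big1 => j' _; rewrite ltnNge ltnW // ltn_Rank.
by have -> : (i' != i) = false by rewrite E eqxx.
Qed.

Lemma big_andb n k (b : bool) (p : 'I_n -> bool) (q : 'I_k -> bool) :
  \big[addb/false]_i \big[addb/false]_j (b && (p i && q j))
  = b && (parity_sum p && parity_sum q).
Proof.
rewrite !parity_sumE; case: b => /=; last by rewrite big1 // => i _; rewrite
  big1.
by rewrite big_distrlr.
Qed.

Lemma odd_eval_sign_rank n (m : 'I_n -> nat) (p q : 'I_(\sum_i m i) -> bool) :
  odd (eval_sign p q)
  = \big[addb/false]_i odd (eval_sign (fun j : 'I_(m i) => p (tagnat.Rank i j))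
                                      (fun j => q (tagnat.Rank i j)))
    (+) odd (eval_sign (fun i => parity_sum (fun j : 'I_(m i) => p (tagnat.Rank
      i j)))
                       (fun i => parity_sum (fun j : 'I_(m i) => q (tagnat.Rank
                         i j)))).
Proof.
rewrite !odd_eval_sign pairsum_rank; congr (_ (+) _).
  by apply: eq_bigr => i _; rewrite odd_eval_sign.
apply: eq_pairsum => i i' _; rewrite andbC -[RHS]andTb -big_andb.
by apply: eq_bigr => j _; apply: eq_bigr => j' _; rewrite andbC.
Qed.

Lemma block_perm_Rank n (m : 'I_n -> nat) (sigma : 'S_n) (tau : forall i, 'S_(m
  i))
    i (j : 'I_(m i)) :
  block_perm sigma tau (tagnat.Rank i j)
  = @tagnat.Rank n (fun k => m ((sigma^-1)%g k)) (sigma i)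
      (cast_ord (congr1 m (esym (permK sigma i))) (tau i j)) :> nat.
Proof. by rewrite permE /block_perm_fun /tagnat.Rank tagnat.rankK. Qed.

Lemma odd_perm_sign_block n (m : 'I_n -> nat) (sigma : 'S_n) (tau : forall i,
  'S_(m i))
    (r : 'I_(\sum_i m i) -> bool) :
  odd (perm_sign r (block_perm sigma tau))
  = \big[addb/false]_i odd (perm_sign (fun j : 'I_(m i) => r (tagnat.Rank i j))
    (tau i))
    (+) odd (perm_sign (fun i => parity_sum (fun j : 'I_(m i) => r (tagnat.Rank
      i j))) sigma).
Proof.
rewrite !odd_perm_sign pairsum_rank; congr (_ (+) _).
  apply: eq_bigr => i _; rewrite odd_perm_sign; apply: eq_pairsum => j j' _.
  by rewrite !block_permE ltn_add2l.
apply: eq_pairsum => i i' ii'; rewrite -big_andb; apply: eq_bigr => j _.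
apply: eq_bigr => j' _; congr (_ && _).
rewrite !block_perm_Rank; have := perm_neq sigma ii'.
case: (ltngtP (sigma i) (sigma i')) => [lt _|lt _|E]; last first.
- by have := perm_inj (ord_inj E) => ii; rewrite ii ltnn in ii'.
- exact: ltn_Rank.
by apply/negbTE; rewrite -leqNgt ltnW // ltn_Rank.
Qed.

End PairSums.

(** * The superoperad identities *)

Lemma sign_eq (R : pzRingType) a b : odd a = odd b -> (-1) ^+ a = (-1) ^+ b :>
  R.
Proof. by move=> E; rewrite -signr_odd E signr_odd. Qed.

(** Compares two reorderings: evaluate f_i at x_i and permute the values, or permute both families
    and then evaluate. *)
Lemma odd_sign_perm n (p q : 'I_n -> bool) (sigma : 'S_n) :
  odd (eval_sign p q) (+) odd (perm_sign (fun i => p i (+) q i) sigma)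
  = odd (perm_sign p sigma) (+) odd (perm_sign q sigma)
    (+) odd (eval_sign (fun i => p ((sigma^-1)%g i)) (fun i => q ((sigma^-1)%g
      i))).
Proof.
rewrite !odd_perm_sign !odd_eval_sign (pairsum_perm (fun i j => p j && q i)).
rewrite -!pairsumD; apply: eq_pairsum => i j ij; rewrite (perm_neq sigma ij).
by case: (sigma i < sigma j)%N; case: (p i); case: (p j); case: (q i); case: (q
  j).
Qed.

Lemma odd_eval_signDl n (p p' q : 'I_n -> bool) :
  odd (eval_sign (fun i => p i (+) p' i) q)
  = odd (eval_sign p q) (+) odd (eval_sign p' q).
Proof.
rewrite !odd_eval_sign -pairsumD; apply: eq_pairsum => i j _.
by case: (p j); case: (p' j); case: (q i).
Qed.

Lemma odd_eval_signDr n (p q q' : 'I_n -> bool) :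
  odd (eval_sign p (fun i => q i (+) q' i))
  = odd (eval_sign p q) (+) odd (eval_sign p q').
Proof.
rewrite !odd_eval_sign -pairsumD; apply: eq_pairsum => i j _.
by case: (p j); case: (q i); case: (q' i).
Qed.

Lemma eval_sign0 n (q : 'I_n -> bool) : eval_sign (fun=> false) q = 0%N.
Proof. by rewrite /eval_sign big1 // => i _; rewrite big1. Qed.

Lemma bprod_ord1 (F : fieldType) M (m : 'I_1 -> nat) (rho : forall i, 'I_(m i)
  -> 'I_M)
    (f : forall i, Ost F (m i)) : bprod rho f = Ost_subst (@rho ord0) (f ord0).
Proof. by rewrite /bprod big_ord1. Qed.

Section SymmetryAndUnit.

Variables (F : fieldType) (V : superspace F) (d : {linear V -> V}).
Hypothesis two : 2%:R != 0 :> F.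
Hypothesis d_even : forall b (v : V), of_parity b v -> of_parity b (d v).
Local Notation Q n := (@Defs.qpoly F V n d).
Local Notation P n := (@Pch F V d n).
Local Notation Qpi := (@qpi F V _ d).
Local Notation act := (actS d_even).
Local Notation comp := (compS two d_even).
Local Notation one := (unitS d).

Lemma actS1 n (X : P n) : act X 1%g = X.
Proof.
apply: Pch_hom_ext => p v f vp; rewrite (actS_hom d_even X 1%g f vp).
have E : (1%g : 'S_n) = id :> ('I_n -> 'I_n) by apply/funext => i; rewrite
  perm1.
have -> : perm_sign p 1%g = 0%N.
  rewrite /perm_sign big1 // => i _; rewrite big1 // => j.
  by rewrite !perm1 => /andP[ij]; rewrite ltnNge ltnW.
by rewrite invg1 E Ost_subst_id qpull_id // scale1r.
Qed.

Lemma actSM n (sigma tau : 'S_n) (X : P n) :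
  act (act X sigma) tau = act X (tau * sigma)%g.
Proof.
apply: Pch_hom_ext => p v f vp; rewrite !(actS_hom d_even _ _ _ vp).
have vp' i : of_parity (p ((tau^-1)%g i)) ((v \o (tau^-1)%g) i) by apply: vp.
rewrite (actS_hom d_even X sigma _ vp') qpullZ scalerA -exprD qpull_comp.
rewrite Ost_subst_comp; last exact: reg_inj (inj_comp perm_inj perm_inj).
have E : sigma \o tau = (tau * sigma)%g by apply/funext => i; rewrite /= permM.
have E' : (v \o (tau^-1)%g) \o (sigma^-1)%g = v \o ((tau * sigma)^-1)%g.
  by apply/funext => i; rewrite /= invMg permM.
rewrite E E'; congr (_ *: _); apply: sign_eq.
by rewrite oddD odd_perm_signM.
Qed.

Lemma compS1 n (X : P n) :
  arity_cast (@sum_unit_arity n) (comp X (fun=> one)) = X.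
Proof.
apply: Pch_hom_ext => p v h vp; rewrite arity_castE.
set e := sum_unit_arity; set c := cast_ord e; set c' := cast_ord (esym e).
have vp' k : of_parity (p (c k)) ((v \o c) k) by apply: vp.
have cRank (i : 'I_n) j : c (@tagnat.Rank n (fun=> 1%N) i j) = i.
  apply: ord_inj; apply: etrans (@tagnat.RankEsum n (fun=> 1%N) i j) _.
  by rewrite ord1 addn0 -(big_ord_widen n (fun=> 1%N) (ltnW (ltn_ord i)))
    sum1_card card_ord.
rewrite (compS_hom two d_even X _ (fun=> unitS_even two d_even) vp').
rewrite /comp_sign eval_sign0 expr0 scale1r.
have B := blocks_rank (fun=> 1%N : nat) (n := n).
have sigc k : tagnat.sig1 (c' k) = k.
  have [j jE] := blocks_surj B (c' k).
  have := congr1 c jE; rewrite cRank => ->.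
  by apply: ord_inj.
have sig_inj : injective (@tagnat.sig1 n (fun=> 1%N)).
  move=> k k' kk'; apply: (@cast_ord_inj _ _ e); rewrite -/c.
  have [j <-] := blocks_surj B k; have [j' <-] := blocks_surj B k'.
  by rewrite !cRank.
(* All blocks are singletons, so the whole function serves as g, with every f_i equal to 1. *)
set h' := Ost_subst c' h; rewrite -[h']mulr1 -(bprod1 F (@tagnat.Rank n (fun=>
  1%N))).
rewrite raw_compE; last exact: reg_inj sig_inj.
have -> : slotvals (@tagnat.Rank n (fun=> 1%N)) (fun=> one) (v \o c) (fun=> 1)
    = fun i => Qpi (vmono 0%MM (v i)).
  apply: eq_dfam => i; rewrite /slotvals unitSE -{1}(scale1r 1) Ost1_coefZ
    scale1r.
  by rewrite /= cRank.
rewrite (qrhs_const B); last exact: reg_inj sig_inj.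
rewrite /pullmap qpull_comp /h' Ost_subst_comp; last first.
  by apply: reg_inj; apply: inj_comp sig_inj _; apply: cast_ord_inj.
have E : tagnat.sig1 \o c' = id :> ('I_n -> 'I_n) by apply/funext.
by rewrite E Ost_subst_id qpull_id.
Qed.

(** The only block contains all indices, so th inverts its enumeration. Since g = 1 has zero
    derivative, the shift operators reduce to multiplication by the lambda_k. *)
Lemma qrhs_unit M (m : 'I_1 -> nat) (pi : 'I_M -> 'I_1) (rho : forall i, 'I_(m
  i) -> 'I_M)
    (B : blocks pi rho) (th : 'I_M -> 'I_(m ord0)) (x : forall i, Q (m i)) :
  (forall k, rho ord0 (th k) = k) ->
  qrhs pi rho one x 1 = qpull th (x ord0).
Proof.
move=> thK; have r1 := reg1 F (off pi).
have q0 y : qrhs pi rho one y (0 : Ost F M) = 0.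
  have := qrhs_lin B one y (-1) (reg0 F _) (reg0 F _).
  by rewrite scaler0 addr0 scaleN1r addNr.
elim/qfam_ind: x => [x i a y z|x i j Hx|w].
- case: _ / (esym (ord1 i)) in y z * => Hy Hz.
  by rewrite (qrhs_multi B) // Hy Hz !dfwith_in qpull_linear.
- case: _ / (esym (ord1 i)) in j *; rewrite (qrhs_mulX B) // shift_opE
  Ost_deriv1 q0 subr0.
  rewrite Hx dfwith_in qpull_mulX (eq_bigl (pred1 (rho ord0 j))) ?big_pred1_eq
    // => k.
  apply/eqP/eqP => [<-|->]; rewrite ?thK //.
  by apply: (@blocks_inj _ _ _ _ _ B ord0); rewrite thK.
rewrite (qrhs_const B) // /pullmap Ost_subst1 unitSE -(scale1r 1) Ost1_coefZ
  scale1r.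
by rewrite !qpullE !vpull0.
Qed.

Lemma arity_cast_linear n n' (e : n = n') a (X Y : P n) :
  arity_cast e (a *: X + Y) = a *: arity_cast e X + arity_cast e Y :> P n'.
Proof. by case: _ / e. Qed.

Lemma compS_multi n (m : 'I_n -> nat) (Y : P n) (X : forall i, P (m i)) i a (x y
  : P (m i)) :
  comp Y (dfwith X (a *: x + y)) = a *: comp Y (dfwith X x) + comp Y (dfwith X
    y).
Proof. exact: (proj2 (compS_multilinear two d_even)). Qed.

Lemma compS_1 n (X : P n) : arity_cast (@sum_arity1 n) (comp one (fun=> X)) = X.
Proof.
(* [compS_hom] needs homogeneous arguments; the constant family is therefore seen as an arbitrary
   family with one slot and split by multilinearity. *)
pose A (X : forall i : 'I_1, P n) := arity_cast (@sum_arity1 n) (comp one X) : P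
  n.
have Am : @multilin F 1 (fun=> P n) _ A.
  move=> {}X i a x y; rewrite /A.
  by rewrite (@compS_multi 1 (fun=> n) one X i a x y) arity_cast_linear.
have A'm : @multilin F 1 (fun=> P n) _ (fun X => X ord0).
  by move=> {}X i a x y; case: _ / (esym (ord1 i)); rewrite !dfwith_in.
apply: (multilin_hom_ext (fun=> Pch_superspace two d_even n) Am A'm _ (fun=>
  X)).
move=> q {}X Xq; rewrite /A; apply: Pch_hom_ext => p v h vp; rewrite
  arity_castE.
set e := sum_arity1 n; set c := cast_ord e; set c' := cast_ord (esym e).
have vp' k : of_parity (p (c k)) ((v \o c) k) by apply: vp.
have RankE j : @tagnat.Rank 1 (fun=> n) ord0 j = c' j.
  apply: ord_inj; apply: etrans (@tagnat.RankEsum 1 (fun=> n) ord0 j) _.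
  have -> // : (\sum_(k < 1 | (k < (ord0 : 'I_1))%N) n)%N = 0%N by exact:
    big_pred0.
rewrite (compS_hom two d_even one _ Xq vp') /comp_sign.
have -> : eval_sign q (fun i => parity_sum (fun j => p (c (tagnat.Rank i j)))) =
  0%N.
  by rewrite /eval_sign big_ord1 big_pred0 // => i; rewrite !ord1.
rewrite expr0 scale1r; have B := blocks_rank (fun _ : 'I_1 => n).
(* There is one block, so the whole function serves as f_1, with g = 1. *)
have -> : Ost_subst c' h = 1 * bprod (@tagnat.Rank 1 (fun=> n)) (fun=> h).
  rewrite mul1r bprod_ord1; congr (Ost_subst _ h); apply/funext => j.
  by rewrite RankE.
rewrite raw_compE; last exact: reg1.
rewrite (qrhs_unit B (th := c)); last by move=> k; rewrite RankE; apply: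
  ord_inj.
rewrite qpull_comp qpull_id; last by move=> k; apply: ord_inj.
rewrite /slotvals; congr (X ord0 _ h); apply/funext => j /=; rewrite RankE.
by congr v; apply: ord_inj.
Qed.

End SymmetryAndUnit.

Lemma blocks_relabel n M N (m : 'I_n -> nat) (pi : 'I_M -> 'I_n)
    (rho : forall i, 'I_(m i) -> 'I_M) (th : 'I_N -> 'I_M) (th' : 'I_M -> 'I_N)
      :
  cancel th th' -> cancel th' th -> blocks pi rho ->
  blocks (pi \o th) (fun i => th' \o @rho i).
Proof.
move=> thK th'K B; split=> [i j|i|k] /=.
- by rewrite th'K (blocks_pi B).
- exact: inj_comp (can_inj th'K) (@blocks_inj _ _ _ _ _ B i).
by have [j E] := blocks_surj B (th k); exists j; rewrite E thK.
Qed.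

Lemma rank_sumn n (m : 'I_n -> nat) (f : 'I_(\sum_i m i) -> nat) :
  (\sum_k f k = \sum_i \sum_(j < m i) f (tagnat.Rank i j))%N.
Proof.
rewrite (partition_big (@tagnat.sig1 n m) xpredT) //=; apply: eq_bigr => i _.
exact: (block_bigop (blocks_rank m) addn i).
Qed.

(** Both sides count predecessors: in the same inner block, in earlier inner blocks of the same
    outer block, and in earlier outer blocks. *)
Lemma Rank_Rank n (m : 'I_n -> nat) (l : 'I_(\sum_i m i) -> nat) i j
    (y : 'I_(l (@tagnat.Rank n m i j))) :
  cast_ord (sum_arityA l)
    (@tagnat.Rank n (fun i => (\sum_j l (tagnat.Rank i j))%N) i
      (@tagnat.Rank (m i) (fun j => l (tagnat.Rank i j)) j y))
  = tagnat.Rank (tagnat.Rank i j) y.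
Proof.
apply: ord_inj; rewrite [RHS]tagnat.RankEsum.
apply: etrans (@tagnat.RankEsum n (fun i => (\sum_j l (tagnat.Rank i j))%N) i _)
  _.
rewrite (@tagnat.RankEsum (m i) (fun j => l (tagnat.Rank i j))) addnA; congr (_
  + _)%N.
rewrite [RHS]big_mkcond rank_sumn [RHS](bigD1 i) //= addnC; congr (_ + _)%N.
  by rewrite [LHS]big_mkcond; apply: eq_bigr => j' _; rewrite ltn_Rank2.
rewrite [LHS]big_mkcond (bigD1 i) //= ltnn add0n; apply: eq_bigr => i' ii'.
case: (ltngtP i' i) => [lt|lt|/ord_inj E]; last by rewrite E eqxx in ii'.
  by apply: eq_bigr => j' _; rewrite ltn_Rank.
by rewrite big1 // => j' _; rewrite ltnNge ltnW // ltn_Rank.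
Qed.

Lemma refine_decomp (F : fieldType) n N (m : 'I_n -> nat) (pi : 'I_N -> 'I_n)
    (rho : forall i, 'I_(m i) -> 'I_N) (B : blocks pi rho) (e : rel 'I_N) (A :
      Ost F N) :
  (forall k l, e k l -> k != l) -> reg e A ->
  exists G (Gi : forall i, Ost F (m i)), [/\ reg (off pi) G,
    forall i, reg (fun j j' => e (@rho i j) (@rho i j')) (Gi i) & A = G * bprod
      rho Gi].
Proof.
move=> en rA; have [L [G [rG eL ->]]] := reg_decomp (off pi) en rA.
have [|Gi -> rGi] := bprod_zV F B (e := e) (L := L) en.
  by apply: sub_all eL => kl; rewrite negbK.
by exists G, Gi.
Qed.

(** * Associativity with signs *)

Section Assoc.

Variables (F : fieldType) (V : superspace F) (d : {linear V -> V}).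
Hypothesis two : 2%:R != 0 :> F.
Hypothesis d_even : forall b (v : V), of_parity b v -> of_parity b (d v).
Local Notation Q n := (@Defs.qpoly F V n d).
Local Notation P n := (@Pch F V d n).
Local Notation comp := (compS two d_even).

Lemma compSA n (m : 'I_n -> nat) (l : 'I_(\sum_(i < n) m i) -> nat)
    (p : 'I_n -> bool) (q : 'I_(\sum_(i < n) m i) -> bool)
    (f : P n) (g : forall i, P (m i)) (h : forall k, P (l k)) :
  (forall i, Pch_parity _ (p i) (g i)) -> (forall k, Pch_parity _ (q k) (h k))
    ->
  (-1) ^+ eval_sign p (fun i => parity_sum (fun j => q (tagnat.Rank i j))) *:
    arity_cast (sum_arityA l)
      (comp f (fun i => comp (g i) (fun j => h (tagnat.Rank i j))))
  = comp (comp f g) h.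
Proof.
move=> gp hq; apply: Pch_hom_ext => r v H vr.
pose m' i := (\sum_(j < m i) l (tagnat.Rank i j))%N.
set e := sum_arityA l; pose c := cast_ord e; pose c' := cast_ord (esym e).
have cK : cancel c c' by move=> k; apply: ord_inj.
have c'K : cancel c' c by move=> k; apply: ord_inj.
pose pi1 := @tagnat.sig1 _ l; pose rho1 := @tagnat.Rank _ l.
pose pi2 := @tagnat.sig1 _ m; pose rho2 := @tagnat.Rank _ m.
pose pi' := @tagnat.sig1 n m' \o c'; pose rho' i := c \o @tagnat.Rank n m' i.
pose eta i := @tagnat.sig1 (m i) (fun j => l (tagnat.Rank i j)).
pose rhoi i (j : 'I_(m i)) := @tagnat.Rank (m i) (fun j => l (tagnat.Rank i j))
  j.
pose B1 : blocks pi1 rho1 := blocks_rank l.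
pose B2 : blocks pi2 rho2 := blocks_rank m.
have B' : blocks pi' rho' by exact: blocks_relabel c'K cK (blocks_rank m').
pose Bi i : blocks (@eta i) (@rhoi i) := blocks_rank _.
have RR i j y : rho' i (rhoi i j y) = rho1 (rho2 i j) y by exact: Rank_Rank.
have pi1_rho' i x : pi1 (rho' i x) = rho2 i (eta i x).
  have [y xE] := blocks_surj (Bi i) x.
  by rewrite -{1}xE RR (blocks_pi B1).
have pi12 k : pi2 (pi1 k) = pi' k.
  have [x xE] := blocks_surj B' k.
  by rewrite -{1}xE pi1_rho' (blocks_pi B2).
(* H is decomposed along the finest blocks, and its regular part A once more along the outer blocks.
   As A has no poles inside the finest blocks, each Gi has poles only between the inner blocks of
   block i. *)
have [A [fk [rA ->]]] := block_decomp B1 H.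
have off1n a b : off pi1 a b -> a != b by apply: contraNneq => ->.
have [G [Gi [rG rGi ->]]] := refine_decomp B' off1n rA.
have {}rGi i : reg (off (eta i)) (Gi i).
  apply: reg_sub (rGi i) => a b; rewrite /off !pi1_rho'.
  by rewrite (inj_eq (@blocks_inj _ _ _ _ _ B2 i)).
have rGG : reg (off pi1) (G * bprod rho' Gi).
  apply: regM; last exact: (reg_refine B2 pi1_rho' rGi).
  by apply: reg_sub rG => a b; apply: contraNneq => E; rewrite -!pi12 E.
pose x := slotvals rho1 h v fk.
pose rk k := parity_sum (fun y => r (rho1 k y)).
have xpar : forall k, q_parity (q k (+) rk k) (x k).
  exact: slotvals_parity hq vr.
pose nestx i := qrhs (eta i) (rhoi i) (g i) (fun j => x (rho2 i j)) (Gi i).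
have RHS_E : comp (comp f g) h v (G * bprod rho' Gi * bprod rho1 fk)
    = comp_sign F q r *: (comp_sign F p (fun k => q k (+) rk k) *:
        qrhs pi' rho' f nestx G).
  rewrite (compS_hom two d_even _ _ hq vr); congr (_ *: _).
  rewrite (raw_compE B1) //.
  rewrite (qrhs_hom_ext B1 (Y' := raw_comp B2 f g) (c := comp_sign F p (fun k =>
    q k (+) rk k)) rGG xpar).
    by congr (_ *: _); rewrite -(qrhs_assoc B1 B2 B' Bi pi12 pi1_rho' RR f g x
      rG rGi).
  by move=> w k wp; rewrite (compS_hom two d_even _ _ gp wp).
pose Rk i := parity_sum (fun j => rk (rho2 i j)).
(* The same factors regrouped for the other bracketing: Fi is the function received by the i-th
   inner composition. *)
pose Fi i := Gi i * bprod (@rhoi i) (fun j => fk (rho2 i j)).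
have subH : Ost_subst c' (G * bprod rho' Gi * bprod rho1 fk)
    = Ost_subst c' G * bprod (@tagnat.Rank n m') Fi.
  have rc (K : Ost F _) : reg (off c') K by exact: reg_inj (can_inj c'K).
  rewrite !Ost_substM // -mulrA; congr (_ * _); rewrite (bprodM (blocks_rank
    m')).
  congr (_ * _); rewrite Ost_subst_prod //.
    apply: eq_bigr => i _; rewrite Ost_subst_comp.
      by congr (Ost_subst _ (Gi i)); apply/funext => t; rewrite /= cK.
    by apply: reg_inj; apply: inj_comp (can_inj c'K) (@blocks_inj _ _ _ _ _ B'
      i).
  rewrite (partition_big pi2 xpredT) //=; apply: eq_bigr => i _.
  have rR i' (K : Ost F (m' i')) : reg (off (@tagnat.Rank n m' i')) K.
    by apply: reg_inj; apply: (blocks_inj (blocks_rank m')).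
  rewrite (block_bigop B2) Ost_subst_prod //; apply: eq_bigr => j _.
  rewrite !Ost_subst_comp; first last.
  - by apply: reg_inj; apply: inj_comp (can_inj c'K) (@blocks_inj _ _ _ _ _ B1
    _).
  - apply: reg_inj; apply: inj_comp (@blocks_inj _ _ _ _ _ (blocks_rank m') i)
    _.
    exact: (@blocks_inj _ _ _ _ _ (Bi i) j).
  congr (Ost_subst _ (fk _)); apply/funext => y /=.
  by rewrite -RR /= cK.
have vr' k : of_parity (r (c k)) ((v \o c) k) by exact: vr.
have gh_par i := compS_even two d_even (gp i) (fun j => hq (tagnat.Rank i j)).
have rG' : reg (off (@tagnat.sig1 n m')) (Ost_subst c' G).
  by apply: (reg_subst _ _ rG) => a b; [apply: contraNneq => -> | rewrite /off].
pose si i := comp_sign F (fun j => q (rho2 i j)) (fun y => r (c (@tagnat.Rank n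
  m' i y))).
have slotE : slotvals (@tagnat.Rank n m')
    (fun i => comp (g i) (fun j => h (tagnat.Rank i j))) (v \o c) Fi
    = fun i => si i *: nestx i.
  apply: eq_dfam => i; rewrite /slotvals.
  have vri y : of_parity (r (c (@tagnat.Rank n m' i y)))
      (((v \o c) \o @tagnat.Rank n m' i) y) by exact: vr.
  rewrite (compS_hom two d_even (g i) _ (fun j => hq (tagnat.Rank i j)) vri).
  rewrite (raw_compE (Bi i)) //; congr (_ *: _); rewrite /nestx.
  have -> // : slotvals (@rhoi i) (fun j => h (tagnat.Rank i j))
      ((v \o c) \o @tagnat.Rank n m' i) (fun j => fk (rho2 i j)) = fun j => x
        (rho2 i j).
  apply: eq_dfam => j; rewrite /x /slotvals.
  have -> // : ((v \o c) \o @tagnat.Rank n m' i) \o @rhoi i j = v \o @rho1 (rho2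
    i j).
  by apply/funext => y /=; rewrite -RR.
rewrite RHS_E -[LHS]/(_ *: (arity_cast _ _ : P _) v _) arity_castE subH.
rewrite (compS_hom two d_even f _ gh_par vr') (raw_compE (blocks_rank m')) //
  slotE.
rewrite (multilin_scale _ _ (qrhs_multilin (blocks_rank m') f rG')) !qpullZ.
have -> : qpull c' (qrhs (@tagnat.sig1 n m') (@tagnat.Rank n m') f nestx
  (Ost_subst c' G))
    = qrhs pi' rho' f nestx G.
  rewrite -(qrhs_intertwine (blocks_rank m') B' (eta := fun i => id)) //.
    have -> // : (fun i => qpull id (nestx i)) = nestx.
    by apply: eq_dfam => i; rewrite qpull_id.
  by move=> i j; rewrite /rho' /= cK.
rewrite !scalerA; congr (_ *: _).
rewrite /si /comp_sign -expr_sum -!exprD; apply: sign_eq.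
have inner i : (fun j => parity_sum (fun y => r (c (@tagnat.Rank n m' i (@rhoi i
  j y)))))
    = fun j => rk (rho2 i j).
  apply/funext => j; rewrite /rk; congr parity_sum; apply/funext => y.
  by rewrite -RR.
have outer : (fun i => parity_sum (fun y => r (c (@tagnat.Rank n m' i y)))) =
  Rk.
  apply/funext => i; rewrite /Rk -inner.
  exact/esym/(parity_sum_rank (fun y => r (c (@tagnat.Rank n m' i y)))).
have innerS : (\sum_i eval_sign (fun j => q (rho2 i j))
      (fun j => parity_sum (fun y => r (c (@tagnat.Rank n m' i (@rhoi i j
        y))))))%N
    = (\sum_i eval_sign (fun j => q (rho2 i j)) (fun j => rk (rho2 i j)))%N.
  by apply: eq_bigr => i _; rewrite inner.
rewrite innerS outer.
have splitr : (fun i => parity_sum (fun j => q (tagnat.Rank i j) (+) rk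
  (tagnat.Rank i j)))
    = fun i => parity_sum (fun j => q (rho2 i j)) (+) Rk i.
  by apply/funext => i; rewrite parity_sum_addb.
(* Moving all g_i past all vectors splits into pairs of the h_k within one block and pairs of
   different blocks; what is left is a permutation of equal terms. *)
rewrite splitr !oddD odd_eval_signDl odd_eval_signDr odd_sum.
rewrite -/rk (odd_eval_sign_rank q rk).
set a := odd (eval_sign p _); set b := odd (eval_sign p Rk).

by rewrite [RHS]addbC -[RHS]addbA; congr addb; rewrite -[LHS]addbA; congr addb;
  exact: addbC.
Qed.

End Assoc.

(** * Equivariance with signs *)

Section Equivariance.

Variables (F : fieldType) (V : superspace F) (d : {linear V -> V}).
Hypothesis two : 2%:R != 0 :> F.
Hypothesis d_even : forall b (v : V), of_parity b v -> of_parity b (d v).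
Local Notation Q n := (@Defs.qpoly F V n d).
Local Notation P n := (@Pch F V d n).
Local Notation act := (actS d_even).
Local Notation comp := (compS two d_even).

Lemma compS_equivariant n (m : 'I_n -> nat) (p : 'I_n -> bool)
    (sigma : 'S_n) (tau : forall i, 'S_(m i)) (f : P n) (g : forall i, P (m i))
      :
  (forall i, Pch_parity _ (p i) (g i)) ->
  comp (act f sigma) (fun i => act (g i) (tau i))
  = act (arity_cast (sum_arity_perm sigma)
      ((-1) ^+ perm_sign p sigma *: comp f (fun i => g ((sigma^-1)%g i))))
      (block_perm sigma tau).
Proof.
move=> gp; apply: Pch_hom_ext => r v H vr.
pose s' i := (sigma^-1)%g i; pose m' i := m (s' i).
set bp := block_perm sigma tau.
set e := sum_arity_perm sigma; pose c := cast_ord e; pose c' := cast_ord (esym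
  e).
have cK : cancel c c' by move=> k; apply: ord_inj.
have c'K : cancel c' c by move=> k; apply: ord_inj.
(* The arity cast and the block permutation are combined into a single relabelling, which maps
   blocks to blocks and restricts to the permutations tau. *)
pose th := c' \o bp; pose th' := (bp^-1)%g \o c.
have thK : cancel th th' by move=> k; rewrite /th' /th /= c'K permK.
have th'K : cancel th' th by move=> k; rewrite /th' /th /= permKV cK.
have th_inj := can_inj thK.
pose R' := @tagnat.Rank n m'; pose pi1 := @tagnat.sig1 n m'.
pose B1 : blocks pi1 R' := blocks_rank m'.
pose Bm := blocks_rank m.
pose rs i : 'I_(m' i) -> _ := @tagnat.Rank n m (s' i).
pose pis := sigma \o @tagnat.sig1 n m.
have Bs : blocks pis rs := blocks_perm Bm sigma.
have thR i (j : 'I_(m' i)) : th (rs i j) = R' i (tau (s' i) j).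
  apply: ord_inj; apply: etrans (block_permE sigma tau j) _.
  by rewrite /R' tagnat.RankEsum /s' permKV.
have pi_th k : pi1 (th k) = pis k.
  have [j kE] := blocks_surj Bs k.
  by rewrite -{1}kE thR (blocks_pi B1).
have [G [Fm [rG ->]]] := block_decomp Bm H.
have rGs : reg (off pis) G by rewrite off_perm.
pose rI i := parity_sum (fun j => r (@tagnat.Rank n m i j)).
(* The value of g_i before its variables are relabelled by tau_i; both sides are expressed through
   these. *)
pose z i := g i ((v \o @tagnat.Rank n m i) \o ((tau i)^-1)%g) (Ost_subst (tau i)
  (Fm i)).
have zpar i : q_parity (p i (+) rI i) (z i).
  rewrite /rI -(parity_sum_perm _ ((tau i)^-1)%g).
  by apply: gp => j; apply: vr.
have tzpar i : q_parity (p i (+) rI i) (qpull (tau i) (z i)).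
  exact: q_parity_pull.
pose psi i := (-1) ^+ perm_sign (fun j => r (@tagnat.Rank n m i j)) (tau i) : F.
have slotL : slotvals (@tagnat.Rank n m) (fun i => act (g i) (tau i)) v Fm
    = fun i => psi i *: qpull (tau i) (z i).
  apply: eq_dfam => i; rewrite /slotvals.
  have vri j : of_parity (r (@tagnat.Rank n m i j)) ((v \o @tagnat.Rank n m i)
    j) by exact: vr.
  exact: (actS_hom d_even (g i) (tau i) (Fm i) vri).
have gtp i : Pch_parity _ (p i) (act (g i) (tau i)) by exact: actS_even.
pose T := qrhs pi1 R' f (fun i => z (s' i)) (Ost_subst th G).
have LHS_E : comp (act f sigma) (fun i => act (g i) (tau i)) v
      (G * bprod (@tagnat.Rank n m) Fm)
    = comp_sign F p r *: ((\prod_i psi i) *: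
        ((-1) ^+ perm_sign (fun i => p i (+) rI i) sigma *: qpull th T)).
  rewrite (compS_hom two d_even _ _ gtp vr) (raw_compE Bm) // slotL.
  rewrite (multilin_scale _ _ (qrhs_multilin Bm _ rG)) (qrhs_actS d_even Bm
    sigma f rG tzpar).
  congr (_ *: (_ *: (_ *: _))).
  exact: (qrhs_intertwine B1 Bs (eta := fun i => tau (s' i)) pi_th thR f (fun i
    => z (s' i)) rGs).
rewrite LHS_E (actS_hom d_even _ bp _ vr) arity_castE.
rewrite -/c -/c' qpull_comp Ost_subst_comp; last exact: reg_inj th_inj.
rewrite -/th.
pose F' i := Ost_subst (tau (s' i)) (Fm (s' i)).
have subH : Ost_subst th (G * bprod (@tagnat.Rank n m) Fm) = Ost_subst th G *
  bprod R' F'.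
  have rt (K : Ost F _) : reg (off th) K by exact: reg_inj th_inj.
  rewrite Ost_substM //; congr (_ * _); rewrite Ost_subst_prod //.
  rewrite [LHS](reindex_inj (@perm_inj _ (sigma^-1)%g)); apply: eq_bigr => i _.
  rewrite Ost_subst_comp; last first.
    by apply: reg_inj; apply: inj_comp th_inj (@blocks_inj _ _ _ _ _ Bm _).
  rewrite /F' Ost_subst_comp; last first.
    apply: reg_inj; apply: inj_comp (@blocks_inj _ _ _ _ _ B1 i) _; exact:
      perm_inj.
  by congr (Ost_subst _ (Fm _)); apply/funext => j; apply: thR.
pose v' := (v \o (bp^-1)%g) \o c; pose r' k := r (th' k).
have vr' k : of_parity (r' k) (v' k) by exact: vr.
have gp' i : Pch_parity _ (p (s' i)) (g (s' i)) by exact: gp.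
have rG' : reg (off pi1) (Ost_subst th G).
  apply: (reg_subst _ _ rGs) => a b; first by apply: contraNneq => ->.
  by rewrite /off !pi_th.
have th'R i (j : 'I_(m' i)) : th' (R' i j) = rs i (((tau (s' i))^-1)%g j).
  by apply: th_inj; rewrite th'K thR permKV.
rewrite subH.
have -> : ((-1) ^+ perm_sign p sigma *: comp f (fun i => g (s' i)) : P _) v'
      (Ost_subst th G * bprod R' F')
    = (-1) ^+ perm_sign p sigma *: (comp_sign F (fun i => p (s' i)) r' *: T).
  rewrite -[LHS]/(_ *: (comp _ _ : P _) v' _).
  rewrite (compS_hom two d_even f _ gp' vr') (raw_compE B1) //.
  have -> // : slotvals R' (fun i => g (s' i)) v' F' = fun i => z (s' i).
  apply: eq_dfam => i; rewrite /slotvals /z.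
  have -> // : v' \o @R' i = (v \o @tagnat.Rank n m (s' i)) \o ((tau (s'
    i))^-1)%g.
  by apply/funext => j; have := th'R i j; rewrite /v' /th' /= => ->.
rewrite !qpullZ !scalerA; congr (_ *: _).
rewrite /psi /comp_sign -expr_sum -!exprD; apply: sign_eq.
have r'E : (fun i => parity_sum (fun j => r' (R' i j))) = fun i => rI (s' i).
  apply/funext => i; rewrite /rI -(parity_sum_perm _ ((tau (s' i))^-1)%g).
  by congr parity_sum; apply/funext => j; rewrite /r' th'R.
rewrite r'E !oddD odd_sum odd_perm_sign_block -/rI.
(* The signs of the tau_i occur on both sides, by [odd_perm_sign_block]; the remaining exponents are
   balanced by this identity. *)
have := odd_sign_perm p rI sigma.
set a := odd (eval_sign p rI); set b := odd _; set x := \big[addb/false]_i _.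
set y := odd (perm_sign rI sigma); set w := odd (perm_sign p sigma); set u :=
  odd (eval_sign _ _).
by case: a; case: b; case: x; case: y; case: w; case: u.
Qed.

End Equivariance.

Theorem proposition6p7 (F : fieldType) (V : superspace F)
    (d : {linear V -> V}) :
  [pchar F]%R =i pred0 ->
  (forall b v, of_parity b v -> of_parity b (d v)) ->
  exists S : operad_data (@Pch F V d),
    [/\ is_chiral_structure S,
        forall S', is_chiral_structure S' -> S' = S &
        is_superoperad (@Pch_parity F V d) S].
Proof.
move=> char0 d_even; have two : 2%:R != 0 :> F.
  by apply/negP => two0; have := char0 2; rewrite !inE two0.
have SC := structure_chiral two d_even.
exists (OperadData (@actS _ _ _ d_even) (unitS d) (@compS _ _ _ two d_even));
  split=> //.
  by move=> S' S'C; apply: (structure_unique two d_even S'C SC).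
split=> /=.
- exact: Pch_superspace.
- by move=> n sigma a X Y; apply: actS_linear.
- by move=> n sigma b X; apply: actS_even.
- by move=> n X; apply: actS1.
- by move=> n sigma tau X; apply: actSM.
- exact: compS_multilinear.
- by move=> n m b p Y X; apply: compS_even.
- by move=> n m l p q f g h; apply: compSA.
- exact: unitS_even.
- by move=> n X; apply: compS1.
- by move=> n X; apply: compS_1.
by move=> n m p sigma tau f g; apply: compS_equivariant.
Qed.
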